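(* Let $K$ be a number field, let $K=K_0\subsetneq K_1\subsetneq K_2\subsetneq \cdots$ be a nested sequence of finite extensions (all inside $\overline{\mathbb{Q}}$), and set $L=\bigcup_{i}K_i$. Suppose that $$\inf_{K_{i-1}\subsetneq M \subseteq K_i}\left(N_{K_{i-1}/\mathbb{Q}}(D_{M/K_{i-1}})\right)^{\frac{1}{[M:K_0][M:K_{i-1}]}}\longrightarrow \infty$$ as $i$ tends to infinity, where the infimum is taken over all intermediate fields $M$ with $K_{i-1}\subsetneq M\subseteq K_i$ (that is, $M$ strictly larger than $K_{i-1}$). Then the field $L$ has the Northcott property.
   Context: All fields lie in a fixed algebraic closure $\overline{\mathbb{Q}}$ of $\mathbb{Q}$. $H(\cdot)$ denotes the non-logarithmic absolute Weil height on $\overline{\mathbb{Q}}$: for $\alpha$ in a number field $F$, $H(\alpha)=\prod_v \max\{1,|\alpha|_v\}^{[F_v:\mathbb{Q}_v]/[F:\mathbb{Q}]}$, the product over all places $v$ of $F$, with $|\cdot|_v$ extending the usual absolute values of $\mathbb{Q}$. A subset $\mathcal{A}\subseteq\overline{\mathbb{Q}}$ has the Northcott property (property $(N)$) if for each positive real $X$ there are only finitely many $\alpha\in\mathcal{A}$ with $H(\alpha)\le X$. For number fields $F\subseteq M$, $D_{M/F}$ denotes the relative discriminant ideal of $M/F$ (of the ring of integers $\mathcal{O}_M$ relative to $F$), an integral ideal of $\mathcal{O}_F$. For a non-zero fractional ideal $\mathfrak{B}$ of $\mathcal{O}_F$, $N_{F/\mathbb{Q}}(\mathfrak{B})$ denotes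 the ideal norm from $F$ to $\mathbb{Q}$, interpreted as the unique positive rational generator of that principal ideal. *)

(* Defs.v *)
(* The algebraic closure of Q is algC, and all fields are subsets of algC. *)
From HB Require Import structures.
From mathcomp Require Import all_boot all_order all_algebra all_field.
From mathcomp Require Import all_classical all_reals all_analysis.
Set Implicit Arguments.
Unset Strict Implicit.
Unset Printing Implicit Defensive.
Import Order.TTheory GRing.Theory Num.Theory.
Import numFieldNormedType.Exports.
Local Open Scope classical_set_scope.
Local Open Scope ring_scope.

Definition is_subfield (F : set algC) : Prop :=
  divring_closed [pred x | x \in F].

Definition QQ : set algC := range (ratr : rat -> algC).

Definition is_basis (E F : set algC) n (b : 'I_n -> algC) : Prop :=
  [/\ forall i, F (b i),
      forall x, F x -> exists c : 'I_n -> algC,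
        (forall i, E (c i)) /\ x = \sum_(i < n) c i * b i
    & forall c : 'I_n -> algC, (forall i, E (c i)) ->
        \sum_(i < n) c i * b i = 0 -> forall i, c i = 0].

Definition has_degree (E F : set algC) (n : nat) : Prop :=
  exists b : 'I_n -> algC, is_basis E F b.

Definition finite_extension (E F : set algC) : Prop :=
  [/\ is_subfield E, is_subfield F, E `<=` F & exists n, has_degree E F n].

Definition number_field (F : set algC) : Prop := finite_extension QQ F.

(* [F : E]; the value 0 is only taken when F is not finite over E. *)
Definition degree (E F : set algC) : nat := xget 0%N (has_degree E F).

Definition coords (E : set algC) n (b : 'I_n -> algC) (x : algC) :
    'I_n -> algC :=
  xget (fun=> 0)
    [set c | (forall i, E (c i)) /\ x = \sum_(i < n) c i * b i].

(* Row i holds the coordinates of x * b i, so this is the transpose of the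
   usual matrix of multiplication by x; trace and determinant agree. *)
Definition mul_matrix (E : set algC) n (b : 'I_n -> algC) (x : algC) :
    'M[algC]_n :=
  \matrix_(i, j) coords E b (x * b i) j.

(* The trace and norm of x from F to E do not depend on the basis. *)
Definition rel_trace (E F : set algC) (x : algC) : algC :=
  xget 0 [set t | exists n (b : 'I_n -> algC),
                    is_basis E F b /\ t = \tr (mul_matrix E b x)].

Definition rel_norm (E F : set algC) (x : algC) : algC :=
  xget 0 [set t | exists n (b : 'I_n -> algC),
                    is_basis E F b /\ t = \det (mul_matrix E b x)].

Definition integers (F : set algC) : set algC :=
  [set x | F x /\ x \in Aint].

(* The O_F-submodule of algC generated by S. *)
Definition ideal_span (F S : set algC) : set algC :=
  [set x | exists n (r s : 'I_n -> algC),
     [/\ forall i, integers F (r i), forall i, S (s i)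
       & x = \sum_(i < n) r i * s i]].

Definition basis_disc (E F : set algC) n (b : 'I_n -> algC) : algC :=
  \det (\matrix_(i < n, j < n) rel_trace E F (b i * b j)).

(* D_{F/E}: the ideal of O_E generated by the discriminants of all the bases
   of F over E contained in O_F. *)
Definition rel_disc (E F : set algC) : set algC :=
  ideal_span E
    [set d | exists n (b : 'I_n -> algC),
       [/\ is_basis E F b, forall i, integers F (b i)
         & d = basis_disc E F b]].

(* N_{F/Q}(B) is the fractional ideal of Z (= integers QQ) generated by the
   norms of the elements of B; ideal_norm is its positive generator. *)
Definition ideal_norm (F B : set algC) : rat :=
  xget 0 [set q : rat | 0 < q /\
    ideal_span QQ [set rel_norm QQ F x | x in B]
      = ideal_span QQ [set ratr q]].

Section Height.
Variable R : realType.
Implicit Types (F A : set algC) (v : algC -> R).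

Definition padic_abs (p : nat) (q : rat) : R :=
  if q == 0 then 0
  else p%:R ^+ logn p `|denq q|%N / p%:R ^+ logn p `|numq q|%N.

(* Absolute values on F are encoded as functions on algC that vanish outside F,
   so that distinct functions are distinct absolute values on F. *)
Definition absolute_value F v : Prop :=
  [/\ forall x, ~ F x -> v x = 0,
      forall x, F x -> 0 <= v x,
      forall x, F x -> (v x = 0 <-> x = 0),
      forall x y, F x -> F y -> v (x * y) = v x * v y
    & forall x y, F x -> F y -> v (x + y) <= v x + v y].

(* Each place of a number field (class of nontrivial absolute values) contains
   exactly one absolute value extending one of the usual ones of Q. *)
Definition places F : set (algC -> R) :=
  [set v | absolute_value F v /\
     ((forall q : rat, v (ratr q) = `|ratr q|) \/
      (exists p : nat, prime p /\
         forall q : rat, v (ratr q) = padic_abs p q))].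

Definition cauchy_in F v (x : nat -> algC) : Prop :=
  (forall k, F (x k)) /\
  (forall e : R, 0 < e -> exists N : nat, forall k l,
     (N <= k)%N -> (N <= l)%N -> v (x k - x l) < e).

Definition null_seq v (x : nat -> algC) : Prop :=
  v (x k) @[k --> \oo] --> (0 : R).

(* F_v is represented by the Cauchy sequences in F modulo null sequences, and
   Q_v by the Cauchy sequences in Q: the family b of elements of F_v is a basis
   of F_v over Q_v. *)
Definition is_local_basis F v n (b : 'I_n -> nat -> algC) : Prop :=
  [/\ forall i, cauchy_in F v (b i),
      forall x, cauchy_in F v x -> exists c : 'I_n -> nat -> algC,
        (forall i, cauchy_in QQ v (c i)) /\
        null_seq v (fun k => x k - \sum_(i < n) c i k * b i k)
    & forall c : 'I_n -> nat -> algC, (forall i, cauchy_in QQ v (c i)) ->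
        null_seq v (fun k => \sum_(i < n) c i k * b i k) ->
        forall i, null_seq v (c i)].

(* [F_v : Q_v] *)
Definition local_degree F v : nat :=
  xget 0%N [set n | exists b : 'I_n -> nat -> algC, is_local_basis F v b].

(* For a in F only finitely many factors differ from 1, so that the finitely
   supported product below is the product over all the places. *)
Definition height_in F (a : algC) : R :=
  \big[*%R/1]_(v \in places F)
    (Num.max 1 (v a)) `^ ((local_degree F v)%:R / (degree QQ F)%:R).

(* Q(a) *)
Definition adjoin_Q (a : algC) : set algC :=
  \bigcap_(F in [set F | is_subfield F /\ F a]) F.

(* height_in F a is the same for all the number fields F containing a. *)
Definition height (a : algC) : R := height_in (adjoin_Q a) a.

Definition northcott A : Prop :=
  forall X : R, 0 < X -> finite_set [set a | A a /\ height a <= X].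

(* The infimum over the fields M with E < M <= F of
   N_{E/Q}(D_{M/E})^(1 / ([M : K0] [M : E])). *)
Definition inf_disc (K0 E F : set algC) : R :=
  inf [set r : R | exists M : set algC,
     [/\ is_subfield M, E `<` M, M `<=` F
       & r = (ratr (ideal_norm E (rel_disc E M)))
               `^ ((degree K0 M)%:R * (degree E M)%:R)^-1]].

End Height.

(* Main.v *)
Require Import Defs.
From HB Require Import structures.
From mathcomp Require Import all_boot all_order all_algebra all_fingroup all_field.
From mathcomp Require Import all_classical all_reals all_analysis.
From mathcomp Require Import ring lra zify.
Import Order.TTheory GRing.Theory Num.Theory.
Import numFieldNormedType.Exports.
Local Open Scope classical_set_scope.
Local Open Scope ring_scope.

(* Widmer's argument. Let a in L have height at most X, let E = K_(i-1) and
   M = E(a) with a in K_i but not in E, and let d = [M : E]. A basis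
   c, c a, ..., c a^(d-1) has discriminant N(c)^2 V^2, with V the Vandermonde
   determinant of the conjugates of a over E. For each prime p, some c makes the
   basis p-integral with |c|_w = max(1,|a|_w)^-(d-1) at all the places w above
   p, so that the p-part of N(D_{M/E}) is at most a product of local factors of
   H(a). Comparing with the archimedean absolute values of V through the product
   formula gives N(D_{M/E}) <= d!^(...) H(a)^(...), hence
   N(D_{M/E})^(1/([M:K][M:E])) <= (2 max(1,X))^(2 [K:Q]). By hypothesis this
   only occurs for finitely many i, and Northcott's theorem for number fields
   concludes.

   The absolute values are taken on a fixed Galois closure N, as w o g for g in
   Gal(N/Q), with w a single absolute value of algC for each place of Q (for a
   prime p, it comes from a maximal subring of algC without 1/p). The only fact
   needed on the height is that H(a)^|Gal(N/Q)| is at least any finite product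
   of the factors max(1, w(g a)), which follows from the local degree being at
   least the number of embeddings inducing a given place. *)

Set Implicit Arguments.
Unset Strict Implicit.
Unset Printing Implicit Defensive.

(** * Subfields of algC and Galois theory *)

(** The scaling factor c has to depend on the prime: one element with the prescribed absolute value
    at every finite place would generate the (d-1)-th power of the denominator ideal of a, and that
    ideal need not be principal. Nothing is lost, because N(D_{M/E}) divides the norm of every
    discriminant, so each prime may use its own basis, and a single rational number, [rho] in
    [ideal_norm_bound], collects the local estimates.

    The exponents explain the shape of the hypothesis. Put e = [K:Q], m = [M:K] and f = [N:M]. Then
    Gal(N/Q) has order e m f and Gal(N/E) has order d f, and the estimate reads N(D)^(d f) <= d!^(2
    e m f) H(a)^(2 e m f d (d-1)). Extracting the root of order (m d)(d f), that is, raising N(D) to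
    1/([M:K][M:E]), leaves H(a) with exponent 2 e (d-1)/d < 2 e and d! with exponent 2 e/d^2. Since
    d! <= 2^(d^2), the result is bounded independently of i, M and N. *)

Section Subfield.
Variable F : set algC.
Hypothesis hF : is_subfield F.

Lemma subfield1 : F 1.
Proof. by have [] := hF; rewrite !inE. Qed.

Lemma subfieldB x y : F x -> F y -> F (x - y).
Proof.
by case: hF => _ h _ Fx Fy; move: (h x y); rewrite !inE; apply.
Qed.

Lemma subfield_div x y : F x -> F y -> F (x / y).
Proof.
by case: hF => _ _ h Fx Fy; move: (h x y); rewrite !inE; apply.
Qed.

Lemma subfield0 : F 0.
Proof. by rewrite -(subrr 1); apply: subfieldB; exact: subfield1. Qed.

Lemma subfieldN x : F x -> F (- x).
Proof. by move=> Fx; rewrite -sub0r; apply: subfieldB => //; exact: subfield0. Qed.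

Lemma subfieldD x y : F x -> F y -> F (x + y).
Proof. by move=> Fx Fy; rewrite -[y]opprK; apply/subfieldB/subfieldN. Qed.

Lemma subfieldV x : F x -> F x^-1.
Proof. by move=> Fx; rewrite -div1r; apply: subfield_div => //; exact: subfield1. Qed.

Lemma subfieldM x y : F x -> F y -> F (x * y).
Proof. by move=> Fx Fy; rewrite -[y]invrK; apply/subfield_div/subfieldV. Qed.

Lemma subfield_sum I (r : seq I) (P : pred I) (f : I -> algC) :
  (forall i, P i -> F (f i)) -> F (\sum_(i <- r | P i) f i).
Proof. move=> h; apply: big_ind => //; [exact: subfield0|exact: subfieldD]. Qed.

Lemma subfield_prod I (r : seq I) (P : pred I) (f : I -> algC) :
  (forall i, P i -> F (f i)) -> F (\prod_(i <- r | P i) f i).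
Proof. move=> h; apply: big_ind => //; [exact: subfield1|exact: subfieldM]. Qed.

Lemma subfieldX x n : F x -> F (x ^+ n).
Proof. by move=> Fx; rewrite -[n]card_ord -prodr_const; exact: subfield_prod. Qed.

Lemma subfield_nat n : F n%:R.
Proof. by rewrite -[n]card_ord -sumr_const; apply: subfield_sum => _ _; exact: subfield1. Qed.

Lemma subfield_int (m : int) : F m%:~R.
Proof.
case: m => n; first exact: subfield_nat.
by rewrite NegzE mulrNz; apply: subfieldN; exact: subfield_nat.
Qed.

Lemma subfield_rat (q : rat) : F (ratr q).
Proof. by apply: subfield_div; exact: subfield_int. Qed.

Lemma subfield_det n (A : 'M[algC]_n) : (forall i j, F (A i j)) -> F (\det A).
Proof.
move=> h; apply: subfield_sum => s _; apply: subfieldM; last exact: subfield_prod.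
by apply/subfieldX/subfieldN/subfield1.
Qed.

End Subfield.

Lemma subfieldP (F : set algC) : F 1 -> (forall x y, F x -> F y -> F (x - y)) ->
  (forall x y, F x -> F y -> F (x / y)) -> is_subfield F.
Proof.
by move=> h1 h2 h3; split=> [|x y|x y]; rewrite !inE /=; [|exact: h2|exact: h3].
Qed.

Lemma QQ_subfield : is_subfield QQ.
Proof.
apply: subfieldP => [|_ _ [x _ <-] [y _ <-]|_ _ [x _ <-] [y _ <-]].
- by exists 1 => //; rewrite rmorph1.
- by exists (x - y) => //; rewrite rmorphB.
- by exists (x / y) => //; rewrite fmorph_div.
Qed.

(* The maps are automorphisms of algC, extended arbitrarily from the Galois
   group of [gal_set]: they compose like the elements of [gal_gT] only on
   [gal_set]. *)
Record galois_field := GaloisField {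
  gal_gT : finGroupType;
  gal_set :> set algC;
  gal_map : gal_gT -> {rmorphism algC -> algC};
  gal_subfield : is_subfield gal_set;
  gal_stable : forall g x, gal_set x -> gal_set (gal_map g x);
  gal_map1 : forall x, gal_set x -> gal_map 1%g x = x;
  gal_mapM : forall g h x, gal_set x ->
    gal_map (g * h)%g x = gal_map h (gal_map g x);
  gal_fixed : forall E x, is_subfield E -> E `<=` gal_set -> gal_set x ->
    (forall g, (forall y, E y -> gal_map g y = y) -> gal_map g x = x) -> E x
}.

(** The list is first closed under conjugation: the number field generated by [t] is then the
    splitting field of the product of the minimal polynomials of the elements of [s]. *)
Lemma splitting_field_exists (s : seq algC) :
  exists (L : splittingFieldType rat) (LC : {rmorphism L -> algC}),
    forall x, x \in s -> exists y, LC y = x.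
Proof.
pose t := flatten [seq sval (closed_field_poly_normal (minCpoly x : {poly algC})) | x <- s].
have [Qr [QrC [rr Drr genQr]]] := num_field_exists t.
have hsub x : x \in s -> x \in t.
  move=> xs; apply/flattenP; eexists; first by apply: map_f xs.
  case: closed_field_poly_normal => r /= Dr.
  have [q [Dq mq] hq] := minCpolyP x.
  have := root_minCpoly x; rewrite Dr rootZ ?root_prod_XsubC //.
  by rewrite lead_coef_eq0 monic_neq0 // Dq map_monic.
pose p := \prod_(x <- s) (map_poly (in_alg Qr) (sval (minCpolyP x))).
have hp : splittingFieldFor 1 p {:Qr}.
  exists rr => //; apply/eqpP; exists (1, 1); rewrite ?oner_eq0 //= !scale1r.
  apply: (map_poly_inj QrC); rewrite !rmorph_prod /=.
  transitivity (\prod_(x <- t) ('X - x%:P)); last first.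
    by rewrite -Drr big_map; apply: eq_bigr => i _; rewrite map_polyXsubC.
  rewrite /t big_flatten big_map; apply: eq_bigr => x _.
  rewrite -map_poly_comp; case: closed_field_poly_normal => r /= Dr.
  case: minCpolyP => q /= [Dq mq] _.
  have -> : map_poly (QrC \o in_alg Qr) q = minCpoly x.
    by rewrite Dq; apply: eq_map_poly => a /=; rewrite rmorphZ_num rmorph1 mulr1.
  by rewrite Dr Dq lead_coef_map (monicP mq) rmorph1 scale1r.
have hS : SplittingField.axiom Qr.
  exists p => //; apply: rpred_prod => x _; apply/polyOverP => i.
  by rewrite coef_map /= memvZ ?memv_line.
pose M := FieldExt_isSplittingField.Build _ Qr hS.
pose L : splittingFieldType rat := HB.pack (FieldExt.sort Qr) M.
exists L, QrC => x /hsub; rewrite -Drr => /mapP[y _ ->].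
by exists y.
Qed.

Lemma galois_field_exists (s : seq algC) :
  exists N : galois_field, forall x, x \in s -> gal_set N x.
Proof.
have [L [LC hs]] := splitting_field_exists s.
pose N : set algC := range LC.
have Nsub : is_subfield N.
  apply: subfieldP => [|_ _ [x _ <-] [y _ <-]|_ _ [x _ <-] [y _ <-]].
  - by exists 1 => //; rewrite rmorph1.
  - by exists (x - y) => //; rewrite rmorphB.
  - by exists (x / y) => //; rewrite fmorph_div.
pose gT : finGroupType := gal_of {:L}.
have inL (x : L) : x \in {:L}%VS by rewrite memvf.
pose gr (g : gT) : {rmorphism L -> L} := gal_repr g : {rmorphism L -> L}.
pose nu (g : gT) := sval (extend_algC_subfield_aut LC (gr g)).
have nuE (g : gT) x : nu g (LC x) = LC (g x).
  by rewrite /nu; case: extend_algC_subfield_aut => /= mu <-.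
have nuS g x : N x -> N (nu g x) by case=> y _ <-; rewrite nuE; exists (g y).
have nu1 x : N x -> nu 1%g x = x by case=> y _ <-; rewrite nuE gal_id.
have nuM g h x : N x -> nu (g * h)%g x = nu h (nu g x).
  by case=> y _ <-; rewrite !nuE galM.
have nuF E x : is_subfield E -> E `<=` N -> N x ->
    (forall g, (forall y, E y -> nu g y = y) -> nu g x = x) -> E x.
  move=> hE EN [x0 _ <-] hx.
  (* [E] is only a set. A rational subspace of largest dimension whose image lies in [E] is its
     whole preimage, which turns [E] into a subfield of [L] to which the Galois correspondence
     applies. *)
  pose P d := `[< exists U : {vspace L}, (forall u, u \in U -> E (LC u)) /\ \dim U = d >].
  have exP : exists d, P d.
    exists 0%N; apply/asboolP; exists 0%VS; split; last exact: dimv0.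
    by move=> u; rewrite memv0 => /eqP->; rewrite rmorph0; exact: subfield0.
  have bP d : P d -> (d <= \dim {:L})%N.
    by move=> /asboolP[U [_ <-]]; apply/dimvS/subvf.
  case: (ex_maxnP exP bP) => d /asboolP[U [UE dU]] dmax.
  have EU u : E (LC u) -> u \in U.
    move=> Eu; have : P (\dim (U + <[u]>)).
      apply/asboolP; exists (U + <[u]>)%VS; split => // _ /memv_addP[v vU [w /vlineP[k ->] ->]].
      rewrite rmorphD /= rmorphZ_num; apply: subfieldD => //; first exact: UE.
      by apply: subfieldM => //; exact: subfield_rat.
    move=> /dmax; rewrite -dU (geq_leqif (dimv_leqif_sup (addvSl _ _))).
    by rewrite subv_add => /andP[_]; rewrite -memvE.
  have aU : is_aspace U.
    rewrite /is_aspace has_algid1; last by apply: EU; rewrite rmorph1; exact: subfield1.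
    by apply/prodvP => u v uU vU; apply: EU; rewrite rmorphM; apply: subfieldM => //; exact: UE.
  pose K : {subfield L} := ASpace aU.
  have gK : galois K {:L}.
    rewrite /galois subvf normalFieldf andbT.
    apply/(@separable.separableP _ _ K) => y _; apply: pcharf0_separable => p.
    by rewrite -(fmorph_pchar LC) pchar_num.
  apply: UE; rewrite -[U]/(K : {vspace L}) -(galois_fixedField gK).
  apply/fixedFieldP => // g gG; apply: (fmorph_inj LC).
  rewrite -nuE; apply: hx => y Ey; have [z _ Dz] := EN y Ey.
  by rewrite -Dz nuE (fixed_gal _ gG) ?subvf //; apply: EU; rewrite Dz.
exists (@GaloisField gT N nu Nsub nuS nu1 nuM nuF) => x /hs[y <-].
by exists y.
Qed.

(** Gaussian elimination, which keeps the solution inside [F]: a nonzero pivot in column [ord0]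
    removes one unknown and one equation, and the coordinate at [i0] is then chosen to satisfy the
    removed equation. *)
Lemma subfield_relation (F : set algC) k m (A : 'I_m -> 'I_k -> algC) :
  is_subfield F -> (forall i j, F (A i j)) -> (k < m)%N ->
  exists y : 'I_m -> algC, [/\ forall i, F (y i), exists i, y i != 0 &
    forall j, \sum_i y i * A i j = 0].
Proof.
move=> hF; elim: k m A => [|k IHk] [//|m] A FA km.
  exists (fun=> 1); split => [i||[]//]; first exact: subfield1.
  by exists ord0; exact: oner_neq0.
have [A0|/existsNP[i0 /eqP A0]] := pselect (forall i, A i ord0 = 0).
  have [|y [Fy y0 hy]] := IHk _ (fun i j => A i (lift ord0 j)) _ (ltnW km).
    by move=> i j; exact: FA.
  exists y; split => // j; case: (unliftP ord0 j) => [j' ->|->]; first exact: hy.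
  by rewrite big1 // => i _; rewrite A0 mulr0.
pose B i j := A (lift i0 i) (lift ord0 j) -
   A (lift i0 i) ord0 / A i0 ord0 * A i0 (lift ord0 j).
have [|y [Fy [i1 y1] hy]] := IHk m B _ km.
  by move=> i j; apply: subfieldB => //; apply: subfieldM => //; apply: subfield_div.
pose s := \sum_i y i * (A (lift i0 i) ord0 / A i0 ord0).
pose z i := if unlift i0 i is Some i' then y i' else - s.
exists z; split.
- move=> i; rewrite /z; case: unlift => //; apply: subfieldN => //.
  by apply: subfield_sum => // i' _; apply: subfieldM => //; apply: subfield_div.
- by exists (lift i0 i1); rewrite /z liftK.
move=> j; rewrite (bigD1_ord i0) //= /z unlift_none.
under eq_bigr do rewrite liftK.
case: (unliftP ord0 j) => [j' ->|->].
  rewrite mulNr mulr_suml addrC -sumrB -[RHS](hy j'); apply: eq_bigr => i _.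
  by rewrite /B mulrBr !mulrA.
rewrite mulNr mulr_suml addrC -sumrB big1 // => i _.
by rewrite -!mulrA mulVf // mulr1 subrr.
Qed.

(** Artin's argument: evaluating the relation at [z * x] and subtracting [nu i z] times the original
    one removes the index [i], and multiplies the coefficient at [j] by a nonzero factor when [z]
    separates [i] from [j]. *)
Lemma embedding_independence (T : finType) (nu : T -> {rmorphism algC -> algC})
    (M : set algC) (J : {set T}) (y : T -> algC) :
    is_subfield M ->
    (forall i j, i \in J -> j \in J -> i != j -> exists2 z, M z & nu i z != nu j z) ->
    (forall x, M x -> \sum_(j in J) y j * nu j x = 0) ->
  forall j, j \in J -> y j = 0.
Proof.
move=> hM; have [n] := ubnP #|J|; elim: n => // n IHn in J y *.
move=> Jn sepJ hy.
have key i j : i \in J -> j \in J -> i != j -> y j = 0.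
  move=> iJ jJ ij; have [z Mz hz] := sepJ i j iJ jJ ij.
  suff: y j * (nu j z - nu i z) = 0.
    by move=> /eqP; rewrite mulf_eq0 subr_eq0 (eq_sym (nu j z)) (negPf hz) orbF => /eqP.
  apply: (IHn (J :\ i) (fun j => y j * (nu j z - nu i z))).
  - by rewrite (cardsD1 i) iJ in Jn.
  - by move=> i' j' /setD1P[_ ?] /setD1P[_ ?]; exact: sepJ.
  - move=> x Mx.
    have : \sum_(j in J) y j * nu j (z * x) - nu i z * (\sum_(j in J) y j * nu j x) = 0.
      by rewrite !hy ?mulr0 ?subrr //; exact: subfieldM.
    rewrite mulr_sumr -sumrB (big_setD1 i) //= => h.
    rewrite -[RHS]h rmorphM mulrCA subrr add0r; apply: eq_bigr => j' _.
    by rewrite rmorphM; ring.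
  - by rewrite in_setD1 eq_sym ij jJ.
move=> j jJ; have [[i [iJ ij]]|ne] := pselect (exists i, i \in J /\ i != j).
  exact: (key i).
have -> : y j = \sum_(i in J) y i * nu i 1.
  rewrite (big_setD1 j) //= rmorph1 mulr1 big1 ?addr0 // => i /setD1P[ij iJ].
  by case: ne; exists i.
by apply: hy; exact: subfield1.
Qed.

(** * Galois correspondence, embeddings, traces and norms inside a Galois closure *)

Section GaloisTheory.
Variable N : galois_field.
Local Notation gT := (gal_gT N).
Local Notation nu := (@gal_map N).

(** Restricting to points of [gal_set N] makes this a group for every set [E], since the maps
    compose like the group elements only there. *)
Definition fixing (E : set algC) : {set gT} :=
  [set g | `[< forall x, gal_set N x -> E x -> nu g x = x >]].

Lemma fixingP E g : E `<=` gal_set N ->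
  reflect (forall x, E x -> nu g x = x) (g \in fixing E).
Proof.
move=> EN; rewrite inE; apply: (iffP (asboolP _)) => h x; last by move=> _; exact: h.
by move=> Ex; apply: h => //; exact: EN.
Qed.

Lemma galMV g x : gal_set N x -> nu g^-1%g (nu g x) = x.
Proof. by move=> Nx; rewrite -gal_mapM // mulgV gal_map1. Qed.

Lemma fixing_group_set E : group_set (fixing E).
Proof.
apply/group_setP; split=> [|g h]; rewrite !inE.
  by apply/asboolP => x Nx _; rewrite gal_map1.
move=> /asboolP hg /asboolP hh; apply/asboolP => x Nx Ex.
by rewrite gal_mapM // hg // hh.
Qed.
Canonical fixing_group E := Group (fixing_group_set E).

Lemma fixingS E M : E `<=` M -> fixing M \subset fixing E.
Proof.
move=> EM; apply/fintype.subsetP => g; rewrite !inE => /asboolP h.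
by apply/asboolP => x Nx Ex; exact/h/EM.
Qed.

Lemma QQ_sub F : is_subfield F -> QQ `<=` F.
Proof. by move=> hF _ [q _ <-]; exact: subfield_rat. Qed.

Lemma fixing_QQ : fixing QQ = [set: gT]%SET.
Proof.
apply/setP => g; rewrite !inE; apply/asboolP => x _ [q _ <-].
by rewrite fmorph_rat.
Qed.

Lemma fixed_QQ x : gal_set N x -> (forall g, nu g x = x) -> QQ x.
Proof.
move=> Nx hx; apply: (@gal_fixed N) => //; first exact: QQ_subfield.
by apply: QQ_sub; exact: gal_subfield.
Qed.

(* [t] represents the cosets of [fixing M] in [fixing E], that is, the
   embeddings of [M] over [E]. *)
Record embeddings_spec (E M : set algC) k (t : 'I_k -> gT) : Prop := {
  embed_in : forall j, t j \in fixing E;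
  embed_sep : forall i j, i != j -> exists2 z, M z & nu (t i) z != nu (t j) z;
  embed_onto : forall g, g \in fixing E -> exists j, forall z, M z -> nu g z = nu (t j) z;
  embed_big : forall T (idx : T) (op : Monoid.com_law idx) (f : gT -> T),
    (forall g h, (forall z, M z -> nu g z = nu h z) -> f g = f h) ->
    \big[op/idx]_(g in fixing E) f g =
    \big[op/idx]_(j < k) iter #|fixing M| (op (f (t j))) idx
}.

Lemma embeddings_exist E M : E `<=` M -> M `<=` gal_set N ->
  exists t : 'I_#|fixing E : fixing M|%g -> gT, embeddings_spec E M t.
Proof.
move=> EM MN; have MsE := fixingS EM.
have agree g h : (forall z, M z -> nu g z = nu h z) <-> g \in (fixing M :* h)%g.
  rewrite mem_rcoset; split => [hz|/(fixingP _ MN) hz z Mz].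
    apply/fixingP => // z Mz; rewrite gal_mapM ?hz ?galMV //; exact: MN.
  rewrite -{1}[g](mulgKV h) gal_mapM ?hz //; exact: MN.
pose t (j : 'I_(#|rcosets (fixing M) (fixing E)|%g)) := repr (enum_val j).
have tP (j : 'I_#|rcosets (fixing M) (fixing E)|) :
    exists2 g, g \in fixing E & enum_val j = (fixing M :* g)%g.
  exact/rcosetsP/enum_valP.
have tM (j : 'I_#|rcosets (fixing M) (fixing E)|) : enum_val j = (fixing M :* t j)%g.
  have [g gE Dg] := tP j; rewrite Dg; apply/esym/rcoset_eqP.
  by rewrite /t Dg mem_repr_rcoset.
have tE (j : 'I_#|rcosets (fixing M) (fixing E)|) : t j \in fixing E.
  have [g gE Dg] := tP j; have : t j \in (fixing M :* g)%g by rewrite /t Dg mem_repr_rcoset.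
  by case/rcosetP => h hM ->; rewrite groupM // (fintype.subsetP MsE).
exists t; split => //.
- move=> i j ij; apply: contrapT => h; case/eqP: ij; apply: enum_val_inj.
  rewrite !tM; apply: rcoset_eqP; apply/agree => z Mz; apply: contrapT => hz.
  by case: h; exists z => //; exact/eqP.
- move=> g gE; have gr : (fixing M :* g)%g \in rcosets (fixing M) (fixing E).
    by rewrite mem_rcosets mulSGid.
  exists (enum_rank_in gr ((fixing M :* g)%g)); apply/agree/rcoset_eqP.
  by rewrite -tM enum_rankK_in.
- move=> T idx op f hf.
  have P := rcosets_partition MsE.
  rewrite (set_partition_big _ P) /= big_enum_val; apply: eq_bigr => j _.
  rewrite tM; transitivity (\big[op/idx]_(g in (fixing M :* t j)%g) f (t j)).
    by apply: eq_bigr => g /agree; exact: hf.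
  by rewrite big_const card_rcoset.
Qed.

Section Tower.
Variables (E M : set algC).
Hypotheses (hE : is_subfield E) (hM : is_subfield M).
Hypotheses (EM : E `<=` M) (MN : M `<=` gal_set N).

Lemma embed_card k (t : 'I_k -> gT) : embeddings_spec E M t ->
  #|fixing E| = (k * #|fixing M|)%N.
Proof.
move=> ht; rewrite -sum1_card (embed_big ht) //= -[k in RHS]card_ord -sum_nat_const.
by apply: eq_bigr => i _; elim: #|fixing M| => //= n ->.
Qed.

Lemma embed_sum k (t : 'I_k -> gT) x : embeddings_spec E M t -> M x ->
  \sum_(g in fixing E) nu g x = (\sum_j nu (t j) x) *+ #|fixing M|.
Proof.
move=> ht Mx; rewrite -sumrMnl (embed_big ht) => [|g h]; last exact.
by apply: eq_bigr => j _; exact: iter_addr_0.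
Qed.

Lemma embed_prod (T : comPzSemiRingType) k (t : 'I_k -> gT) (f : algC -> T) x :
  embeddings_spec E M t -> M x ->
  \prod_(g in fixing E) f (nu g x) = (\prod_j f (nu (t j) x)) ^+ #|fixing M|.
Proof.
move=> ht Mx; rewrite -prodrXl (embed_big ht) => [|g h hgh]; last by rewrite hgh.
by apply: eq_bigr => j _; exact: iter_mulr_1.
Qed.

Lemma trace_fixed x : gal_set N x -> E (\sum_(g in fixing E) nu g x).
Proof.
have EN : E `<=` gal_set N by apply: subset_trans MN.
move=> Nx; apply: (@gal_fixed N) => //.
  by apply: subfield_sum => [|g _]; [exact: gal_subfield|exact: gal_stable].
move=> h hh; have hE' : h \in fixing E by apply/fixingP.
rewrite rmorph_sum /= [RHS](reindex_inj (mulIg h)) /=.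
by apply: eq_big => [g|g _]; rewrite ?groupMr // gal_mapM.
Qed.

Section Basis.
Variables (k : nat) (t : 'I_k -> gT).
Hypothesis ht : embeddings_spec E M t.

Lemma embed_independent (y : 'I_k -> algC) :
  (forall x, M x -> \sum_j y j * nu (t j) x = 0) -> forall j, y j = 0.
Proof.
move=> hy j; apply: (@embedding_independence _ (fun j => nu (t j)) M [set: 'I_k]%SET) => //.
  by move=> i i' _ _ ne; have [z ? ?] := embed_sep ht ne; exists z.
by move=> x Mx; rewrite -[RHS](hy x Mx); apply: eq_bigl => i; rewrite inE.
Qed.

Variables (n : nat) (b : 'I_n -> algC).
Hypothesis hb : is_basis E M b.

Lemma basis_relation (y : 'I_k -> algC) :
  (forall i, \sum_j y j * nu (t j) (b i) = 0) -> forall j, y j = 0.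
Proof.
case: hb => _ span _ hy; apply: embed_independent => _ /span[c [Ec ->]].
under eq_bigr do rewrite rmorph_sum mulr_sumr.
rewrite exchange_big big1 //= => i _.
transitivity (c i * \sum_j y j * nu (t j) (b i)); last by rewrite hy mulr0.
rewrite mulr_sumr; apply: eq_bigr => j _; rewrite rmorphM mulrCA; congr (_ * _).
have EN : E `<=` gal_set N by apply: subset_trans MN.
by have /(fixingP _ EN)-> := embed_in ht j.
Qed.

(** One inequality is the independence of the embeddings. For the other, a relation between the
    vectors of conjugates of the [b i], normalized to coefficient 1 at [i0] and averaged over
    [fixing E], becomes a relation over [E] between the [b i] whose coefficient at [i0] is the order
    of the group. *)
Lemma basis_size : k = n.
Proof.
have EN : E `<=` gal_set N by apply: subset_trans MN.
have [Mb span free] := hb.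
have Nnu g i : gal_set N (nu g (b i)) by apply/gal_stable/MN.
apply/eqP; rewrite eqn_leq; apply/andP; split; rewrite leqNgt; apply/negP => lt.
  have [y [_ [j /eqP yj] /basis_relation-/(_ j)//]] :=
    subfield_relation (gal_subfield N) (fun j i => Nnu (t j) i) lt.
have [y [Ny [i0 yi0] hy]] :=
  subfield_relation (gal_subfield N) (fun i j => Nnu (t j) i) lt.
pose c i := \sum_(g in fixing E) nu g ((y i0)^-1 * y i).
have Nc i : gal_set N ((y i0)^-1 * y i).
  by apply: subfieldM; [exact: gal_subfield|apply: subfieldV => //; exact: gal_subfield|].
have : c i0 = 0.
  apply: free => [i|]; first exact: trace_fixed.
  under eq_bigr do rewrite mulr_suml.
  rewrite exchange_big big1 //= => g gE.
  transitivity (nu g ((y i0)^-1 * \sum_i y i * nu g^-1%g (b i))).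
    rewrite mulr_sumr rmorph_sum; apply: eq_bigr => i _ /=.
    rewrite mulrA [in RHS]rmorphM; congr (_ * _).
    by rewrite -gal_mapM ?mulVg ?gal_map1 //; exact: MN.
  have [j hj] := embed_onto ht (groupVr gE).
  by under eq_bigr do rewrite hj //; rewrite hy mulr0 rmorph0.
rewrite /c; under eq_bigr do rewrite mulVf // rmorph1.
by rewrite sumr_const => /eqP; rewrite pnatr_eq0 eqn0Ngt cardG_gt0.
Qed.

End Basis.

Section Matrices.
Variables (n : nat) (t : 'I_n -> gT) (b : 'I_n -> algC).
Hypotheses (ht : embeddings_spec E M t) (hb : is_basis E M b).

Definition embed_matrix : 'M[algC]_n := \matrix_(i, j) nu (t j) (b i).

Lemma embed_matrix_unit : embed_matrix \in unitmx.
Proof.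
rewrite unitmxE unitfE -det_tr; apply/negP => /det0P[v v0 hv].
case/eqP: v0; apply/rowP => j; rewrite mxE.
apply: (basis_relation ht hb (y := v 0)) => i.
have /rowP/(_ i) := hv; rewrite !mxE => h; rewrite -[RHS]h.
by apply: eq_bigr => j' _; rewrite !mxE.
Qed.

(** The columns of the matrix of conjugates are eigenvectors common to all the multiplications; this
    makes traces and norms sums and products over the embeddings, whatever the basis. *)
Lemma mul_matrix_conj x : M x ->
  mul_matrix E b x *m embed_matrix =
  embed_matrix *m diag_mx (\row_j nu (t j) x).
Proof.
have EN : E `<=` gal_set N by apply: subset_trans MN.
have [Mb span _] := hb.
move=> Mx; apply/matrixP => i j; rewrite !mxE.
have /span/cid[c hc] : M (x * b i) by exact: subfieldM.
have [Ec Dx] : [set d : 'I_n -> algC | (forall l, E (d l)) /\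
    x * b i = \sum_(l < n) d l * b l] (coords E b (x * b i)).
  by apply: xgetPex; exists c.
under eq_bigr do rewrite !mxE.
transitivity (nu (t j) (x * b i)).
  rewrite [in RHS]Dx rmorph_sum; apply: eq_bigr => l _ /=.
  by rewrite rmorphM; congr (_ * _); have /(fixingP _ EN)-> := embed_in ht j.
rewrite rmorphM mulrC (bigD1 j) //= !mxE eqxx mulr1n big1 ?addr0 // => l lj.
by rewrite !mxE (negPf lj) mulr0n mulr0.
Qed.

Lemma trace_mul_matrix x : M x -> \tr (mul_matrix E b x) = \sum_j nu (t j) x.
Proof.
move=> Mx; have U := embed_matrix_unit.
rewrite -[mul_matrix E b x](mulmxK U) mul_matrix_conj // mxtrace_mulC mulmxA.
rewrite mulVmx // mul1mx mxtrace_diag; apply: eq_bigr => j _.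
by rewrite mxE.
Qed.

Lemma det_mul_matrix x : M x -> \det (mul_matrix E b x) = \prod_j nu (t j) x.
Proof.
move=> Mx; have U := embed_matrix_unit.
have := congr1 determinant (mul_matrix_conj Mx).
rewrite !det_mulmx [RHS]mulrC => /mulIf -> //; last by rewrite -unitfE -unitmxE.
by rewrite det_diag; apply: eq_bigr => j _; rewrite mxE.
Qed.

End Matrices.

Lemma rel_traceE k (t : 'I_k -> gT) n (b : 'I_n -> algC) x :
    embeddings_spec E M t -> is_basis E M b -> M x ->
  rel_trace E M x = \sum_j nu (t j) x.
Proof.
move=> ht hb Mx; apply: xget_unique.
  have e := basis_size ht hb; subst k.
  by exists n, b; rewrite (trace_mul_matrix ht hb).
move=> _ [m [c [hc ->]]]; have e := basis_size ht hc; subst k.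
exact: trace_mul_matrix.
Qed.

Lemma rel_normE k (t : 'I_k -> gT) n (b : 'I_n -> algC) x :
    embeddings_spec E M t -> is_basis E M b -> M x ->
  rel_norm E M x = \prod_j nu (t j) x.
Proof.
move=> ht hb Mx; apply: xget_unique.
  have e := basis_size ht hb; subst k.
  by exists n, b; rewrite (det_mul_matrix ht hb).
move=> _ [m [c [hc ->]]]; have e := basis_size ht hc; subst k.
exact: det_mul_matrix.
Qed.

Lemma degreeE n : has_degree E M n -> degree E M = n.
Proof.
have [t ht] := embeddings_exist EM MN.
move=> hn; apply: xget_unique => // m [c hc]; case: hn => b hb.
by rewrite -(basis_size ht hb) -(basis_size ht hc).
Qed.

Lemma degree_card n : has_degree E M n -> #|fixing E| = (n * #|fixing M|)%N.
Proof.
have [t ht] := embeddings_exist EM MN.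
by case=> b hb; rewrite (embed_card ht) (basis_size ht hb).
Qed.

(* Galois descent: the coordinates of [x] on a family with invertible matrix of
   conjugates are given by Cramer's rule, and are invariant under [fixing E]. *)
Lemma basis_criterion n (t : 'I_n -> gT) (b : 'I_n -> algC) :
    embeddings_spec E M t -> (forall i, M (b i)) ->
  \matrix_(i, j) nu (t j) (b i) \in unitmx -> is_basis E M b.
Proof.
have EN : E `<=` gal_set N by apply: subset_trans MN.
move=> ht Mb; set B := \matrix_(i, j) _ => U; split => //; last first.
  move=> c Ec hc i; have : (\row_i c i) *m B = 0.
    apply/rowP => j; rewrite !mxE -[RHS](rmorph0 (nu (t j))) -[in RHS]hc rmorph_sum.
    apply: eq_bigr => l _; rewrite !mxE rmorphM; congr (_ * _).
    by have /(fixingP _ EN)-> := embed_in ht j.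
  move=> /(congr1 (mulmx^~ (invmx B))); rewrite mulmxK // mul0mx.
  by move=> /rowP/(_ i); rewrite !mxE.
move=> x Mx; pose c := (\row_j nu (t j) x) *m invmx B.
have cB : c *m B = \row_j nu (t j) x by rewrite /c mulmxKV.
have cx g : g \in fixing E -> \sum_i c 0 i * nu g (b i) = nu g x.
  move=> /(embed_onto ht)[j hj]; rewrite hj //.
  have /rowP/(_ j) := cB; rewrite !mxE => h; rewrite -[RHS]h.
  by apply: eq_bigr => i _; rewrite hj // [B _ _]mxE.
have Nc i : gal_set N (c 0 i).
  have hN := gal_subfield N.
  have BN i' j' : gal_set N (B i' j') by rewrite mxE; apply/gal_stable/MN.
  rewrite mxE; apply: subfield_sum => // j _; apply: subfieldM => //.
    by rewrite mxE; apply/gal_stable/MN.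
  rewrite /invmx U !mxE; apply: subfieldM => //.
    by apply: subfieldV => //; exact: subfield_det.
  rewrite /cofactor; apply: subfieldM => //.
    by apply: subfieldX => //; apply: subfieldN => //; exact: subfield1.
  by apply: subfield_det => // i' j'; rewrite !mxE; apply/gal_stable/MN.
exists (c 0); split => [i|]; last first.
  have := cx 1%g (group1 _); rewrite gal_map1; last exact: MN.
  by move=> <-; apply: eq_bigr => i _; rewrite gal_map1 //; exact: MN.
apply: (@gal_fixed N) => // g hg; have gE : g \in fixing E by apply/fixingP.
suff e : \row_i nu g (c 0 i) = c by have /rowP/(_ i) := e; rewrite mxE.
suff: (\row_i nu g (c 0 i)) *m B = c *m B.
  by move=> /(congr1 (mulmx^~ (invmx B))); rewrite !mulmxK.
rewrite cB; apply/rowP => j; rewrite !mxE.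
have Nx := MN Mx.
(* The equation [cx] at [t j * g^-1], transported by [g], is the equation at [t j] with coefficients
   [nu g (c 0 i)]. *)
have tg : (t j * g^-1)%g \in fixing E by rewrite groupM ?groupV ?(embed_in ht).
have := congr1 (nu g) (cx _ tg); rewrite -gal_mapM // mulgKV => <-.
rewrite rmorph_sum; apply: eq_bigr => l _; rewrite [B _ _]mxE mxE [RHS]rmorphM /=.
by rewrite -gal_mapM ?mulgKV //; exact: MN.
Qed.

End Tower.

Section Adjoin.
Variables (E : set algC) (a : algC).
Hypotheses (hE : is_subfield E) (EN : E `<=` gal_set N) (Na : gal_set N a).

(** The field E(a), as the fixed field of the stabilizer of [a] in [fixing E]; that it is the
    smallest field containing [E] and [a] is [adjoin_min]. *)
Definition adjoin : set algC :=
  [set x | gal_set N x /\ forall g, g \in fixing E -> nu g a = a -> nu g x = x].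

Lemma adjoin_subfield : is_subfield adjoin.
Proof.
have hN := gal_subfield N.
apply: subfieldP => [|x y [Nx hx] [Ny hy]|x y [Nx hx] [Ny hy]].
- by split=> [|g _ _]; [exact: subfield1|rewrite rmorph1].
- by split=> [|g gE ga]; [exact: subfieldB|rewrite rmorphB hx // hy].
- by split=> [|g gE ga]; [exact: subfield_div|rewrite fmorph_div /= hx // hy].
Qed.

Lemma sub_adjoin : E `<=` adjoin.
Proof. by move=> x Ex; split=> [|g /(fixingP _ EN)/(_ x Ex)]; first exact: EN. Qed.

Lemma adjoin_gen : adjoin a. Proof. by []. Qed.

Lemma adjoin_sub : adjoin `<=` gal_set N. Proof. by move=> x []. Qed.

Lemma adjoin_min F : is_subfield F -> E `<=` F -> F a -> adjoin `<=` F.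
Proof.
move=> hF EF Fa x [Nx hx]; have hN := gal_subfield N.
(* [F] need not lie in the Galois closure, while [gal_fixed] only speaks of subfields of it. *)
have hFN : is_subfield (F `&` gal_set N).
  apply: subfieldP => [|y z [Fy Ny] [Fz Nz]|y z [Fy Ny] [Fz Nz]].
  - by split; exact: subfield1.
  - by split; exact: subfieldB.
  - by split; exact: subfield_div.
suff [] : (F `&` gal_set N) x by [].
apply: (@gal_fixed N) => // g hg; apply: hx; last exact: hg.
by apply/fixingP => // y Ey; apply: hg; split; [exact: EF|exact: EN].
Qed.

Section PowerBasis.
Variables (n : nat) (t : 'I_n -> gT).
Hypothesis ht : embeddings_spec E adjoin t.

Lemma embed_gen_inj : injective (fun j => nu (t j) a).
Proof.
move=> i j e; apply: contrapT => /eqP /(embed_sep ht)[z [Nz hz]] /eqP; apply.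
have : nu (t i * (t j)^-1)%g z = z.
  apply: hz; first by rewrite groupM ?groupV ?(embed_in ht).
  by rewrite gal_mapM //= e galMV.
rewrite gal_mapM // => /(congr1 (nu (t j))).
by rewrite -gal_mapM ?mulVg ?gal_map1 //; exact: gal_stable.
Qed.

Lemma det_power_matrix c : \det (\matrix_(i < n, j < n) nu (t j) (c * a ^+ i)) =
  (\prod_j nu (t j) c) * \det (Vandermonde n (\row_j nu (t j) a)).
Proof.
have -> : \matrix_(i < n, j < n) nu (t j) (c * a ^+ i) =
    Vandermonde n (\row_j nu (t j) a) *m diag_mx (\row_j nu (t j) c).
  apply/matrixP => i j; rewrite mul_mx_diag !mxE rmorphM rmorphXn mulrC.
  by [].
rewrite det_mulmx det_diag mulrC; congr (_ * _).
by apply: eq_bigr => j _; rewrite mxE.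
Qed.

Lemma Vandermonde_neq0 : \det (Vandermonde n (\row_j nu (t j) a)) != 0.
Proof.
rewrite det_Vandermonde; apply/prodf_neq0 => i _; apply/prodf_neq0 => j ij.
rewrite !mxE subr_eq0; apply/negP => /eqP /embed_gen_inj e.
by rewrite e ltnn in ij.
Qed.

Lemma power_basis c : adjoin c -> c != 0 ->
  is_basis E adjoin (fun i : 'I_n => c * a ^+ i).
Proof.
move=> Mc c0; apply: (basis_criterion hE sub_adjoin adjoin_sub ht).
  have hM := adjoin_subfield.
  by move=> i; apply: subfieldM => //; apply: subfieldX => //; exact: adjoin_gen.
rewrite unitmxE unitfE det_power_matrix mulf_neq0 ?Vandermonde_neq0 //.
by apply/prodf_neq0 => j _; rewrite fmorph_eq0.
Qed.

End PowerBasis.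

Lemma adjoin_degree : has_degree E adjoin #|fixing E : fixing adjoin|%g.
Proof.
have [t ht] := embeddings_exist sub_adjoin adjoin_sub.
have hM := adjoin_subfield.
by exists (fun i => 1 * a ^+ i); apply: (power_basis ht); rewrite ?oner_neq0 //; exact: subfield1.
Qed.

End Adjoin.

Lemma adjoin_QE a : gal_set N a -> adjoin_Q a = adjoin QQ a.
Proof.
have QN : QQ `<=` gal_set N by apply: QQ_sub; exact: gal_subfield.
move=> Na; apply/seteqP; split => x.
  apply; split; first by apply: adjoin_subfield.
  exact: adjoin_gen.
move=> Mx F [hF Fa]; apply: adjoin_min Mx => //; exact: QQ_sub.
Qed.

End GaloisTheory.

(** * Absolute values of algC *)

Structure absval (R : realType) := AbsVal {
  av :> algC -> R;
  av_ge0 : forall x, 0 <= av x;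
  av_eq0 : forall x, (av x == 0) = (x == 0);
  avM : forall x y, av (x * y) = av x * av y;
  avD : forall x y, av (x + y) <= av x + av y
}.

Section AbsValTheory.
Variables (R : realType) (w : absval R).

Lemma av0 : w 0 = 0.
Proof. by apply/eqP; rewrite av_eq0. Qed.

Lemma av1 : w 1 = 1.
Proof.
have w1 : w 1 != 0 by rewrite av_eq0 oner_neq0.
by apply: (mulfI w1); rewrite -avM !mulr1.
Qed.

Lemma avX x n : w (x ^+ n) = w x ^+ n.
Proof. by elim: n => [|n IHn]; rewrite ?expr0 ?av1 // !exprS avM IHn. Qed.

Lemma avN x : w (- x) = w x.
Proof.
apply/eqP; rewrite -(@eqrXn2 _ 2) ?av_ge0 //.
by rewrite -!avX sqrrN.
Qed.

Lemma avV x : w x^-1 = (w x)^-1.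
Proof.
have [->|x0] := eqVneq x 0; first by rewrite invr0 av0 invr0.
have wx : w x != 0 by rewrite av_eq0.
by apply: (mulfI wx); rewrite -avM !divff // av1.
Qed.

Lemma av_prod I (r : seq I) (P : pred I) f :
  w (\prod_(i <- r | P i) f i) = \prod_(i <- r | P i) w (f i).
Proof. exact: (big_morph w (avM w) av1). Qed.

Lemma av_sum I (r : seq I) (P : pred I) f :
  w (\sum_(i <- r | P i) f i) <= \sum_(i <- r | P i) w (f i).
Proof.
apply: (big_ind2 (fun x y => w x <= y)) => [|x1 x2 y1 y2 h1 h2|//].
  by rewrite av0.
by apply: le_trans (avD _ _ _) _; exact: lerD.
Qed.

Lemma av_gt0 x : (0 < w x) = (x != 0).
Proof. by rewrite lt_def av_eq0 av_ge0 andbT. Qed.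

End AbsValTheory.

(** * The archimedean absolute value *)

Section Archimedean.
Variable R : realType.

(** The modulus of [x] is an element of [algC]; the cut of the rationals below it carries it over to
    [R]. *)
Definition real_cut (x : algC) : R := sup [set ratr q | q in [set q : rat | ratr q <= `|x|]].

Lemma real_cut_ge x q : ratr q <= `|x| -> (ratr q : R) <= real_cut x.
Proof.
move=> qx; apply: ub_le_sup; last by exists q.
have [n hn] : exists n : nat, `|x| < n%:R.
  by exists (Num.bound `|x|); apply: archi_boundP.
exists n%:R => _ [r /= rx <-]; rewrite -(ratr_nat _ n) ler_rat.
by rewrite -(ler_rat algC) ratr_nat; apply: le_trans rx (ltW hn).
Qed.

Lemma real_cut_le x q : `|x| <= ratr q -> real_cut x <= ratr q.
Proof.
move=> qx; apply: ge_sup.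
  by exists (ratr 0), 0 => //=; rewrite rmorph0.
by move=> _ [r /= rx <-]; rewrite ler_rat -(ler_rat algC); apply: le_trans rx qx.
Qed.

Lemma real_cut_gtP x q : real_cut x < ratr q -> `|x| < ratr q.
Proof.
move=> h; rewrite real_ltNge ?normr_real ?ratr_real //.
  by apply/negP => /real_cut_ge; rewrite leNgt h.
by rewrite rpred_rat.
Qed.

Lemma real_cut_ltP x q : ratr q < real_cut x -> ratr q < `|x|.
Proof.
move=> h; rewrite real_ltNge ?normr_real ?rpred_rat //.
by apply/negP => /real_cut_le; rewrite leNgt h.
Qed.

Lemma real_cut_ge0 x : 0 <= real_cut x.
Proof. by rewrite -(rmorph0 (ratr : rat -> R)) real_cut_ge // rmorph0. Qed.

Lemma rat_between (x y : R) : x < y -> exists2 q : rat, x < ratr q & ratr q < y.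
Proof. by move=> /rat_in_itvoo[q]; rewrite in_itv /= => /andP[]; exists q. Qed.

Lemma real_cut_rat (q : rat) : real_cut (ratr q) = `|ratr q|.
Proof.
apply/eqP; rewrite eq_le -ratr_norm real_cut_le ?real_cut_ge //.
all: by rewrite ratr_norm.
Qed.

Lemma real_cut_eq0 x : (real_cut x == 0) = (x == 0).
Proof.
apply/eqP/eqP => [x0|->]; last by rewrite -(rmorph0 (ratr : rat -> algC)) real_cut_rat rmorph0 normr0.
apply/eqP; rewrite -normr_eq0; apply: contraT => nx.
have hn : `|x|^-1 < (Num.bound `|x|^-1)%:R by apply: archi_boundP; rewrite invr_ge0.
set n := Num.bound _ in hn; have n0 : (0 < n%:R :> algC) by apply: le_lt_trans hn; rewrite invr_ge0.
have : ratr (n%:R^-1 : rat) <= `|x|.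
  rewrite fmorphV rmorph_nat -[leRHS]invrK lef_pV2 ?posrE ?invr_gt0 //; first exact: ltW.
  by rewrite lt_def nx normr_ge0.
move=> /real_cut_ge; rewrite x0 fmorphV rmorph_nat invr_le0.
by rewrite leNgt ltr0n -(ltr0n algC) n0.
Qed.

Lemma real_cutD x y : real_cut (x + y) <= real_cut x + real_cut y.
Proof.
rewrite leNgt; apply/negP; rewrite -ltrBrDr => /rat_between[a xa].
rewrite ltrBrDl -ltrBrDr => /rat_between[b yb]; rewrite ltrBrDl -rmorphD => hab.
have := real_cut_ltP hab; rewrite real_ltNge ?normr_real ?rpred_rat //.
rewrite rmorphD => /negP; apply; apply: le_trans (ler_normD _ _) _.
by apply: lerD; apply/ltW/real_cut_gtP.
Qed.

Lemma real_cutM x y : real_cut (x * y) = real_cut x * real_cut y.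
Proof.
have sx := real_cut_ge0 x; have sy := real_cut_ge0 y.
apply/eqP; rewrite eq_le; apply/andP; split; rewrite leNgt; apply/negP => h.
  have [a xa ha] : exists2 a : rat, real_cut x < ratr a & ratr a * real_cut y < real_cut (x * y).
    have [y0|y0] := eqVneq (real_cut y) 0.
      have [|a xa _] := @rat_between (real_cut x) (real_cut x + 1).
        by rewrite ltrDl.
      by exists a => //; rewrite y0 mulr0; rewrite y0 mulr0 in h.
    have y1 : 0 < real_cut y by rewrite lt_def y0.
    have [|a xa ay] := @rat_between (real_cut x) (real_cut (x * y) / real_cut y).
      by rewrite ltr_pdivlMr.
    by exists a => //; rewrite -ltr_pdivlMr.
  have a0 : 0 < (ratr a : R) by apply: le_lt_trans xa.
  have [|b yb hb] := @rat_between (real_cut y) (real_cut (x * y) / ratr a).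
    by rewrite ltr_pdivlMr // mulrC.
  move: hb; rewrite ltr_pdivlMr // mulrC -rmorphM => /real_cut_ltP.
  rewrite real_ltNge ?normr_real ?rpred_rat // => /negP; apply.
  by rewrite normrM rmorphM ler_pM // ltW // real_cut_gtP.
have y1 : 0 < real_cut y.
  rewrite lt_def sy andbT; apply: contraTneq h => ->.
  by rewrite mulr0 -leNgt real_cut_ge0.
have [|a] := @rat_between (real_cut (x * y) / real_cut y) (real_cut x).
  by rewrite ltr_pdivrMr.
rewrite ltr_pdivrMr // => ha xa.
have a0 : 0 < (ratr a : R).
  by rewrite -(pmulr_lgt0 _ y1); apply: le_lt_trans ha; exact: real_cut_ge0.
have [|b] := @rat_between (real_cut (x * y) / ratr a) (real_cut y).
  by rewrite ltr_pdivrMr // [_ * ratr a]mulrC.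
rewrite ltr_pdivrMr // => hb yb.
have b0 : 0 < (ratr b : R).
  by rewrite -(pmulr_lgt0 _ a0); apply: le_lt_trans hb; exact: real_cut_ge0.
move: hb; rewrite -rmorphM => /real_cut_gtP.
rewrite real_ltNge ?normr_real ?rpred_rat // => /negP; apply.
rewrite normrM rmorphM [`|x| * _]mulrC ler_pM // ?ltW // ?real_cut_ltP //.
  by rewrite ltr0q -(ltr0q R).
by rewrite ltr0q -(ltr0q R).
Qed.

Definition arch_absval : absval R :=
  AbsVal real_cut_ge0 real_cut_eq0 real_cutM real_cutD.

End Archimedean.

(** * Extension of a p-adic absolute value to [algC] by a valuation ring *)

Definition subring_set (V : set algC) :=
  [/\ V 1, forall x y, V x -> V y -> V (x - y) & forall x y, V x -> V y -> V (x * y)].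

Section Subring.
Variable V : set algC.
Hypothesis hV : subring_set V.

Lemma subring1 : V 1. Proof. by case: hV. Qed.
Lemma subringB x y : V x -> V y -> V (x - y). Proof. by case: hV => _ + _; apply. Qed.
Lemma subringM x y : V x -> V y -> V (x * y). Proof. by case: hV => _ _; apply. Qed.
Lemma subring0 : V 0.
Proof. by rewrite -(subrr 1); apply: subringB; exact: subring1. Qed.
Lemma subringN x : V x -> V (- x).
Proof. by move=> Vx; rewrite -sub0r; apply: subringB => //; exact: subring0. Qed.
Lemma subringD x y : V x -> V y -> V (x + y).
Proof. by move=> Vx Vy; rewrite -[y]opprK; apply: subringB => //; exact: subringN. Qed.
Lemma subring_sum I (r : seq I) (P : pred I) (f : I -> algC) :
  (forall i, P i -> V (f i)) -> V (\sum_(i <- r | P i) f i).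
Proof. move=> h; apply: big_ind => //; [exact: subring0|exact: subringD]. Qed.
Lemma subringX x n : V x -> V (x ^+ n).
Proof.
by move=> Vx; elim: n => [|n IHn]; rewrite ?expr0 ?exprS; [exact: subring1|exact: subringM].
Qed.
Lemma subring_nat n : V n%:R.
Proof.
elim: n => [|n IHn]; first exact: subring0.
by rewrite -addn1 natrD; apply: subringD; [|exact: subring1].
Qed.
Definition adjoin_subring x : set algC :=
  [set y | exists2 q : {poly algC}, forall i, V q`_i & y = q.[x]].

Lemma adjoin_subringP x : subring_set (adjoin_subring x).
Proof.
split=> [|_ _ [q Vq ->] [r Vr ->]|_ _ [q Vq ->] [r Vr ->]].
- exists 1; last by rewrite hornerC.
  by move=> i; rewrite coef1; exact: subring_nat.
- exists (q - r); last by rewrite !hornerE.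
  by move=> i; rewrite coefB; exact: subringB.
- exists (q * r); last by rewrite !hornerE.
  by move=> i; rewrite coefM; apply: subring_sum => j _; exact: subringM.
Qed.

Lemma sub_adjoin_subring x : V `<=` adjoin_subring x.
Proof.
move=> v Vv; exists v%:P; last by rewrite hornerC.
by move=> i; rewrite coefC; case: ifP => // _; exact: subring0.
Qed.

Lemma adjoin_subring_gen x : adjoin_subring x x.
Proof.
exists 'X; last by rewrite hornerX.
by move=> i; rewrite coefX; exact: subring_nat.
Qed.

End Subring.

Section ValuationRing.
Variable p : nat.
Hypothesis p_pr : prime p.
Let pC : algC := p%:R.

Let pC0 : pC != 0.
Proof. by rewrite pnatr_eq0 -lt0n prime_gt0. Qed.

Lemma maximal_subring_exists : exists V : set algC,
  [/\ subring_set V, ~ V pC^-1 &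
      forall W, subring_set W -> V `<=` W -> ~ W pC^-1 -> W `<=` V].
Proof.
pose P (X : set algC) := X = set0 \/ (subring_set X /\ ~ X pC^-1).
have [F FP tF|V [PV Vmax]] := @Zorn_bigcup algC P.
  have [[X [FX [[X0|PX] X1]]]|noX] := pselect (exists X, F X /\ P X /\ X <> set0).
  - by [].
  - right.
    have hsub Y Z : F Y -> F Z -> exists2 W, F W & [/\ subring_set W, Y `<=` W & Z `<=` W].
      have aux Y' : F Y' -> exists2 W, F W & subring_set W /\ Y' `<=` W.
        move=> FY; case: (FP _ FY) => [->|[sY _]]; last by exists Y' => //; split.
        by exists X => //; split=> //; case: PX.
      move=> /aux[Y' FY [sY YY]] /aux[Z' FZ [sZ ZZ]].
      have [YZ|ZY] := tF _ _ FY FZ.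
        by exists Z' => //; split => //; exact: subset_trans YZ.
      by exists Y' => //; split => //; exact: subset_trans ZY.
    split; last first.
      by case=> Y FY Yp; case: (FP _ FY) => [Y0|[_]]; [rewrite Y0 in Yp|exact].
    split.
    + by exists X => //; case: PX => [[]].
    + move=> x y [Y FY Yx] [Z FZ Zy]; have [W FW [sW YW ZW]] := hsub _ _ FY FZ.
      by exists W => //; apply: subringB => //; [exact: YW|exact: ZW].
    + move=> x y [Y FY Yx] [Z FZ Zy]; have [W FW [sW YW ZW]] := hsub _ _ FY FZ.
      by exists W => //; apply: subringM => //; [exact: YW|exact: ZW].
  - left; apply/seteqP; split => // x [X FX Xx]; case: noX; exists X.
    by split => //; split; [exact: FP|move=> X0; rewrite X0 in Xx].
pose Z : set algC := range (intr : int -> algC).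
have sZ : subring_set Z.
  split=> [|_ _ [x _ <-] [y _ <-]|_ _ [x _ <-] [y _ <-]].
  - by exists 1.
  - by exists (x - y) => //; rewrite rmorphB.
  - by exists (x * y) => //; rewrite rmorphM.
have nZ : ~ Z pC^-1.
  case=> m _ /(congr1 ( *%R^~ pC)); rewrite mulVf // -[pC]/(p%:~R) -intrM.
  move=> /eqP; rewrite -[1]/(1%:~R) eqr_int => /eqP /(congr1 absz).
  rewrite abszM /= => /eqP; rewrite muln_eq1 => /andP[_ /eqP p1].
  by move: p_pr; rewrite p1.
exists V; have [sV nV] : subring_set V /\ ~ V pC^-1.
  case: PV => // V0; case: (Vmax Z); last by right.
  rewrite V0; split => // /(_ 1) /=; apply; exact: subring1.
split => // W sW VW nW; apply: contrapT => WV; apply: (Vmax W) => //.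
by right.
Qed.

Section Valuation.
Variable V : set algC.
Hypotheses (sV : subring_set V) (nVp : ~ V pC^-1).

Let one_sub_pV y := exists2 v, V v & y = 1 - pC * v.

Let one_sub_pV_X y n : one_sub_pV y -> one_sub_pV (y ^+ n).
Proof.
have Vp : V pC by exact: subring_nat.
case=> v Vv ->; elim: n => [|n [u Vu IHn]].
  by exists 0; [exact: subring0|rewrite mulr0 subr0].
exists (u + v - pC * u * v); last by rewrite exprS IHn; ring.
by apply: (subringB sV); [exact: (subringD sV)|apply: (subringM sV) => //; exact: (subringM sV)].
Qed.

Let mulp_neq1 v : V v -> pC * v != 1.
Proof.
move=> Vv; apply/eqP => /(congr1 ( *%R pC^-1)).
by rewrite mulKf // mulr1 => e; apply: nVp; rewrite -e.
Qed.

Hypothesis maxV : forall W, subring_set W -> V `<=` W -> ~ W pC^-1 -> W `<=` V.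

(** Membership of 1 in p V[x], witnessed in degree less than [n]. By maximality of [V] this is what
    happens when [x] is outside [V], since adjoining it would invert [p]. *)
Let p_relation x n := exists2 c : nat -> algC, forall i, V (c i) &
  pC * (\sum_(i < n) c i * x ^+ i) = 1.

Let notin_relation x : ~ V x -> exists n, p_relation x n.
Proof.
move=> nx; have [[q Vq Dq]|nW] := pselect (adjoin_subring V x pC^-1).
  by exists (size q), (nth 0 q) => //; rewrite -horner_coef -Dq divff.
case: nx; apply: (maxV (adjoin_subringP sV x) _ nW); last exact: adjoin_subring_gen.
exact: sub_adjoin_subring.
Qed.

(** If [y^-1] were outside [V], its relation multiplied by [y ^+ n] would put [y ^+ n] in pV,
    whereas it is 1 modulo pV. Hence 1 would lie in pV. *)
Let one_sub_pV_inv y : one_sub_pV y -> V y^-1.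
Proof.
move=> hy; apply: contrapT => /notin_relation[n [c Vc]] e.
have y0 : y != 0.
  case: hy => v Vv ->; rewrite subr_eq0 eq_sym; exact: mulp_neq1.
have [u Vu Du] := one_sub_pV_X n hy.
have Vy : V y.
  case: hy => v Vv ->; apply: (subringB sV); first exact: subring1.
  by apply: (subringM sV) => //; exact: subring_nat.
have : pC * (u + \sum_(i < n) c i * y ^+ (n - i)) = 1.
  have -> : \sum_(i < n) c i * y ^+ (n - i) = y ^+ n * \sum_(i < n) c i * y^-1 ^+ i.
    rewrite mulr_sumr; apply: eq_bigr => i _; rewrite mulrCA; congr (_ * _).
    by rewrite exprVn -expfB_cond // (negPf y0) add0n ltnW.
  by rewrite mulrDr mulrCA e Du mulr1 addrC subrK.
apply/eqP/mulp_neq1; apply: (subringD sV) => //; apply: (subring_sum sV) => i _.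
by apply: (subringM sV) => //; exact: subringX.
Qed.

(** Since [1 - pC * d 0] is a unit of [V], the relation for [x^-1] multiplied by [x ^+ n] expresses
    [x ^+ n] through lower powers with coefficients in pV. The condition [m <= n] keeps these
    exponents nonnegative, and substitution lowers the degree of the relation for [x]. *)
Let reduce_relation x m n : x != 0 -> (m <= n)%N ->
  p_relation x^-1 m.+1 -> p_relation x n.+1 -> p_relation x n.
Proof.
move=> x0 mn [d Vd hd] [c Vc hc].
have hu : one_sub_pV (1 - pC * d 0%N) by exists (d 0%N).
pose u := (1 - pC * d 0%N)^-1; have Vu : V u by exact: one_sub_pV_inv.
have u0 : 1 - pC * d 0%N != 0 by rewrite subr_eq0 eq_sym; exact: mulp_neq1.
have rel : x ^+ n = pC * u * \sum_(j < m) d j.+1 * x ^+ (n - j.+1).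
  have -> : \sum_(j < m) d j.+1 * x ^+ (n - j.+1) =
            x ^+ n * \sum_(j < m) d j.+1 * x^-1 ^+ j.+1.
    rewrite mulr_sumr; apply: eq_bigr => j _; rewrite mulrCA; congr (_ * _).
    by rewrite exprVn -expfB_cond // (negPf x0) add0n (leq_trans _ mn).
  move: hd; rewrite big_ord_recl expr0 mulr1 mulrDr => /(canRL (addKr _)).
  under eq_bigr do rewrite !lift0.
  rewrite addrC => hd; rewrite [pC * u]mulrC -mulrA [pC * _]mulrCA hd mulrCA /u.
  by rewrite mulVf // mulr1.
pose e i := c i + c n * pC * u * (if (n - i <= m)%N then d (n - i)%N else 0).
exists e => [i|].
  apply: (subringD sV) => //; apply: (subringM sV); last first.
    by case: ifP => // _; exact: subring0.
  by apply: (subringM sV) => //; apply: (subringM sV) => //; exact: subring_nat.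
rewrite -[RHS]hc big_ord_recr /= rel; congr (_ * _).
under eq_bigr do rewrite /e mulrDl.
rewrite big_split /=; congr (_ + _).
under eq_bigr do rewrite -mulrA.
rewrite -mulr_sumr !mulrA; congr (_ * _).
rewrite (reindex_inj rev_ord_inj) /=.
rewrite (big_ord_widen n (fun j => d j.+1 * x ^+ (n - j.+1))) // [RHS]big_mkcond /=.
apply: eq_bigr => j _; rewrite subKn ?ltn_ord //.
by case: ifP => _; rewrite ?mul0r.
Qed.

(** Were both outside, the longer of two shortest relations, for [x] and for [x^-1], could still be
    shortened. *)
Lemma maximal_subring_total x : x != 0 -> V x \/ V x^-1.
Proof.
move=> x0; apply: contrapT => /not_orP[nx nx'].
have minrel y : ~ V y -> exists2 n, p_relation y n.+1 & ~ p_relation y n.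
  move=> /notin_relation[n]; elim: n => [[c _]|n IHn hn].
    by rewrite big_ord0 mulr0 => /eqP; rewrite eq_sym oner_eq0.
  by have [/IHn//|] := pselect (p_relation y n); exists n.
have [n hn n'] := minrel _ nx; have [m hm m'] := minrel _ nx'.
have [mn|nm] := leqP m n; first exact/n'/(reduce_relation x0 mn).
by apply: m'; apply: (reduce_relation _ (ltnW nm)) => //; rewrite ?invr_eq0 ?invrK.
Qed.

End Valuation.

Section ValuationAbs.
Variable V : set algC.
Hypotheses (sV : subring_set V) (nVp : ~ V pC^-1).
Hypothesis totV : forall x, x != 0 -> V x \/ V x^-1.

Definition is_unit x := [/\ x != 0, V x & V x^-1].

Lemma is_unit1 : is_unit 1.
Proof. by split; rewrite ?oner_neq0 ?invr1 //; exact: subring1. Qed.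

Lemma is_unitM x y : is_unit x -> is_unit y -> is_unit (x * y).
Proof.
move=> [x0 Vx Vx'] [y0 Vy Vy']; split; first by rewrite mulf_neq0.
  exact: (subringM sV).
by rewrite invfM; exact: (subringM sV).
Qed.

Lemma is_unitV x : is_unit x -> is_unit x^-1.
Proof. by move=> [x0 Vx Vx']; split; rewrite ?invr_eq0 ?invrK. Qed.

Lemma is_unitN x : is_unit x -> is_unit (- x).
Proof. by move=> [x0 Vx Vx']; split; rewrite ?oppr_eq0 ?invrN //; exact: (subringN sV). Qed.

Lemma is_unitX x n : is_unit x -> is_unit (x ^+ n).
Proof.
move=> ux; elim: n => [|n IHn]; first by rewrite expr0; exact: is_unit1.
by rewrite exprS; exact: is_unitM.
Qed.

(** [V] is a local ring: [(1 + a) / a] differs from [a^-1] by 1, so it is outside [V]; hence its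
    inverse is in [V], and so is [(1 + a)^-1], which is 1 minus that inverse. *)
Lemma local_inverse a : V a -> ~ V a^-1 -> is_unit (1 + a).
Proof.
move=> Va na; have V1 := subring1 sV.
have a0 : a != 0 by apply: contra_notN na => /eqP->; rewrite invr0; exact: subring0.
have a1 : 1 + a != 0.
  rewrite addr_eq0; apply/eqP => e; apply: na; rewrite -[a]opprK -e invrN invr1.
  exact: (subringN sV).
split=> //; first exact: (subringD sV).
have [|h|h] := @totV ((1 + a) / a); first by rewrite mulf_neq0 ?invr_eq0.
  case: na; have -> : a^-1 = (1 + a) / a - 1 by field.
  exact: (subringB sV).
have -> : (1 + a)^-1 = 1 - ((1 + a) / a)^-1 by field; rewrite a0 a1.
exact: (subringB sV).
Qed.

Lemma is_unit_dominant x y : x != 0 -> y != 0 -> ~ is_unit (x / y) ->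
  is_unit ((x + y) / x) \/ is_unit ((x + y) / y).
Proof.
move=> x0 y0 nu; have xy0 : x / y != 0 by rewrite mulf_neq0 ?invr_eq0.
have [h|h] := totV xy0; [right|left].
  have -> : (x + y) / y = 1 + x / y by field.
  by apply: local_inverse => // h'; apply: nu.
have -> : (x + y) / x = 1 + (x / y)^-1 by field; rewrite x0 y0.
by apply: local_inverse; rewrite ?invrK // => h'; apply: nu.
Qed.

(** In terms of valuations: a sum of nonzero terms with pairwise distinct valuations has the
    valuation of one of the terms, and in particular does not vanish. *)
Lemma is_unit_sum (s : seq algC) : all (predC1 0) s ->
  (forall i j, (i < j < size s)%N -> ~ is_unit (s`_i / s`_j)) -> s != [::] ->
  exists2 x, x \in s & is_unit ((\sum_(y <- s) y) / x).
Proof.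
elim: s => // x s IHs /= /andP[x0 s0] sep _.
have [->|sn] := eqVneq s [::].
  by exists x; rewrite ?mem_seq1 // big_seq1 divff //; exact: is_unit1.
have [i j /andP[ij js]|//|y ys uy] := IHs s0.
  by apply: (sep i.+1 j.+1); rewrite ltnS ij.
have y0 : y != 0 by apply: (allP s0).
set S := \sum_(z <- s) z in uy.
have S0 : S != 0 by case: uy; rewrite mulf_eq0 => /norP[].
rewrite big_cons -/S; have [|h|h] := is_unit_dominant x0 S0.
- move=> h; have [/= l ls] := (nthP 0 ys); move=> Dy.
  apply: (sep 0%N l.+1); rewrite //= Dy.
  have -> : x / y = (x / S) * (S / y) by field; rewrite S0 y0.
  exact: is_unitM.
- by exists x; rewrite ?mem_head.
- exists y; first by rewrite inE ys orbT.
  have -> : (x + S) / y = ((x + S) / S) * (S / y) by field; rewrite S0 y0.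
  exact: is_unitM.
Qed.

Lemma is_unit_nat n : coprime p n -> is_unit n%:R.
Proof.
move=> co; have n0 : (0 < n)%N.
  by rewrite lt0n; apply: contraTneq co => ->; rewrite /coprime gcdn0 gtn_eqF ?prime_gt1.
have Vn m : V m%:R by exact: subring_nat.
split=> //; first by rewrite pnatr_eq0 -lt0n.
have [u v e _] := egcdnP p n0; rewrite gcdnC (eqP co) in e.
have h : is_unit (u * n)%:R.
  rewrite e natrD addrC natrM mulrC.
  have [->|v0] := eqVneq v 0%N; first by rewrite mulr0 addr0; exact: is_unit1.
  apply: local_inverse; first exact: (subringM sV).
  move=> h; apply: nVp; rewrite -[pC]/(p%:R).
  have v1 : (v%:R : algC) != 0 by rewrite pnatr_eq0.
  by rewrite -[p%:R^-1](mulfK v1) mulrAC -invfM mulrC; apply: (subringM sV).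
have [nz _ h'] := h; move: nz; rewrite natrM mulf_eq0 => /norP[u0 n1].
have -> : (n%:R : algC)^-1 = u%:R * (u * n)%:R^-1 by rewrite natrM; field; rewrite u0 n1.
exact: (subringM sV).
Qed.

Lemma quotient_of_monomials (F : fieldType) (a b y z t : F) :
    a != 0 -> b != 0 -> z != 0 -> t != 0 ->
  a * (y * z) / (b * z) / (a / b * t) = y / t.
Proof. by move=> a0 b0 z0 t0; field; rewrite a0 b0 z0 t0. Qed.

Lemma subring_exprz (k : int) : V (pC ^ k) -> 0 <= k.
Proof.
case: k => // n; rewrite NegzE -exprz_inv => h; exfalso; apply: nVp.
have -> : pC^-1 = pC ^+ n * pC^-1 ^+ n.+1.
  by rewrite exprS mulrCA -exprMn divff // expr1n mulr1.
by apply: (subringM sV) => //; apply: (subringX sV); exact: subring_nat.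
Qed.

Lemma is_unit_exprz (k : int) : is_unit (pC ^ k) -> k = 0.
Proof.
move=> [_ /subring_exprz k0]; rewrite invr_expz => /subring_exprz.
by rewrite oppr_ge0 => k0'; apply/eqP; rewrite eq_le k0 k0'.
Qed.

(** The opposite of the usual valuation, so that the p-adic absolute value of a nonzero [q] is [p]
    to the power [rat_val q]. *)
Definition rat_val (q : rat) : int :=
  (logn p `|denq q|)%:Z - (logn p `|numq q|)%:Z.

Lemma is_unit_nat_val n : (0 < n)%N -> is_unit (n%:R / pC ^+ logn p n).
Proof.
move=> n0; have [m co Dn] := pfactor_coprime p_pr n0.
have -> : (n%:R : algC) = m%:R * pC ^+ logn p n by rewrite {1}Dn natrM natrX.
by rewrite mulfK ?expf_neq0 //; exact: is_unit_nat.
Qed.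

Lemma is_unit_rat q : q != 0 -> is_unit (ratr q * pC ^ rat_val q).
Proof.
move=> q0.
have dn : is_unit (`|denq q|%N%:R / pC ^+ logn p `|denq q|).
  by apply: is_unit_nat_val; rewrite absz_gt0.
have nn : is_unit ((numq q)%:~R / pC ^+ logn p `|numq q|).
  have : is_unit (`|numq q|%N%:R / pC ^+ logn p `|numq q|).
    by apply: is_unit_nat_val; rewrite absz_gt0 numq_eq0.
  case: (numq q) => n //=; rewrite NegzE mulrNz mulNr; exact: is_unitN.
have := is_unitM nn (is_unitV dn); congr is_unit.
rewrite /ratr /rat_val expfzDr // -invr_expz -!exprnP.
have -> : (denq q)%:~R = `|denq q|%N%:R :> algC by rewrite -{1}absz_denq.
by field; rewrite !expf_neq0 // pnatr_eq0 absz_eq0 denq_neq0.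
Qed.

(** The monomials of the minimal polynomial, evaluated at [x], sum to zero. By [is_unit_sum] two of
    them have the same valuation, so some power of [x] is, up to a unit, a rational number and
    therefore a power of [p]. The value group thus has rank one and embeds in the reals. *)
Lemma val_exists x : x != 0 -> exists m (k : int), (0 < m)%N /\ is_unit (x ^+ m * pC ^ k).
Proof.
move=> x0; apply: contrapT => no.
have [q [Dq mq] _] := minCpolyP x.
pose f i := ratr q`_i * x ^+ i.
pose idx := [seq i <- iota 0 (size q) | q`_i != 0].
have idxP i : i \in idx -> q`_i != 0 by rewrite mem_filter => /andP[].
have [|||y _ [+ _ _]] := @is_unit_sum (map f idx).
- by apply/allP => _ /mapP[i /idxP qi ->]; rewrite /= mulf_neq0 ?fmorph_eq0 ?expf_neq0.
- move=> i j; rewrite size_map => /andP[ij js]; have is_ := ltn_trans ij js.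
  rewrite !(nth_map 0%N) // => /is_unitV; rewrite invf_div.
  have lt : (nth 0 idx i < nth 0 idx j)%N.
    have srt : sorted ltn idx by apply: sorted_filter; [exact: ltn_trans|exact: iota_ltn_sorted].
    by rewrite (sorted_ltn_nth ltn_trans 0%N srt).
  have qi := idxP _ (mem_nth 0%N is_); have qj := idxP _ (mem_nth 0%N js).
  move: (nth _ _ i) (nth _ _ j) lt qi qj => i' j' lt qi qj h; apply: no.
  have r0 : q`_j' / q`_i' != 0 by rewrite mulf_neq0 ?invr_eq0.
  exists (j' - i')%N, (- rat_val (q`_j' / q`_i')); split; first by rewrite subn_gt0.
  have := is_unitM h (is_unitV (is_unit_rat r0)); congr is_unit.
  rewrite /f; have -> : x ^+ j' = x ^+ (j' - i') * x ^+ i' by rewrite -exprD subnK // ltnW.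
  rewrite fmorph_div -invr_expz.
  by apply: quotient_of_monomials; rewrite ?fmorph_eq0 ?expfz_neq0 ?expf_neq0.
- have : size q != 0%N by rewrite size_poly_eq0 monic_neq0.
  move=> sq; have : has (fun i => q`_i != 0) (iota 0 (size q)); last first.
    by rewrite has_filter -/idx; case: (idx).
  apply/hasP.
  exists (size q).-1; first by rewrite mem_iota add0n ltn_predL lt0n.
  by rewrite -lead_coefE (monicP mq) oner_neq0.
rewrite big_map big_filter; apply/negP; rewrite negbK mulf_eq0; apply/orP; left.
have /rootP : root (minCpoly x) x by exact: root_minCpoly.
rewrite Dq horner_coef size_map_poly => e.
rewrite -[X in _ == X]e; apply/eqP; rewrite -(big_mkord xpredT (fun i => (map_poly ratr q)`_i * x ^+ i)).
rewrite /index_iota subn0 big_mkcond; apply: eq_bigr => i _.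
by rewrite coef_map /=; case: eqP => //= ->; rewrite rmorph0 mul0r.
Qed.

Variable R : realType.
Local Notation pR := (p%:R : R).

Let pR0 : 0 < pR. Proof. by rewrite ltr0n prime_gt0. Qed.

(* The value group lies in the divisible hull of the powers of [p], so the
   absolute value of [x] is read off from a power of [x] which is, up to a unit,
   a power of [p]. *)
Definition val_spec x (r : R) :=
  0 < r /\ exists m (k : int), [/\ (0 < m)%N, is_unit (x ^+ m * pC ^ k) & r ^+ m = pR ^ k].

Lemma val_spec_exists x : x != 0 -> exists r, val_spec x r.
Proof.
move=> /val_exists[m [k [m0 u]]].
have pk : 0 < pR ^ k by rewrite exprz_gt0.
exists ((pR ^ k) `^ m%:R^-1); split; first by rewrite powR_gt0.
exists m, k; split=> //.
by rewrite -powR_mulrn ?powR_ge0 // -powRrM mulVf ?powRr1 ?pnatr_eq0 -?lt0n // ltW.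
Qed.

Lemma val_spec_unique x r s : val_spec x r -> val_spec x s -> r = s.
Proof.
move=> [r0 [m [k [m0 u e]]]] [s0 [m' [k' [m0' u' e']]]].
have h : k * m' = k' * m.
  apply/eqP; rewrite -subr_eq0; apply/eqP/is_unit_exprz.
  have := is_unitM (is_unitX m' u) (is_unitV (is_unitX m u')); congr is_unit.
  have x0 : x != 0 by case: u => + _ _; rewrite mulf_eq0 expf_eq0 m0 => /norP[].
  rewrite expfzDr // -invr_expz !exprMn -!exprM mulnC -!exprz_exp -!exprnP.
  by field; rewrite !expf_neq0 ?expfz_neq0.
apply/eqP; rewrite -(@eqrXn2 _ (m * m')%N _ _ _ (ltW r0) (ltW s0)) ?muln_gt0 ?m0 //.
by rewrite exprM e mulnC exprM e' !exprnP !exprz_exp h.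
Qed.

Lemma val_specM x y r s : val_spec x r -> val_spec y s -> val_spec (x * y) (r * s).
Proof.
move=> [r0 [m [k [m0 u e]]]] [s0 [m' [k' [m0' u' e']]]]; split; first exact: mulr_gt0.
exists (m * m')%N, (k * m' + k' * m); split; first by rewrite muln_gt0 m0.
  have := is_unitM (is_unitX m' u) (is_unitX m u'); congr is_unit.
  rewrite expfzDr // -!exprz_exp -!exprnP !exprMn !exprM -!exprM [(m' * m)%N]mulnC.
  by ring.
rewrite exprMn exprM e [(m * m')%N]mulnC exprM e' expfzDr ?gt_eqF //.
by rewrite !exprnP !exprz_exp.
Qed.

(** The exponent [m] does no harm because [V] is integrally closed: it contains [x] as soon as it
    contains a power of [x]. *)
Lemma val_spec_le1 x r : val_spec x r -> (r <= 1) <-> V x.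
Proof.
move=> [r0 [m [k [m0 u e]]]].
have p1 : 1 < pR by rewrite ltr1n prime_gt1.
have -> : (r <= 1) = (k <= 0).
  rewrite -(expr_le1 m0 (ltW r0)) e.
  by rewrite -[X in _ <= X](expr0z pR) ler_eXz2l.
have [nz ux ux'] := u.
have x0 : x != 0 by move: nz; rewrite mulf_eq0 expf_eq0 m0 => /norP[].
split=> [k0|Vx].
  have Vm : V (x ^+ m).
    rewrite -[x ^+ m](mulfK (expfz_neq0 k pC0)); apply: (subringM sV) => //.
    rewrite invr_expz; case: k k0 {u e nz ux ux'} => [[|n]|n] // _.
      by rewrite oppr0 expr0z; exact: subring1.
    by rewrite NegzE opprK -exprnP; apply: (subringX sV); exact: subring_nat.
  have [//|Vx'] := totV x0.
  have -> : x = x ^+ m * x^-1 ^+ m.-1.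
    case: m m0 {u e nz ux ux' Vm} => // m _ /=.
    by rewrite exprS -mulrA -exprMn divff // expr1n mulr1.
  by apply: (subringM sV) => //; exact: (subringX sV).
rewrite -oppr_ge0; apply: subring_exprz; rewrite -invr_expz.
have -> : (pC ^ k)^-1 = x ^+ m * (x ^+ m * pC ^ k)^-1.
  by rewrite invfM mulrA divff ?mul1r // expf_neq0.
by apply: (subringM sV) => //; exact: (subringX sV).
Qed.

Definition val_abs x : R := if x == 0 then 0 else xget 0 [set r | val_spec x r].

Lemma val_absP x : x != 0 -> val_spec x (val_abs x).
Proof.
move=> x0; rewrite /val_abs (negPf x0).
have [r hr] := val_spec_exists x0.
by apply: (@xgetPex R 0 [set r | val_spec x r]); exists r.
Qed.

Lemma val_absE x r : x != 0 -> val_spec x r -> val_abs x = r.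
Proof. by move=> /val_absP h /(val_spec_unique h). Qed.

Lemma val_abs_ge0 x : 0 <= val_abs x.
Proof.
have [->|/val_absP[/ltW//]] := eqVneq x 0.
by rewrite /val_abs eqxx.
Qed.

Lemma val_abs_eq0 x : (val_abs x == 0) = (x == 0).
Proof.
have [->|x0] := eqVneq x 0; first by rewrite /val_abs eqxx eqxx.
by have [h _] := val_absP x0; rewrite gt_eqF.
Qed.

Lemma val_absM x y : val_abs (x * y) = val_abs x * val_abs y.
Proof.
have [->|x0] := eqVneq x 0; first by rewrite mul0r /val_abs eqxx mul0r.
have [->|y0] := eqVneq y 0; first by rewrite mulr0 /val_abs eqxx mulr0.
apply: val_absE; first exact: mulf_neq0.
by apply: val_specM; exact: val_absP.
Qed.

Lemma val_abs_le1 x : val_abs x <= 1 <-> V x.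
Proof.
have [->|x0] := eqVneq x 0; last exact/val_spec_le1/val_absP.
by rewrite /val_abs eqxx ler01; split => // _; exact: subring0.
Qed.

Lemma val_abs_max x y : val_abs (x + y) <= Num.max (val_abs x) (val_abs y).
Proof.
wlog suff key : x y / val_abs y != 0 /\ val_abs x <= val_abs y -> val_abs (x + y) <= val_abs y.
  have z0 : val_abs 0 = 0 by rewrite /val_abs eqxx.
  have [->|x0] := eqVneq x 0; first by rewrite add0r le_max lexx orbT.
  have [->|y0] := eqVneq y 0; first by rewrite addr0 le_max lexx.
  have [xy|/ltW yx] := leP (val_abs x) (val_abs y).
    by apply: key; rewrite val_abs_eq0.
  by rewrite addrC; apply: key; rewrite val_abs_eq0.
move=> [y0 xy]; have y0' : y != 0 by rewrite -val_abs_eq0.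
have -> : x + y = (x / y + 1) * y by field.
rewrite val_absM -[leRHS]mul1r ler_wpM2r ?val_abs_ge0 //.
apply/val_abs_le1; apply: (subringD sV); last exact: subring1.
apply/val_abs_le1; rewrite -(@ler_pM2r _ (val_abs y)) ?lt_def ?y0 ?val_abs_ge0 //.
by rewrite -val_absM mulfVK // mul1r.
Qed.

Lemma val_abs_rat q : val_abs (ratr q) = padic_abs R p q.
Proof.
rewrite /padic_abs; case: eqVneq => [->|q0]; first by rewrite rmorph0 /val_abs eqxx.
apply: val_absE; first by rewrite fmorph_eq0.
split; first by rewrite divr_gt0 // exprn_gt0.
exists 1%N, (rat_val q); split; rewrite // ?expr1; first exact: is_unit_rat.
by rewrite /rat_val expfzDr ?gt_eqF // -invr_expz.
Qed.

Lemma val_absD x y : val_abs (x + y) <= val_abs x + val_abs y.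
Proof.
apply: le_trans (val_abs_max x y) _.
by rewrite ge_max lerDl lerDr !val_abs_ge0.
Qed.

Definition valuation_absval : absval R :=
  AbsVal val_abs_ge0 val_abs_eq0 val_absM val_absD.

End ValuationAbs.

Lemma padic_absval_exists (R : realType) : exists w : absval R,
  (forall q, w (ratr q) = padic_abs R p q) /\
  (forall x y, w (x + y) <= Num.max (w x) (w y)).
Proof.
have [V [sV nV mV]] := maximal_subring_exists.
have tV := maximal_subring_total sV nV mV.
exists (valuation_absval sV nV tV R); split.
  exact: val_abs_rat.
exact: val_abs_max.
Qed.

End ValuationRing.

(** * Places and local degrees *)

Section AbsoluteValue.
Variables (R : realType) (F : set algC) (v : algC -> R).
Hypotheses (hF : is_subfield F) (hv : absolute_value F v).

Lemma absv_ge0 x : 0 <= v x.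
Proof.
have [Fx|nFx] := pselect (F x); first by case: hv => _ + _ _ _; apply.
by case: hv => h _ _ _ _; rewrite h.
Qed.

Lemma absv0 : v 0 = 0.
Proof. by have F0 := subfield0 hF; case: hv => _ _ h _ _; apply/(h _ F0). Qed.

Lemma absv_eq0 x : F x -> (v x == 0) = (x == 0).
Proof. by move=> Fx; case: hv => _ _ h _ _; apply/eqP/eqP => /(h _ Fx). Qed.

Lemma absvM x y : F x -> F y -> v (x * y) = v x * v y.
Proof. by case: hv => _ _ _ h _; exact: h. Qed.

Lemma absvD x y : F x -> F y -> v (x + y) <= v x + v y.
Proof. by case: hv => _ _ _ _ h; exact: h. Qed.

Lemma absv1 : v 1 = 1.
Proof.
have F1 := subfield1 hF.
have v1 : v 1 != 0 by rewrite absv_eq0 // oner_neq0.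
by apply: (mulfI v1); rewrite -absvM // !mulr1.
Qed.

Lemma absvX x n : F x -> v (x ^+ n) = v x ^+ n.
Proof.
move=> Fx; elim: n => [|n IHn]; rewrite ?expr0 ?absv1 // !exprS absvM ?IHn //.
exact: subfieldX.
Qed.

Lemma absvN x : F x -> v (- x) = v x.
Proof.
move=> Fx; apply/eqP; rewrite -(@eqrXn2 _ 2) ?absv_ge0 //.
by rewrite -!absvX ?sqrrN //; exact: subfieldN.
Qed.

Lemma absvB x y : F x -> F y -> v (x - y) <= v x + v y.
Proof. by move=> Fx Fy; rewrite -(absvN Fy) absvD //; exact: subfieldN. Qed.

Lemma absvV x : F x -> v x^-1 = (v x)^-1.
Proof.
move=> Fx; have [->|x0] := eqVneq x 0; first by rewrite invr0 absv0 invr0.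
have vx : v x != 0 by rewrite absv_eq0.
by apply: (mulfI vx); rewrite -absvM ?divff ?absv1 //; exact: subfieldV.
Qed.

Lemma absv_sum I (r : seq I) (P : pred I) f : (forall i, P i -> F (f i)) ->
  v (\sum_(i <- r | P i) f i) <= \sum_(i <- r | P i) v (f i).
Proof.
move=> Ff; suff: F (\sum_(i <- r | P i) f i) /\
  v (\sum_(i <- r | P i) f i) <= \sum_(i <- r | P i) v (f i) by case.
apply: (big_ind2 (fun x y => F x /\ v x <= y)) => [|x1 x2 y1 y2 [F1 h1] [F2 h2]|i Pi].
- by rewrite absv0; split => //; exact: subfield0.
- split; first exact: subfieldD.
  by apply: le_trans (absvD _ _) _ => //; exact: lerD.
- by split=> //; exact: Ff.
Qed.

Lemma absv_gt0 x : F x -> (0 < v x) = (x != 0).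
Proof. by move=> Fx; rewrite lt_def absv_eq0 // absv_ge0 andbT. Qed.

Lemma null_seqP x : null_seq v x <->
  forall e, 0 < e -> exists N, forall k, (N <= k)%N -> v (x k) < e.
Proof.
split=> [/cvgrPdist_lt h e /h [N _ hN]|h].
  by exists N => k /hN; rewrite sub0r normrN ger0_norm ?absv_ge0.
apply/cvgrPdist_lt => e /h[N hN]; exists N => // k /hN.
by rewrite sub0r normrN ger0_norm ?absv_ge0.
Qed.

Lemma cauchy_const G x : G `<=` F -> G x -> cauchy_in G v (fun=> x).
Proof. by move=> GF Gx; split=> // e e0; exists 0%N => k l _ _; rewrite subrr absv0. Qed.

Lemma not_null_bounded G x : G `<=` F -> cauchy_in G v x -> ~ null_seq v x ->
  exists e, 0 < e /\ exists N, forall k, (N <= k)%N -> e <= v (x k).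
Proof.
move=> GF [Gx cx] /null_seqP /existsNP[e /not_implyP[e0 he]].
have e2 : 0 < e / 2 by rewrite divr_gt0.
exists (e / 2); split => //; have [N hN] := cx _ e2; exists N => k Nk.
rewrite leNgt; apply/negP => ke; apply: he; exists N => l Nl.
have -> : x l = (x l - x k) + x k by rewrite subrK.
apply: le_lt_trans (absvD _ _) _; first by apply: subfieldB => //; exact: GF.
  exact: GF.
by rewrite [e]splitr ltrD // hN.
Qed.

End AbsoluteValue.

(** * Bases of a completion over the completion of the rationals *)

Section LocalBasis.
Variables (R : realType) (F : set algC) (v : algC -> R).
Hypotheses (hF : is_subfield F) (hv : absolute_value F v).
Variables (n : nat) (e : 'I_n -> algC).
Hypotheses (eF : forall i, F (e i)) (span : forall x, F x ->
  exists2 q : 'I_n -> algC, forall i, QQ (q i) & x = \sum_i q i * e i).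

Let QF : QQ `<=` F. Proof. exact: QQ_sub. Qed.

Let FcombQ (q : 'I_n -> algC) (I : {set 'I_n}) : (forall i, QQ (q i)) ->
  F (\sum_(i in I) q i * e i).
Proof. by move=> Qq; apply: subfield_sum => // i _; apply: subfieldM => //; exact: QF. Qed.

(** Independence of the [e i] over the completion of [QQ], whose elements are Cauchy sequences
    modulo null sequences. *)
Definition local_indep (I : {set 'I_n}) := forall c : 'I_n -> nat -> algC,
  (forall i, cauchy_in QQ v (c i)) ->
  null_seq v (fun k => \sum_(i in I) c i k * e i) ->
  forall i, i \in I -> null_seq v (c i).

Lemma local_indepD1 (I : {set 'I_n}) i0 : i0 \in I -> local_indep I -> local_indep (I :\ i0).
Proof.
move=> i0I hI c cc hc i; rewrite in_setD1 => /andP[ii0 iI].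
have Q0 : cauchy_in QQ v (fun=> 0).
  by apply: (cauchy_const hF hv) => //; exact: subfield0 QQ_subfield.
pose d i := if i == i0 then fun=> 0 else c i.
have -> : c i = d i by rewrite /d (negPf ii0).
apply: hI iI => [j|]; first by rewrite /d; case: ifP.
rewrite [X in null_seq v X](_ : _ = fun k => \sum_(i in I :\ i0) c i k * e i) //.
apply/funext => k; rewrite (big_setD1 i0) //= {1}/d eqxx mul0r add0r.
by apply: eq_bigr => j; rewrite in_setD1 /d => /andP[/negPf->].
Qed.

Lemma inv_lt (d : R) : 0 < d -> exists N, forall k, (N <= k)%N -> k.+1%:R^-1 < d.
Proof.
move=> d0; exists (Num.bound d^-1) => k hk.
rewrite -[d]invrK ltf_pV2 ?posrE ?invr_gt0 //.
apply: lt_le_trans (archi_boundP _) _; first by rewrite invr_ge0 ltW.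
by rewrite ler_nat leqW.
Qed.

(** Continuity of the coordinates, by induction on the size of [I]. If it fails at [i0], there are
    combinations tending to 0 with coordinate 1 at [i0]. Their differences have no [i0] term, so the
    bound for the smaller set makes the other coordinates Cauchy, and the limit contradicts
    independence. *)
Lemma coordinate_bound (I : {set 'I_n}) : local_indep I -> forall i0, i0 \in I ->
  exists d, 0 < d /\ forall q : 'I_n -> algC, (forall i, QQ (q i)) ->
    d * v (q i0) <= v (\sum_(i in I) q i * e i).
Proof.
have [m] := ubnP #|I|; elim: m => // m IHm in I *; move=> Im hI i0 i0I.
apply: contrapT => no.
have {no} /choice[q hq] (k : nat) : exists q : 'I_n -> algC, (forall i, QQ (q i)) /\
    v (\sum_(i in I) q i * e i) < k.+1%:R^-1 * v (q i0).
  apply: contrapT => no'; apply: no; exists k.+1%:R^-1; split; first by rewrite invr_gt0.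
  by move=> q Qq; rewrite leNgt; apply/negP => lt; apply: no'; exists q.
have q0 k : q k i0 != 0.
  have [Qq] := hq k; rewrite -(absv_gt0 hv) => [|]; last exact: QF.
  move=> h; have := le_lt_trans (absv_ge0 hv _) h.
  by rewrite pmulr_rgt0 // invr_gt0.
pose c i k := if i \in I then q k i / q k i0 else 0.
have Qc i k : QQ (c i k).
  rewrite /c; case: ifP => _; last exact: subfield0 QQ_subfield.
  by have [Qq _] := hq k; exact: subfield_div QQ_subfield _ _ _ _.
have FS k : F (\sum_(i in I) c i k * e i) by apply: (FcombQ (q := fun i => c i k)).
have small k : v (\sum_(i in I) c i k * e i) < k.+1%:R^-1.
  have [Qq h] := hq k.
  have -> : \sum_(i in I) c i k * e i = (\sum_(i in I) q k i * e i) / q k i0.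
    by rewrite mulr_suml; apply: eq_bigr => i iI; rewrite /c iI mulrAC.
  have Fq : F (q k i0) by exact: QF.
  have FS0 := FcombQ I Qq.
  rewrite (absvM hv FS0 (subfieldV hF Fq)) (absvV hF hv Fq).
  by rewrite ltr_pdivrMr // (absv_gt0 hv Fq).
have c1 k : c i0 k = 1 by rewrite /c i0I divff.
have cc i : cauchy_in QQ v (c i).
  split=> // eps eps0.
  have [->|ii0] := eqVneq i i0.
    by exists 0%N => k l _ _; rewrite !c1 subrr (absv0 hF hv).
  have [iI|iI] := boolP (i \in I); last first.
    by exists 0%N => k l _ _; rewrite /c (negPf iI) subrr (absv0 hF hv).
  have [||d [d0 hd]] := IHm (I :\ i0) _ (local_indepD1 i0I hI) i.
  - by rewrite (cardsD1 i0) i0I in Im.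
  - by rewrite in_setD1 ii0 iI.
  have de : 0 < d * eps / 2 by rewrite divr_gt0 ?mulr_gt0.
  have [N hN] := inv_lt de; exists N => k l Nk Nl.
  rewrite -(ltr_pM2l d0); apply: le_lt_trans (hd (fun j => c j k - c j l) _) _.
    by move=> j; exact: subfieldB QQ_subfield _ _ _ _.
  have -> : \sum_(j in I :\ i0) (c j k - c j l) * e j =
     (\sum_(i in I) c i k * e i) - (\sum_(i in I) c i l * e i).
    rewrite !(big_setD1 i0 i0I) /= !c1 opprD addrACA subrr add0r -sumrB.
    by apply: eq_bigr => j _; rewrite mulrBl.
  apply: le_lt_trans (absvB hF hv (FS k) (FS l)) _.
  by rewrite [d * eps]splitr ltrD // (lt_trans (small _)) // hN.
have /(null_seqP hv) : null_seq v (c i0).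
  apply: hI i0I => //; apply/(null_seqP hv) => eps /inv_lt[N hN].
  by exists N => k /hN; apply: lt_trans.
move=> /(_ 1 ltr01)[N /(_ N (leqnn N))].
by rewrite c1 (absv1 hF hv) ltxx.
Qed.

(** For [j] outside [I], maximality gives a null combination with a coefficient that is not null.
    The coefficient of [e j] cannot be null either, by independence of [I]; it is thus bounded away
    from 0, and dividing by it approximates [e j]. *)
Lemma local_dense (I : {set 'I_n}) : (forall j, j \notin I -> ~ local_indep (j |: I)) ->
  local_indep I -> forall x, F x -> forall eps, 0 < eps ->
  exists q : 'I_n -> algC, (forall i, QQ (q i)) /\
    v (x - \sum_(i in I) q i * e i) < eps.
Proof.
move=> maxI indI.
have dense_gen j eps : 0 < eps -> exists q : 'I_n -> algC, (forall i, QQ (q i)) /\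
    v (e j - \sum_(i in I) q i * e i) < eps.
  move=> eps0; have [jI|jI] := boolP (j \in I).
    exists (fun i => (i == j)%:R); split; first by move=> i; exact: subfield_nat QQ_subfield _.
    rewrite (big_setD1 j) //= eqxx mul1r big1 ?addr0 ?subrr ?(absv0 hF hv) //.
    by move=> i; rewrite in_setD1 => /andP[/negPf-> _]; rewrite mul0r.
  have /existsNP[c /not_implyP[cc /not_implyP[hc /existsNP[i /not_implyP[iI ni]]]]] := maxI j jI.
  have Fc k l : F (c k l) by apply: QF; case: (cc k).
  have FcI k : F (\sum_(i in I) c i k * e i).
    by apply: (FcombQ (q := fun i => c i k)) => l; case: (cc l).
  have sumjI k : \sum_(i in j |: I) c i k * e i = c j k * e j + \sum_(i in I) c i k * e i.
    by rewrite big_setU1.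
  have nj : ~ null_seq v (c j).
    move=> /(null_seqP hv) nj.
    have hI : null_seq v (fun k => \sum_(i in I) c i k * e i).
      apply/(null_seqP hv) => d d0.
      have [N1 hN1] : exists N, forall k, (N <= k)%N -> v (c j k) * v (e j) < d / 2.
        have [ve0|ve0] := eqVneq (v (e j)) 0.
          by exists 0%N => k _; rewrite ve0 mulr0 divr_gt0.
        have ve1 : 0 < v (e j) by rewrite lt_def ve0 (absv_ge0 hv).
        have [|N hN] := nj (d / 2 / v (e j)); first by rewrite !divr_gt0.
        by exists N => k /hN; rewrite ltr_pdivlMr.
      have d2 : 0 < d / 2 by rewrite divr_gt0.
      have [N2 hN2] := (null_seqP hv _).1 hc _ d2.
      exists (maxn N1 N2) => k; rewrite geq_max => /andP[k1 k2].
      have -> : \sum_(i in I) c i k * e i =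
          (\sum_(i in j |: I) c i k * e i) - c j k * e j by rewrite sumjI addrC addKr.
      apply: le_lt_trans (absvB hF hv _ _) _.
      - by rewrite sumjI; apply: subfieldD => //; exact: subfieldM.
      - exact: subfieldM.
      - by rewrite [d]splitr ltrD ?hN2 // (absvM hv) // hN1.
    move: iI; rewrite in_setU1 => /orP[/eqP ij|iI]; last exact/ni/(indI c).
    by apply: ni; rewrite ij; apply/(null_seqP hv).
  have [eta [eta0 [N1 hN1]]] := not_null_bounded hF hv QF (cc j) nj.
  have [N2 hN2] := (null_seqP hv _).1 hc _ (mulr_gt0 eps0 eta0).
  pose k := maxn N1 N2.
  have vc : eta <= v (c j k) by apply: hN1; exact: leq_maxl.
  have vc0 : 0 < v (c j k) by exact: lt_le_trans vc.
  have cj0 : c j k != 0 by rewrite -(absv_gt0 hv).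
  exists (fun i => - (c i k / c j k)); split.
    move=> l; apply: (subfieldN QQ_subfield); apply: (subfield_div QQ_subfield).
      by case: (cc l).
    by case: (cc j).
  have -> : e j - \sum_(i in I) - (c i k / c j k) * e i =
      (\sum_(i in j |: I) c i k * e i) * (c j k)^-1.
    rewrite sumjI mulrDl mulrAC divff // mul1r mulr_suml -sumrN; congr (_ + _).
    by apply: eq_bigr => l _; rewrite mulNr opprK mulrAC.
  have FS : F (\sum_(i in j |: I) c i k * e i).
    by rewrite sumjI; apply: subfieldD => //; exact: subfieldM.
  rewrite (absvM hv FS (subfieldV hF (Fc _ _))) (absvV hF hv (Fc _ _)).
  rewrite ltr_pdivrMr //; apply: lt_le_trans (hN2 k (leq_maxr _ _)) _.
  by rewrite ler_pM2l.
move=> x /span[r Qr ->] eps eps0.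
pose B := 1 + \sum_j v (r j).
have B0 : 0 < B by rewrite ltr_pwDl // sumr_ge0 // => j _; exact: (absv_ge0 hv).
have {dense_gen} /choice[q hq] (j : 'I_n) : exists q : 'I_n -> algC, (forall i, QQ (q i)) /\
    v (e j - \sum_(i in I) q i * e i) < eps / B.
  by apply: dense_gen; rewrite divr_gt0.
exists (fun i => \sum_j r j * q j i); split.
  move=> i; apply: (subfield_sum QQ_subfield) => j _.
  by apply: (subfieldM QQ_subfield) => //; case: (hq j).
have Fr j : F (r j) by exact: QF.
have Fd j : F (e j - \sum_(i in I) q j i * e i).
  by apply: subfieldB => //; apply: FcombQ; case: (hq j).
have -> : \sum_i r i * e i - \sum_(i in I) (\sum_j r j * q j i) * e i =
    \sum_j r j * (e j - \sum_(i in I) q j i * e i).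
  under [X in _ - X]eq_bigr do rewrite mulr_suml.
  rewrite exchange_big -sumrB; apply: eq_bigr => j _ /=.
  by rewrite mulrBr mulr_sumr; under [in RHS]eq_bigr do rewrite mulrA.
have Fm j : F (r j * (e j - \sum_(i in I) q j i * e i)) by exact: subfieldM.
apply: le_lt_trans (absv_sum hF hv _ (fun j _ => Fm j)) _.
apply: le_lt_trans (_ : _ <= (\sum_j v (r j)) * (eps / B)) _.
  rewrite mulr_suml; apply: ler_sum => j _; rewrite (absvM hv) //.
  by apply: ler_wpM2l; [exact: (absv_ge0 hv)|case: (hq j) => _ /ltW].
by rewrite mulrA ltr_pdivrMr // mulrC ltr_pM2l // /B ltrDr.
Qed.

(** A maximal locally independent part of a rational basis works: density approximates any Cauchy
    sequence by rational combinations, and [coordinate_bound] makes their coefficients Cauchy. This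
    keeps [local_degree] from taking its default value 0. *)
Lemma local_basis_exists : exists m (b : 'I_m -> nat -> algC), is_local_basis F v b.
Proof.
have exI : exists I : {set 'I_n}, `[< local_indep I >].
  by exists finset.set0; apply/asboolP => c _ _ i; rewrite finset.in_set0.
have [I0 hI0] := exI.
case: (@arg_maxnP _ I0 (fun I => `[< local_indep I >]) (fun I => #|I|) hI0) => I /asboolP indI maxI.
have dense : forall x, F x -> forall eps, 0 < eps -> exists q : 'I_n -> algC,
    (forall i, QQ (q i)) /\ v (x - \sum_(i in I) q i * e i) < eps.
  apply: local_dense => // j jI /asboolP /maxI.
  by rewrite /= cardsU1 jI add1n ltnn.
exists #|I|, (fun i => fun=> e (enum_val i)); split.
- by move=> i; exact: (cauchy_const hF hv).
- move=> x [Fx cx].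
  have /choice[q hq] (k : nat) : exists q : 'I_n -> algC, (forall i, QQ (q i)) /\
      v (x k - \sum_(i in I) q i * e i) < k.+1%:R^-1.
    by apply: dense => //; rewrite invr_gt0.
  have FS k : F (\sum_(i in I) q k i * e i) by apply: FcombQ; case: (hq k).
  have Fd k : F (x k - \sum_(i in I) q k i * e i) by exact: subfieldB.
  exists (fun i k => q k (enum_val i)); split; last first.
    apply/(null_seqP hv) => eps /inv_lt[N hN]; exists N => k /hN.
    apply: lt_trans; rewrite -(big_enum_val (fun i => q k i * e i)).
    by case: (hq k).
  move=> i; split; first by move=> k; case: (hq k).
  move=> eps eps0.
  have [d [d0 hd]] := coordinate_bound indI (enum_valP i).
  have de : 0 < d * eps / 3 by rewrite divr_gt0 ?mulr_gt0.
  have [N1 hN1] := inv_lt de; have [N2 hN2] := cx _ de.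
  exists (maxn N1 N2) => k l; rewrite !geq_max => /andP[k1 k2] /andP[l1 l2].
  rewrite -(ltr_pM2l d0); apply: le_lt_trans (hd (fun j => q k j - q l j) _) _.
    by move=> j; apply: (subfieldB QQ_subfield); [case: (hq k)|case: (hq l)].
  have -> : \sum_(j in I) (q k j - q l j) * e j = (x k - x l) -
     (x k - \sum_(i in I) q k i * e i) + (x l - \sum_(i in I) q l i * e i).
    under eq_bigr do rewrite mulrBl.
    by rewrite sumrB; ring.
  have Fxx : F (x k - x l) by exact: subfieldB.
  apply: le_lt_trans (absvD hv _ _) _ => //; first exact: subfieldB.
  have e3 : d * eps = d * eps / 3 + d * eps / 3 + d * eps / 3 by field.
  rewrite [ltRHS]e3; apply: ltrD; last first.
    by case: (hq l) => _ /lt_trans; apply; exact: hN1.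
  apply: le_lt_trans (absvB hF hv Fxx (Fd k)) _; apply: ltrD; first exact: hN2.
  by case: (hq k) => _ /lt_trans; apply; exact: hN1.
move=> c cc hc i.
have Q0 : cauchy_in QQ v (fun=> 0).
  by apply: (cauchy_const hF hv) => //; exact: subfield0 QQ_subfield.
pose d l := if [pick j | enum_val j == l] is Some j then c j else fun=> 0.
have dE j : d (enum_val j) = c j.
  rewrite /d; case: pickP => [j' /eqP /enum_val_inj ->//|/(_ j)].
  by rewrite eqxx.
rewrite -dE; apply: (indI d) (enum_valP i) => [l|].
  by rewrite /d; case: pickP.
rewrite [X in null_seq v X](_ : _ = fun k => \sum_(i < #|I|) c i k * e (enum_val i)) //.
apply/funext => k; rewrite (big_enum_val (fun i => d i k * e i)) /=.
by apply: eq_bigr => j _; rewrite dE.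
Qed.

End LocalBasis.

(* Approximate Dedekind independence: if there were more embeddings than local
   basis elements, there would be normalized vectors [y_k] with
   [sum_j y_k,j s_j(x) -> 0] for all [x] in [F]. *)
Lemma embeddings_le_local_basis (R : realType) (F : set algC) (v : algC -> R)
    (w : absval R) m (s : 'I_m -> {rmorphism algC -> algC})
    n (e : 'I_n -> algC) l (b : 'I_l -> nat -> algC) :
    is_subfield F -> absolute_value F v -> is_basis QQ F e ->
    (forall j x, F x -> w (s j x) = v x) ->
    (forall i j, i != j -> exists2 z, F z & s i z != s j z) ->
    is_local_basis F v b ->
  (m <= l)%N.
Proof.
move=> hF hv he ws sep [cb spanb _]; rewrite leqNgt; apply/negP => lm.
have QF : QQ `<=` F by exact: QQ_sub.
have Fb i k : F (b i k) by case: (cb i).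
have setT_sub : is_subfield [set: algC] by exact: subfieldP.
have /choice[y hy] (k : nat) : exists y : 'I_m -> algC, [/\ forall j, w (y j) <= 1,
    exists j, y j = 1 & forall i, \sum_j y j * s j (b i k) = 0].
  have [//|y [_ [j0 yj0] hy]] := @subfield_relation _ _ _ (fun j i => s j (b i k)) setT_sub _ lm.
  have [j _ jmax] := @Order.TotalTheory.arg_maxP _ R _ j0 xpredT (fun j => w (y j)) isT.
  have yj : y j != 0.
    by rewrite -(av_gt0 w); apply: lt_le_trans (jmax j0 isT); rewrite av_gt0.
  exists (fun i => y i / y j); split.
  - by move=> i; rewrite avM avV ler_pdivrMr ?av_gt0 // mul1r; exact: jmax.
  - by exists j; rewrite divff.
  - move=> i; transitivity ((\sum_i' y i' * s i' (b i k)) / y j).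
      by rewrite mulr_suml; apply: eq_bigr => i' _; rewrite mulrAC.
    by rewrite hy mul0r.
have small x : F x -> forall eps, 0 < eps -> exists N, forall k, (N <= k)%N ->
    w (\sum_j y k j * s j x) < eps.
  move=> Fx eps eps0.
  have [c [cc /(null_seqP hv) hc]] := spanb _ (cauchy_const hF hv (fun _ => id) Fx).
  have e1 : 0 < eps / m.+1%:R by rewrite divr_gt0.
  have [N hN] := hc _ e1; exists N => k /hN {hN}.
  set d := x - _ => hd.
  have Fd : F d.
    apply: subfieldB => //; apply: subfield_sum => // i _; apply: subfieldM => //.
    by apply: QF; case: (cc i).
  have [y1 _ y0] := hy k.
  have -> : \sum_j y k j * s j x = \sum_j y k j * s j d.
    under [RHS]eq_bigr do rewrite rmorphB mulrBr rmorph_sum mulr_sumr.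
    rewrite sumrB exchange_big /= [X in _ - X]big1 ?subr0 // => i _.
    transitivity (c i k * \sum_j y k j * s j (b i k)); last by rewrite y0 mulr0.
    rewrite mulr_sumr; apply: eq_bigr => j _.
    by rewrite rmorphM mulrCA; have [Qc _] := cc i; case: (Qc k) => q _ <-; rewrite fmorph_rat.
  apply: le_lt_trans (av_sum _ _ _ _) _.
  apply: le_lt_trans (_ : _ <= m%:R * v d) _.
    rewrite -[m in m%:R]card_ord -sumr_const mulr_suml; apply: ler_sum => j _.
    by rewrite avM ws // ler_wpM2r // (absv_ge0 hv).
  apply: le_lt_trans (_ : _ <= m.+1%:R * v d) _.
    by rewrite ler_wpM2r ?(absv_ge0 hv) // ler_nat.
  by rewrite mulrC -ltr_pdivlMr.
(* The right inverse [Z] of [S] recovers the whole vector [y k] from finitely many sums, those over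
   the basis [e]. Once these are smaller than [C^-1], no entry of [y k] can equal 1. *)
pose S : 'M[algC]_(m, n) := \matrix_(j, i) s j (e i).
have /row_freeP[Z SZ] : row_free S.
  apply: inj_row_free => u uS; apply/rowP => j; rewrite mxE.
  apply: (@embedding_independence _ s F [set: 'I_m]%SET (u 0)) => //.
    by move=> i i' _ _; exact: sep.
  case: he => _ spane _ => _ /spane[c [Qc ->]].
  under eq_bigr do rewrite rmorph_sum mulr_sumr.
  rewrite exchange_big big1 //= => i _.
  have /rowP/(_ i) := uS; rewrite !mxE => h.
  transitivity (c i * \sum_j' u 0 j' * S j' i); last by rewrite h mulr0.
  rewrite mulr_sumr; apply: eq_big => [j'|j' _]; first by rewrite inE.
  by rewrite mxE rmorphM mulrCA; case: (Qc i) => q _ <-; rewrite fmorph_rat.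
pose C := 1 + \sum_i \sum_j w (Z i j).
have C0 : 0 < C by rewrite ltr_pwDl // !sumr_ge0 // => i _; rewrite sumr_ge0 // => j _; exact: av_ge0.
have Fe i : F (e i) by case: he.
have /choice[N hN] (i : 'I_n) : exists N, forall k, (N <= k)%N ->
    w (\sum_j y k j * s j (e i)) < C^-1.
  by apply: small => //; rewrite invr_gt0.
pose k := \max_i N i.
have hk i : w (\sum_j y k j * s j (e i)) < C^-1 by apply: hN; exact: leq_bigmax.
have [_ [j0 yj0] _] := hy k.
have : w (y k j0) < 1.
  have -> : y k j0 = \sum_i (\sum_j y k j * s j (e i)) * Z i j0.
    have : (\row_j y k j) *m S *m Z = \row_j y k j by rewrite -mulmxA SZ mulmx1.
    move=> /rowP/(_ j0); rewrite !mxE => <-; apply: eq_bigr => i _.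
    by rewrite mxE; congr (_ * _); apply: eq_bigr => j _; rewrite !mxE.
  apply: le_lt_trans (av_sum _ _ _ _) _.
  apply: le_lt_trans (_ : _ <= C^-1 * \sum_i \sum_j w (Z i j)) _.
    rewrite mulr_sumr; apply: ler_sum => i _; rewrite avM.
    apply: ler_pM; rewrite ?av_ge0 ?(ltW (hk i)) //.
    by rewrite (bigD1 j0) //= lerDl sumr_ge0 // => j _; exact: av_ge0.
  by rewrite mulrC ltr_pdivrMr // mul1r /C ltrDr.
by rewrite yj0 av1 ltxx.
Qed.

(** * Weak approximation and finiteness of the places above a rational one *)

Lemma bernoulli (R : realType) (s : R) n : 0 <= s -> 1 + s *+ n <= (1 + s) ^+ n.
Proof.
move=> s0; elim: n => [|n IHn]; first by rewrite mulr0n addr0 expr0.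
rewrite exprS; apply: le_trans (_ : (1 + s) * (1 + s *+ n) <= _); last first.
  by rewrite ler_pM2l // ltr_pwDl.
rewrite mulrDl mul1r mulrDr mulr1 mulrS addrACA -!addrA lerD2l lerD2l.
by rewrite lerDl mulr_ge0 // mulrn_wge0.
Qed.

Lemma expr_unbounded (R : realType) (t B : R) : 1 < t -> exists N, forall k, (N <= k)%N -> B < t ^+ k.
Proof.
move=> t1; have s0 : 0 < t - 1 by rewrite subr_gt0.
exists (Num.bound `|B / (t - 1)|) => k hk.
have -> : t = 1 + (t - 1) by rewrite addrC subrK.
apply: lt_le_trans (bernoulli _ (ltW s0)); rewrite -mulr_natr.
have : B / (t - 1) < k%:R.
  apply: le_lt_trans (ler_norm _) _; apply: lt_le_trans (archi_boundP (normr_ge0 _)) _.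
  by rewrite ler_nat.
rewrite ltr_pdivrMr // mulrC => h; apply: lt_trans h _.
by rewrite ltrDr ltr01.
Qed.

Lemma expr_small (R : realType) (t eps : R) : 0 <= t -> t < 1 -> 0 < eps ->
  exists N, forall k, (N <= k)%N -> t ^+ k < eps.
Proof.
move=> t0 t1 eps0; have [->|tn] := eqVneq t 0.
  by exists 1%N => -[//|k] _; rewrite exprS mul0r.
have tp : 0 < t by rewrite lt_def tn.
have [|N hN] := @expr_unbounded R t^-1 eps^-1; first by rewrite invf_gt1.
exists N => k /hN; rewrite exprVn ltf_pV2 ?posrE ?exprn_gt0 //.
Qed.

Section WeakApproximation.
Variables (R : realType) (F : set algC) (pi : algC) (rho : R).
Hypotheses (hF : is_subfield F) (Qpi : QQ pi) (rho1 : 1 < rho).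

(** Prescribing the value [rho > 1] at one rational normalizes the absolute values: distinct ones
    cannot be powers of each other. *)
Definition above (v : algC -> R) := absolute_value F v /\ v pi = rho.

Let Fpi : F pi. Proof. exact: QQ_sub Qpi. Qed.

(** Once [v' z < v z], a power of [z] makes the ratio of the two values exceed [rho], and a power of
    [pi], which scales both by the same power of [rho], places 1 strictly between them. *)
Lemma separate_two v v' : above v -> above v' -> v <> v' ->
  exists y, [/\ F y, 1 < v y & v' y < 1].
Proof.
move=> [hv vpi] [hv' vpi'] ne.
have [z Fz zz] : exists2 z, F z & v' z < v z.
  apply: contrapT => no; apply: ne; apply/funext => x.
  have [Fx|Fx] := pselect (F x); last by case: hv => -> //; case: hv' => ->.
  have [->|x0] := eqVneq x 0; first by rewrite !(absv0 hF).
  have [||//] := ltrgtP (v x) (v' x) => lt; exfalso; apply: no; last by exists x.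
  exists x^-1; first exact: subfieldV.
  rewrite !(absvV hF) // ltf_pV2 // posrE ?(absv_gt0 hv) ?(absv_gt0 hv') //.
have b0 : 0 < v z by apply: le_lt_trans zz; exact: (absv_ge0 hv').
have z0 : z != 0 by rewrite -(absv_gt0 hv).
have a0 : 0 < v' z by rewrite (absv_gt0 hv').
have rho0 : 0 < rho by apply: lt_trans rho1.
have [|m hm] := @expr_unbounded R (v z / v' z) rho; first by rewrite ltr_pdivlMr // mul1r.
have {hm} := hm m (leqnn m); set A := v' z ^+ m; set B := v z ^+ m.
have A0 : 0 < A by rewrite exprn_gt0.
rewrite expr_div_n -/A -/B ltr_pdivlMr // => AB.
(* The factor [rho ^+ N] brings the smaller value above 1, so the least exponent [n] is positive and
   its predecessor falls short. *)
have [N /(_ N (leqnn N)) hN] := @expr_unbounded R rho A^-1 rho1.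
have ex : exists n, A * rho ^+ N < rho ^+ n.
  by have [n /(_ n (leqnn n)) hn] := @expr_unbounded R rho (A * rho ^+ N) rho1; exists n.
have [n hn nmin] := ex_minnP ex.
have n0 : (0 < n)%N.
  rewrite lt0n; apply/eqP => n0; move: hn; rewrite n0 expr0 mulrC -ltr_pdivlMr // div1r.
  by rewrite ltNge ltW.
have hn' : rho ^+ n <= rho * (A * rho ^+ N).
  rewrite -[in leLHS](prednK n0) exprS ler_pM2l // leNgt.
  by apply/negP => /nmin; rewrite -ltnS prednK // ltnn.
have rn : 0 < rho ^+ n by rewrite exprn_gt0.
have Fy : F (z ^+ m * pi ^+ N) by apply: subfieldM => //; exact: subfieldX.
have Fpn : F (pi ^+ n) by exact: subfieldX.
have vy u : absolute_value F u -> u pi = rho ->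
    u (z ^+ m * pi ^+ N / pi ^+ n) = u z ^+ m * rho ^+ N / rho ^+ n.
  move=> hu upi; rewrite (absvM hu Fy (subfieldV hF Fpn)) (absvV hF hu Fpn).
  by rewrite (absvM hu) ?(absvX hF hu) ?upi //; exact: subfieldX.
exists (z ^+ m * pi ^+ N / pi ^+ n); split; first exact: subfield_div.
  rewrite vy // ltr_pdivlMr // mul1r; apply: le_lt_trans hn' _.
  by rewrite mulrA ltr_pM2r // exprn_gt0.
by rewrite vy // ltr_pdivrMr // mul1r.
Qed.

Let eventually_all (T : eqType) (s : seq T) (P : T -> nat -> Prop) :
  (forall x, x \in s -> exists N, forall k, (N <= k)%N -> P x k) ->
  exists N, forall k, (N <= k)%N -> forall x, x \in s -> P x k.
Proof.
elim: s => [|x s IHs] h; first by exists 0%N.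
have [|N1 h1] := IHs; first by move=> y ys; apply: h; rewrite inE ys orbT.
have [N2 h2] := h x (mem_head _ _).
exists (maxn N1 N2) => k; rewrite geq_max => /andP[k1 k2] y.
by rewrite inE => /orP[/eqP->|]; [exact: h2|exact: h1].
Qed.

Lemma separate_many v (s : seq (algC -> R)) : above v ->
  (forall v', v' \in s -> above v' /\ v <> v') ->
  exists y, [/\ F y, 1 < v y & forall v', v' \in s -> v' y < 1].
Proof.
move=> av; have hv := av.1; elim: s => [_|v' s IHs hs].
  by exists pi; split=> //; rewrite av.2.
have [|y [Fy vy sy]] := IHs; first by move=> u us; apply: hs; rewrite inE us orbT.
have [av' ne] := hs _ (mem_head _ _); have hv' := av'.1.
have [z [Fz vz v'z]] := separate_two av av' ne.
have above_s u : u \in s -> absolute_value F u.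
  by move=> us; have [|[]] := hs u; rewrite // inE us orbT.
have FX n : F (y ^+ n) by exact: subfieldX.
have [v'y|v'y] := leP (v' y) 1.
  have [|N hN] := @eventually_all _ s (fun u k => u (y ^+ k * z) < 1).
    move=> u us; have hu := above_s u us.
    have [|N hN] := @expr_small R (u y) (1 + u z)^-1 (absv_ge0 hu _) (sy _ us).
      by rewrite invr_gt0 ltr_pwDl // (absv_ge0 hu).
    exists N => k /hN; rewrite (absvM hu) // (absvX hF hu) //.
    have uz : 0 < 1 + u z by rewrite ltr_pwDl // (absv_ge0 hu).
    move=> h; apply: le_lt_trans (_ : _ <= u y ^+ k * (1 + u z)) _.
      by rewrite ler_wpM2l ?lerDr // exprn_ge0 // (absv_ge0 hu).
    by rewrite -ltr_pdivlMr // div1r.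
  exists (y ^+ N * z); split; first exact: subfieldM.
    rewrite (absvM hv) // (absvX hF hv) //; apply: lt_le_trans vz _.
    by rewrite ler_peMl ?(absv_ge0 hv) // exprn_ege1 // ltW.
  move=> u; rewrite inE => /orP[/eqP->|us]; last exact: hN.
  rewrite (absvM hv') // (absvX hF hv') //; apply: le_lt_trans v'z.
  by rewrite ler_piMl ?(absv_ge0 hv') // exprn_ile1 // (absv_ge0 hv').
(* Here [y] is large at [v'] too. The element [t k] tends to 1 where [y] exceeds 1 and to 0 where
   [y] is below 1, so [t k * z] inherits the sizes of [z] at [v] and [v'] and becomes small on
   [s]. *)
pose t k := y ^+ k / (1 + y ^+ k).
have F1 k : F (1 + y ^+ k) by apply: subfieldD => //; exact: subfield1.
have Ft k : F (t k) by exact: subfield_div.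
have F1' := subfield1 hF.
have tE (u : algC -> R) k : absolute_value F u -> u (t k) = u y ^+ k / u (1 + y ^+ k).
  by move=> hu; rewrite (absvM hu) ?(absvV hF hu) ?(absvX hF hu) //; exact: subfieldV.
have ub (u : algC -> R) k : absolute_value F u -> u (1 + y ^+ k) <= 1 + u y ^+ k.
  move=> hu; apply: le_trans (absvD hu F1' (FX k)) _.
  by rewrite (absv1 hF hu) (absvX hF hu).
have lb (u : algC -> R) k : absolute_value F u -> u y ^+ k - 1 <= u (1 + y ^+ k).
  move=> hu; rewrite lerBlDr -(absvX hF hu) //.
  have {1}-> : y ^+ k = (1 + y ^+ k) - 1 by rewrite addrC addKr.
  by apply: le_trans (absvB hF hu (F1 k) F1') _; rewrite (absv1 hF hu).
have lb1 (u : algC -> R) k : absolute_value F u -> 1 - u y ^+ k <= u (1 + y ^+ k).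
  move=> hu; rewrite lerBlDr -(absvX hF hu) // -[leLHS](absv1 hF hu).
  have {1}-> : 1 = (1 + y ^+ k) - y ^+ k by rewrite addrK.
  exact: (absvB hF hu).
have [N1 h1] : exists N, forall k, (N <= k)%N -> 1 < v (t k * z).
  have [N hN] := expr_unbounded (v z - 1)^-1 vy; exists N.+1 => k Nk; move: (hN k (ltnW Nk)).
  have vz1 : 0 < v z - 1 by rewrite subr_gt0.
  rewrite -div1r ltr_pdivrMr // mulrBr mulr1 ltrBrDr => h.
  have Y0 : 0 <= v y ^+ k by rewrite exprn_ge0 // (absv_ge0 hv).
  have d0 : 0 < v (1 + y ^+ k).
    apply: lt_le_trans (lb _ k hv); rewrite subr_gt0 exprn_egt1 //.
    by rewrite -lt0n (leq_ltn_trans _ Nk).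
  rewrite (absvM hv) // tE // mulrAC ltr_pdivlMr // mul1r.
  exact: le_lt_trans (ub _ _ hv) h.
have [N2 h2] : exists N, forall k, (N <= k)%N -> v' (t k * z) < 1.
  have [N hN] := expr_unbounded (1 - v' z)^-1 v'y; exists N => k /hN.
  have z1 : 0 < 1 - v' z by rewrite subr_gt0.
  rewrite -div1r ltr_pdivrMr // mulrBr mulr1 ltrBrDr => h.
  have Y0 : 0 <= v' y ^+ k * v' z by rewrite mulr_ge0 ?exprn_ge0 // (absv_ge0 hv').
  have d0 : 0 < v' y ^+ k - 1 by rewrite subr_gt0; apply: le_lt_trans h; rewrite lerDl.
  have d1 := lt_le_trans d0 (lb _ k hv').
  rewrite (absvM hv') // tE // mulrAC ltr_pdivrMr // mul1r.
  by apply: lt_le_trans (lb _ _ hv'); rewrite ltrBrDr addrC.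
have [|N3 h3] := @eventually_all _ s (fun u k => u (t k * z) < 1).
  move=> u us; have hu := above_s u us.
  have uz : 0 < 1 + u z by rewrite ltr_pwDl // (absv_ge0 hu).
  have [|N hN] := @expr_small R (u y) (1 + u z)^-1 (absv_ge0 hu _) (sy _ us).
    by rewrite invr_gt0.
  exists N => k /hN; rewrite -div1r ltr_pdivlMr // mulrDr mulr1 => h.
  have Y0 : 0 <= u y ^+ k * u z by rewrite mulr_ge0 ?exprn_ge0 // (absv_ge0 hu).
  have d0 : 0 < 1 - u y ^+ k by rewrite subr_gt0; apply: le_lt_trans h; rewrite lerDl.
  have d1 := lt_le_trans d0 (lb1 _ k hu).
  rewrite (absvM hu) // tE // mulrAC ltr_pdivrMr // mul1r.
  by apply: lt_le_trans (lb1 _ _ hu); rewrite ltrBrDr addrC.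
exists (t (maxn N1 (maxn N2 N3)) * z); split; first exact: subfieldM.
  by apply: h1; exact: leq_maxl.
move=> u; rewrite inE => /orP[/eqP->|us].
  by apply: h2; rewrite !leq_max leqnn orbT.
by apply: h3 => //; rewrite !leq_max leqnn !orbT.
Qed.

(** High powers of elements [y j] that are large at [V j] and small at the others are independent
    over [QQ]: in a relation, the term with the largest coefficient dominates at its own absolute
    value. The coefficients can be compared because all the [V j] agree on [QQ]. *)
Lemma card_above n (e : 'I_n -> algC) (vs : seq (algC -> R)) :
    is_basis QQ F e -> (forall v, v \in vs -> above v) ->
    (forall v v', v \in vs -> v' \in vs -> forall q, QQ q -> v q = v' q) ->
  uniq vs -> (size vs <= n)%N.
Proof.
move=> [Fe span _] habove agree uvs; rewrite leqNgt; apply/negP => nm.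
pose m := size vs; pose V (i : 'I_m) := nth (fun=> 0) vs i.
have Vin i : V i \in vs by rewrite mem_nth.
have hV i : absolute_value F (V i) by have [] := habove _ (Vin i).
have sepV (i : 'I_m) : exists y, [/\ F y, 1 < V i y & forall j, j != i -> V j y < 1].
  have [|v'|y [Fy y1 ys]] := @separate_many (V i) (rem (V i) vs); first exact: habove.
    rewrite mem_rem_uniq // inE => /andP[/eqP ne v's]; split; first exact: habove.
    by move=> e'; apply: ne; rewrite e'.
  exists y; split => // j ji; apply: ys; rewrite mem_rem_uniq // inE Vin andbT.
  by rewrite nth_uniq.
have /choice[y hy] := sepV.
have M0 : 0 < m%:R :> R by rewrite ltr0n; exact: leq_ltn_trans nm.
have [|N hN] := @eventually_all _ (enum {: 'I_m * 'I_m})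
    (fun ij k => ij.1 != ij.2 -> V ij.1 (y ij.2) ^+ k < m%:R^-1).
  move=> [i j] _ /=; have [<-|ij] := eqVneq i j; first by exists 0%N => k _ /eqP.
  have [||N hN] := @expr_small R (V i (y j)) m%:R^-1 (absv_ge0 (hV i) _).
  - by have [_ _ h] := hy j; exact: h.
  - by rewrite invr_gt0.
  - by exists N => k /hN.
have {}hN i j : i != j -> V i (y j) ^+ N < m%:R^-1.
  by move=> ij; apply: (hN N (leqnn N) (i, j)); rewrite // mem_enum.
have Fy j : F (y j) by case: (hy j).
have FX j : F (y j ^+ N) by exact: subfieldX.
have /choice[A hA] (j : 'I_m) := span _ (FX j).
have [//|c [Qc [i0 c0] hc]] := @subfield_relation QQ n m A QQ_subfield (fun i j => (hA i).1 j).
have QF : QQ `<=` F by exact: QQ_sub.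
have rel : \sum_j c j * y j ^+ N = 0.
  under eq_bigr => j _ do rewrite (hA j).2 mulr_sumr.
  rewrite exchange_big big1 //= => i _.
  under eq_bigr do rewrite mulrA.
  by rewrite -mulr_suml hc mul0r.
have [i _ imax] := @Order.TotalTheory.arg_maxP _ R _ i0 xpredT (fun j => V i0 (c j)) isT.
have cV j l k : V j (c k) = V l (c k) by apply: agree.
have ci : 0 < V i (c i).
  rewrite (cV i i0); apply: lt_le_trans (imax i0 isT).
  by rewrite (absv_gt0 (hV i0)) //; exact: QF.
have Fc j : F (c j) by exact: QF.
have Fcy j : F (c j * y j ^+ N) by exact: subfieldM.
move: rel; rewrite (bigD1 i) //= => /eqP; rewrite addr_eq0 => /eqP /(congr1 (V i)).
rewrite (absvN hF (hV i)); last by apply: subfield_sum.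
rewrite (absvM (hV i)) // (absvX hF (hV i)) // => E.
have : V i (c i) * V i (y i) ^+ N <= V i (c i) * ((m.-1)%:R / m%:R).
  rewrite E; apply: le_trans (absv_sum hF (hV i) _ (fun j _ => Fcy j)) _.
  rewrite mulrCA.
  apply: le_trans (_ : \sum_(j < m | j != i) V i (c i) / m%:R <= _); last first.
    by rewrite sumr_const cardC1 card_ord mulr_natl.
  apply: ler_sum => j ji; rewrite (absvM (hV i)) // (absvX hF (hV i)) //.
  apply: ler_pM; rewrite ?exprn_ge0 ?(absv_ge0 (hV i)) //.
    by rewrite !(cV i i0); exact: imax.
  by apply/ltW/hN; rewrite eq_sym.
rewrite ler_pM2l //; apply/negP; rewrite -ltNge.
have [_ y1 _] := hy i; apply: lt_le_trans (exprn_ege1 _ (ltW y1)).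
rewrite ltr_pdivrMr // mul1r ltr_nat prednK //; move: M0; rewrite ltr0n.
by [].
Qed.

Lemma finite_above n (e : 'I_n -> algC) (A : set (algC -> R)) :
    is_basis QQ F e -> (forall v, A v -> above v) ->
    (forall v v', A v -> A v' -> forall q, QQ q -> v q = v' q) ->
  finite_set A.
Proof.
move=> he hA agree; apply: contrapT => /(@infinite_set_fset _ _ n.+1)[B BA].
apply/negP; rewrite -leqNgt; apply: (card_above he) => [v vB|v v' vB v'B|].
- exact/hA/BA.
- by apply: agree; exact: BA.
- exact: finmap.fset_uniq.
Qed.

End WeakApproximation.

(** For [t > 1], the square of Bernoulli's inequality makes [t ^+ (n * 2)] grow quadratically. *)
Lemma le1_of_linear_growth (R : realType) (t : R) : 0 <= t ->
  (forall n, t ^+ n <= n.+1%:R) -> t <= 1.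
Proof.
move=> t0 h; rewrite leNgt; apply/negP => t1.
have s0 : 0 < t - 1 by rewrite subr_gt0.
pose n := Num.bound ((t - 1) ^- 2 * 2%:R).
have hn : (t - 1) ^- 2 * 2%:R < n%:R.
  by apply: archi_boundP; rewrite mulr_ge0 // invr_ge0 exprn_ge0 // ltW.
have := h (n * 2)%N; rewrite exprM; apply/negP; rewrite -ltNge.
have : (1 + (t - 1) *+ n) ^+ 2 <= t ^+ n ^+ 2.
  have t1' : 1 + (t - 1) = t by rewrite addrC subrK.
  have := bernoulli n (ltW s0); rewrite t1' => hb.
  by rewrite lerXn2r // nnegrE ?exprn_ge0 // addr_ge0 // mulrn_wge0 // ltW.
apply: lt_le_trans; set s := t - 1 in s0 hn *; rewrite -(mulr_natr s).
have : 2%:R < n%:R * s ^+ 2.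
  by move: hn; rewrite mulrC ltr_pdivrMr ?exprn_gt0.
rewrite -[(n * 2).+1%:R]natr1 natrM; set m : R := n%:R => hs.
have m0 : 0 < m by rewrite -(pmulr_lgt0 _ (exprn_gt0 2 s0)); apply: lt_trans hs.
have : m * 2 < m * (m * s ^+ 2) by rewrite ltr_pM2l.
have : 0 < s * m by rewrite mulr_gt0.
by nra.
Qed.

(** The binomial expansion of an [n]-th power has [n.+1] terms, with coefficients of absolute value
    at most 1, so the powers of [v (x + y) / M] grow at most linearly. *)
Lemma nonarchimedean (R : realType) (F : set algC) (v : algC -> R) :
    is_subfield F -> absolute_value F v -> (forall n, v n%:R <= 1) ->
  forall x y, F x -> F y -> v (x + y) <= Num.max (v x) (v y).
Proof.
move=> hF hv vn x y Fx Fy; set M := Num.max _ _.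
have M0 : 0 <= M by rewrite le_max (absv_ge0 hv).
have xM : v x <= M by rewrite le_max lexx.
have yM : v y <= M by rewrite le_max lexx orbT.
have [Mz|Mn] := eqVneq M 0.
  apply: le_trans (absvD hv Fx Fy) _; rewrite Mz in xM yM *.
  by rewrite -[leRHS]addr0 lerD.
have Mp : 0 < M by rewrite lt_def Mn.
rewrite -[leRHS]mul1r -ler_pdivrMr //.
apply: le1_of_linear_growth => [|n].
  by rewrite divr_ge0 // (absv_ge0 hv).
have FX z k : F z -> F (z ^+ k) by exact: subfieldX.
rewrite expr_div_n ler_pdivrMr ?exprn_gt0 // -(absvX hF hv); last exact: subfieldD.
have Ft (i : 'I_n.+1) : F (x ^+ (n - i) * y ^+ i *+ 'C(n, i)).
  by rewrite -mulr_natr; apply: subfieldM => //; [apply: subfieldM => //; exact: FX|exact: subfield_nat].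
rewrite exprDn; apply: le_trans (absv_sum hF hv _ (fun i _ => Ft i)) _.
rewrite -[n.+1 in leRHS]card_ord -sumr_const mulr_suml; apply: ler_sum => i _.
have F1 : F (x ^+ (n - i) * y ^+ i) by apply: subfieldM => //; exact: FX.
rewrite -mulr_natr (absvM hv F1 (subfield_nat hF _)) mul1r.
apply: le_trans (_ : v (x ^+ (n - i) * y ^+ i) * 1 <= _).
  by rewrite ler_wpM2l ?(absv_ge0 hv).
rewrite mulr1 (absvM hv) ?(absvX hF hv) //; [|exact: FX|exact: FX].
have -> : M ^+ n = M ^+ (n - i) * M ^+ i by rewrite -exprD subnK // -ltnS.
by apply: ler_pM; rewrite ?exprn_ge0 ?(absv_ge0 hv) // lerXn2r // nnegrE (absv_ge0 hv).
Qed.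

Lemma padic_abs_le1 (R : realType) p q : prime p -> ~~ (p %| `|denq q|)%N ->
  padic_abs R p q <= 1.
Proof.
move=> p_pr pd; rewrite /padic_abs; case: ifP => // _.
rewrite (@logn_coprime p `|denq q|) ?prime_coprime // expr0 div1r invf_le1.
  by rewrite exprn_ege1 // ler1n prime_gt0.
by rewrite exprn_gt0 // ltr0n prime_gt0.
Qed.

Lemma padic_abs_nat_le1 (R : realType) p n : prime p -> padic_abs R p n%:R <= 1.
Proof.
move=> p_pr; apply: padic_abs_le1 => //.
by rewrite -[n%:R]/(n%:~R) denq_int /= dvdn1; apply: contraTneq p_pr => ->.
Qed.

(** [B] is the product of the denominators in the minimal polynomial. At a prime not dividing it the
    coefficients are integral, and the monic leading term would dominate if [v a] exceeded 1. *)
Lemma almost_all_places_le1 (R : realType) a : exists2 B : nat, (0 < B)%N &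
  forall p, prime p -> ~~ (p %| B)%N -> forall F (v : algC -> R),
    is_subfield F -> F a -> absolute_value F v ->
    (forall q, v (ratr q) = padic_abs R p q) -> v a <= 1.
Proof.
have [q [Dq mq] _] := minCpolyP a.
exists (\prod_(i < size q) `|denq q`_i|)%N.
  by apply: prodn_gt0 => i; rewrite absz_gt0 denq_neq0.
move=> p p_pr pB F v hF Fa hv vq.
have vn n : v n%:R <= 1 by rewrite -(ratr_nat _ n) vq padic_abs_nat_le1.
have um := nonarchimedean hF hv vn.
have vqi i : v (ratr q`_i) <= 1.
  rewrite vq; have [iq|qi] := ltnP i (size q).
    apply: padic_abs_le1 => //; apply: contra pB => /dvdn_trans; apply.
    by rewrite (bigD1 (Ordinal iq)) //= dvdn_mulr.
  by rewrite nth_default // /padic_abs eqxx.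
rewrite leNgt; apply/negP => va.
have : root (minCpoly a) a by exact: root_minCpoly.
rewrite Dq => /rootP; rewrite horner_coef size_map_poly.
have sq : (0 < size q)%N by rewrite size_poly_gt0 monic_neq0.
move: (monicP mq); rewrite lead_coefE; case: (size q) sq => // d _ /= qd.
rewrite big_ord_recr /= coef_map /= qd rmorph1 mul1r => /eqP.
rewrite addrC addr_eq0 => /eqP /(congr1 v).
have FX k : F (a ^+ k) by exact: subfieldX.
have Fq i : F (ratr q`_i * a ^+ i) by apply: subfieldM => //; exact: subfield_rat.
rewrite (absvX hF hv) // (absvN hF hv); last first.
  by apply: subfield_sum => // i _; rewrite coef_map; exact: Fq.
case: d {qd} => [|d].
  by rewrite big_ord0 (absv0 hF hv) expr0 => /eqP; rewrite oner_eq0.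
move=> E; have : v a ^+ d.+1 <= v a ^+ d; last first.
  by rewrite exprS ger_pMl ?leNgt ?va // exprn_gt0 // (lt_trans ltr01).
rewrite E; set S := \sum_(_ < _) _; suff [] : F S /\ v S <= v a ^+ d by [].
apply: (big_ind (fun x => F x /\ v x <= v a ^+ d)) => [|x y [Fx vx] [Fy vy]|i _].
- by rewrite (absv0 hF hv) exprn_ge0 ?(absv_ge0 hv) //; split => //; exact: subfield0.
- split; first exact: subfieldD.
  by apply: le_trans (um _ _ Fx Fy) _; rewrite ge_max vx vy.
rewrite coef_map /=; split; first exact: Fq.
rewrite (absvM hv) ?(absvX hF hv) //; last exact: subfield_rat.
apply: le_trans (_ : 1 * v a ^+ i <= _).
  by rewrite ler_wpM2r // exprn_ge0 // (absv_ge0 hv).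
by rewrite mul1r ler_weXn2l ?ltW // -ltnS.
Qed.

(** * A lower bound for the height *)

(* [None] stands for the archimedean absolute value and [Some p] for a p-adic
   one; the values at [Some n], [n] not prime, are irrelevant. *)
Definition rat_place (R : realType) (o : option nat) : absval R :=
  match o with
  | None => arch_absval R
  | Some p => if pselect (prime p) is left p_pr
              then sval (cid (padic_absval_exists p_pr R)) else arch_absval R
  end.

Arguments rat_place : simpl never.

Definition prime_place (o : option nat) : bool := if o is Some p then prime p else true.

Section RatPlace.
Variable R : realType.

Lemma rat_place_padic p q : prime p ->
  rat_place R (Some p) (ratr q) = padic_abs R p q.
Proof. by rewrite /rat_place; case: pselect => // p_pr _; case: cid => w [h _] /=. Qed.

Lemma rat_place_max p x y : prime p ->
  rat_place R (Some p) (x + y) <=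
  Num.max (rat_place R (Some p) x) (rat_place R (Some p) y).
Proof. by rewrite /rat_place; case: pselect => // p_pr _; case: cid => w [_ h] /=. Qed.

Lemma rat_place_arch q : rat_place R None (ratr q) = `|ratr q|.
Proof. exact: real_cut_rat. Qed.

Lemma padic_abs_nat p l : (0 < l)%N -> padic_abs R p l%:R = (p%:R ^+ logn p l)^-1.
Proof.
move=> l0; rewrite /padic_abs pnatr_eq0 eqn0Ngt l0 /=.
have -> : l%:R = (l%:Z)%:~R :> rat by [].
by rewrite denq_int numq_int logn1 expr0 /= div1r.
Qed.

Lemma padic_abs_prime p : prime p -> padic_abs R p p%:R = p%:R^-1.
Proof. by move=> p_pr; rewrite padic_abs_nat ?prime_gt0 // logn_prime // eqxx expr1. Qed.

Lemma padic_abs_other p l : prime p -> prime l -> l != p -> padic_abs R p l%:R = 1.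
Proof.
move=> p_pr l_pr lp; rewrite padic_abs_nat ?prime_gt0 // logn_prime //.
by rewrite eq_sym (negPf lp) expr0 invr1.
Qed.

Lemma rat_place_inj o o' : prime_place o -> prime_place o' ->
  (forall q, rat_place R o (ratr q) = rat_place R o' (ratr q)) -> o = o'.
Proof.
have aux p : prime p -> ~ (forall q, rat_place R (Some p) (ratr q) = rat_place R None (ratr q)).
  move=> p_pr /(_ p%:R); rewrite rat_place_padic // rat_place_arch padic_abs_prime //.
  rewrite ratr_nat normr_nat => e; have : p%:R * p%:R^-1 = p%:R * p%:R :> R by rewrite e.
  rewrite divff ?pnatr_eq0 -?lt0n ?prime_gt0 // -natrM => /eqP.
  by rewrite eq_sym pnatr_eq1 muln_eq1 => /andP[/eqP p1 _]; rewrite p1 in p_pr.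
case: o o' => [p|] [l|] // p_pr l_pr h; last 2 first.
- by case: (aux p).
- by case: (aux l) => // q; rewrite h.
congr Some; apply: contrapT => /eqP pl; have := h p%:R.
rewrite !rat_place_padic // padic_abs_prime // padic_abs_other //.
move=> /(congr1 (fun x => x^-1)); rewrite invrK invr1 => /eqP.
by rewrite pnatr_eq1 => /eqP p1; rewrite p1 in p_pr.
Qed.

End RatPlace.

(** The finiteness of the support is essential: a finitely supported product takes the default value
    1 otherwise. *)
Lemma prod_le_fsbig (R : realType) (T : choiceType) (A : set T) (f : T -> R) (s : seq T) :
    (forall x, 1 <= f x) -> finite_set [set x | A x /\ f x != 1] -> uniq s ->
    (forall x, x \in s -> A x) ->
  \prod_(x <- s) f x <= \big[*%R/1]_(x \in A) f x.
Proof.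
move=> f1 finA us sA; set S := finite_support _ _ _.
have SE x : (x \in S) = `[< A x /\ f x != 1 >].
  rewrite /S in_finite_support.
    apply/idP/asboolP; rewrite inE => -[Ax fx]; split => //; [exact/eqP|exact/eqP].
  by apply: sub_finite_set finA => y [Ay /eqP fy].
have -> : \prod_(x <- s) f x = \prod_(x <- S | x \in s) f x.
  rewrite (bigID (fun x => f x == 1)) /= big1 ?mul1r; last by move=> x /eqP.
  rewrite -big_filter -[RHS]big_filter; apply: perm_big.
  have uS : uniq S by exact: finite_support_uniq.
  apply: uniq_perm => [||x]; rewrite ?filter_uniq //.
  rewrite !mem_filter SE; apply/andP/andP => [[fx xs]|[xs /asboolP[]]//].
  by split => //; apply/asboolP; split => //; exact: sA.
rewrite [leRHS](bigID (mem s)) /=; rewrite -[leLHS]mulr1; apply: ler_pM => //.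
  by apply: prodr_ge0 => x _; apply: le_trans (f1 x).
apply: (big_ind (fun y => 1 <= y)) => // x y x1 y1.
by rewrite -[1]mulr1 ler_pM.
Qed.

Lemma height_ge0 (R : realType) a : 0 <= height R a.
Proof. by apply: prodr_ge0 => v _; exact: powR_ge0. Qed.

Section HeightLowerBound.
Variables (R : realType) (N : galois_field) (a : algC).
Hypothesis Na : gal_set N a.
Local Notation nu := (@gal_map N).

Let QN : QQ `<=` gal_set N. Proof. by apply: QQ_sub; exact: gal_subfield. Qed.
Let F := adjoin N QQ a.
Let hF : is_subfield F. Proof. exact: adjoin_subfield. Qed.
Let Fa : F a. Proof. exact: adjoin_gen. Qed.
Let n := #|fixing N QQ : fixing N F|%g.

(** Only the archimedean place and the primes dividing [B] can contribute, and [finite_above]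
    applies to each of them. *)
Lemma places_support_finite (e : R) :
  finite_set [set v | @places R F v /\ Num.max 1 (v a) `^ ((local_degree F v)%:R / e) != 1].
Proof.
have [b hb] := adjoin_degree QQ_subfield QN Na; rewrite -/F in b hb.
have [B B0 hB] := almost_all_places_le1 R a.
pose A (o : option nat) : set (algC -> R) :=
  [set v | absolute_value F v /\ forall q, v (ratr q) = rat_place R o (ratr q)].
have finA o : prime_place o -> finite_set (A o).
  move=> po; pose c : rat := if o is Some p then p%:R^-1 else 2%:R.
  have rho1 : 1 < rat_place R o (ratr c).
    rewrite /c {c}; case: o po => [p p_pr|_].
      rewrite fmorphV avV rat_place_padic // padic_abs_prime // invrK.
      by rewrite -[1]/(1%:R) ltr_nat prime_gt1.
    by rewrite rat_place_arch ratr_nat normr_nat -[1]/(1%:R) ltr_nat.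
  apply: (finite_above hF _ rho1 hb) => [|v [hv vq]|v v' [hv vq] [hv' vq'] _ [q _ <-]].
  - by exists c.
  - by split.
  - by rewrite vq vq'.
apply: (@sub_finite_set _ _ (A None `|` \bigcup_(p in [set p | p \in primes B]) A (Some p))).
  move=> v [[hv [vq|[p [p_pr vq]]]] nt]; first by left; split => // q; rewrite rat_place_arch.
  right; exists p; last by split=> // q; rewrite rat_place_padic.
  rewrite /= mem_primes p_pr B0 /=; apply: contraNT nt => pB.
  have va := hB p p_pr pB F v hF Fa hv vq.
  by rewrite (_ : Num.max 1 (v a) = 1) ?powR1 //; apply/max_idPl.
rewrite finite_setU; split; first exact: finA.
apply: bigcup_finite; first exact: finite_seq.
by move=> p /=; rewrite mem_primes => /andP[p_pr _]; exact: finA.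
Qed.

Lemma height_ge_prod (s : seq (option nat)) : uniq s -> all prime_place s ->
  \prod_(o <- s) \prod_(g : gal_gT N) Num.max 1 (rat_place R o (nu g a)) <=
  height R a ^+ #|gal_gT N|.
Proof.
move=> us ps.
have [b hb] := adjoin_degree QQ_subfield QN Na; rewrite -/F -/n in b hb.
have [t ht] := embeddings_exist (sub_adjoin a QN) (@adjoin_sub N QQ a).
rewrite -/F -/n in t ht.
have FN : F `<=` gal_set N by exact: adjoin_sub.
pose pl o (j : 'I_n) x : R := if `[< F x >] then rat_place R o (nu (t j) x) else 0.
have plE o j x : F x -> pl o j x = rat_place R o (nu (t j) x) by move=> Fx; rewrite /pl asboolT.
have FQ q : F (ratr q) by exact: subfield_rat.
have pl_rat o j q : pl o j (ratr q) = rat_place R o (ratr q) by rewrite plE // fmorph_rat.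
have pl_abs o j : absolute_value F (pl o j).
  split => [x Fx|x Fx|x Fx|x y Fx Fy|x y Fx Fy].
  - by rewrite /pl asboolF.
  - by rewrite plE // av_ge0.
  - by rewrite plE //; split => [/eqP|->]; rewrite ?rmorph0 ?av0 // av_eq0 fmorph_eq0 => /eqP.
  - by rewrite !plE ?rmorphM ?avM //; exact: subfieldM.
  - by rewrite !plE ?rmorphD ?avD //; exact: subfieldD.
have pl_place o j : prime_place o -> places F (pl o j).
  move=> po; split=> //; case: o po => [p p_pr|_]; [right|left].
    by exists p; split=> // q; rewrite pl_rat rat_place_padic.
  by move=> q; rewrite pl_rat rat_place_arch.
pose M (v : algC -> R) := Num.max 1 (v a).
have M1 v : 1 <= M v by rewrite /M le_max lexx.
have M0 v : 0 <= M v by apply: le_trans (M1 v).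
(* One entry for each rational place in [s] and each embedding of Q(a). A place occurs in [r] as
   often as it is induced by an embedding, hence at most [local_degree] times. *)
pose r : seq (algC -> R) := [seq pl o j | o <- s, j <- enum 'I_n].
have cardG : #|gal_gT N| = (n * #|fixing N F|)%N.
  by rewrite -(embed_card ht) fixing_QQ cardsT.
have -> : \prod_(o <- s) \prod_g Num.max 1 (rat_place R o (nu g a)) =
    (\prod_(v <- r) M v) ^+ #|fixing N F|.
  rewrite /r big_allpairs_dep /= -prodrXl; apply: eq_bigr => o _.
  have := embed_prod (fun x => Num.max 1 (rat_place R o x)) ht Fa.
  rewrite fixing_QQ; under eq_bigl do rewrite inE.
  move=> ->; congr (_ ^+ _); rewrite big_enum /=; apply: eq_bigr => j _.
  by rewrite /M plE.
rewrite cardG exprM; apply: lerXn2r; rewrite ?nnegrE.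
- by rewrite prodr_ge0.
- by rewrite exprn_ge0 // height_ge0.
have n0 : (0 < n)%N by rewrite /n indexg_gt0.
pose psi v : R := M v `^ ((local_degree F v)%:R / (degree QQ F)%:R).
have hdeg : degree QQ F = n.
  apply: (@degreeE N) => //; [exact: QQ_subfield|exact: sub_adjoin|by exists b].
have psi_n v : psi v ^+ n = M v ^+ local_degree F v.
  by rewrite -powR_mulrn ?powR_ge0 // -powRrM hdeg mulfVK ?powR_mulrn // pnatr_eq0 -lt0n.
have psi1 v : 1 <= psi v.
  by rewrite -(expr_ge1 n0 (powR_ge0 _ _)) psi_n exprn_ege1.
have count_le v : v \in r -> (count_mem v r <= local_degree F v)%N.
  move=> /allpairsP[[u j0] /= [os _ ->]]; set v0 := pl u j0.
  have po := allP ps u os.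
  pose J := [set j | pl u j == v0]%SET.
  have -> : count_mem v0 r = #|J|.
    rewrite /r count_flatten -map_comp sumnE big_map (bigD1_seq u) //=.
    rewrite big1_seq ?addn0.
      by rewrite count_map -size_filter enumT cardsE cardE /enum_mem; congr size; exact: eq_filter.
    move=> u' /andP[uu' u's]; rewrite count_map; apply/eqP; rewrite eqn0Ngt -has_count.
    apply/hasPn => j _ /=; apply/eqP => e; case/eqP: uu'.
    apply: (@rat_place_inj R _ _ (allP ps _ u's) po) => q.
    by rewrite -(pl_rat u' j) e /v0 pl_rat.
  have [Fb spanb _] := hb.
  have spanb' x : F x -> exists2 q : 'I_n -> algC, forall i, QQ (q i) & x = \sum_i q i * b i.
    by move=> /spanb[q [Qq ->]]; exists q.
  have [l [c hc]] := local_basis_exists hF (pl_abs u j0) Fb spanb'.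
  have [d hd] : [set l | exists c : 'I_l -> nat -> algC, is_local_basis F v0 c] (local_degree F v0).
    by apply: xgetPex; exists l, c.
  apply: (@embeddings_le_local_basis R F v0 (rat_place R u) #|J|
    (fun i => nu (t (enum_val i))) n b _ d) => //; first exact: pl_abs.
    move=> i x Fx; have := enum_valP i; rewrite inE => /eqP <-.
    by rewrite plE.
  move=> i i' ii'; apply: (embed_sep ht); apply: contra ii' => /eqP e.
  by apply/eqP/enum_val_inj.
have -> : \prod_(v <- r) M v = \prod_(v <- undup r) M v ^+ count_mem v r.
  by rewrite -big_undup_iterop_count.
apply: le_trans (_ : (\prod_(v <- undup r) psi v) ^+ n <= _).
  rewrite -prodrXl !big_seq; apply: ler_prod => v.
  rewrite mem_undup => vr; rewrite psi_n exprn_ge0 //=.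
  by apply: ler_weXn2l => //; exact: count_le.
apply: lerXn2r; rewrite ?nnegrE ?height_ge0 //.
  by rewrite prodr_ge0 // => v _; rewrite (le_trans ler01).
rewrite /height /height_in (adjoin_QE Na) -/F.
apply: prod_le_fsbig => //; [exact: places_support_finite|exact: undup_uniq|].
move=> v; rewrite mem_undup => /allpairsP[[u j] /= [us' _ ->]].
by apply: pl_place; exact: (allP ps).
Qed.

End HeightLowerBound.

(** * Northcott's theorem for number fields *)

Section CoefficientBound.
Variables (R : realType) (w : absval R) (K : R).
Hypothesis wD : forall x y B, w x <= B -> w y <= B -> w (x + y) <= K * B.

(** The constant [K] is 2 for the archimedean absolute value and 1 for an ultrametric one, so that
    one induction serves both. *)
Lemma coef_prod_XsubC_bound (s : seq algC) i :
  w (\prod_(x <- s) ('X - x%:P))`_i <= K ^+ size s * \prod_(x <- s) Num.max 1 (w x).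
Proof.
elim: s i => [|x s IHs] i.
  rewrite !big_nil expr0 mulr1 coef1; case: (i == 0%N); last by rewrite av0 ler01.
  by rewrite av1.
rewrite !big_cons mulrBl coefB coefXM coefCM.
have -> : K ^+ size (x :: s) * (Num.max 1 (w x) * \prod_(j <- s) Num.max 1 (w j)) =
  K * (K ^+ size s * \prod_(j <- s) Num.max 1 (w j) * Num.max 1 (w x)).
  by rewrite /= exprS; ring.
move: IHs; set P := \prod_(j <- s) ('X - _); set B := K ^+ size s * _ => IHs.
have M1 : 1 <= Num.max 1 (w x) by rewrite le_max lexx.
have B0 : 0 <= B by apply: le_trans (IHs 0%N); exact: av_ge0.
apply: wD; last first.
  rewrite avN avM mulrC; apply: ler_pM; rewrite ?av_ge0 //.
  by rewrite le_max lexx orbT.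
apply: le_trans (_ : B * 1 <= _); last by rewrite ler_wpM2l.
by rewrite mulr1; case: ifP => // _; rewrite av0.
Qed.

End CoefficientBound.

Lemma prod_primes_superset m n : (0 < m)%N -> (n %| m)%N ->
  (\prod_(p <- primes m) p ^ logn p n)%N = n.
Proof.
move=> m0 nm; have n0 : (0 < n)%N by exact: dvdn_gt0 nm.
rewrite {2}[n]prod_prime_decomp // prime_decompE big_map /=.
rewrite (bigID (fun p => p \in primes n)) /= [X in (_ * X)%N]big1_seq ?muln1.
  rewrite -big_filter; apply: perm_big; apply: uniq_perm.
  - by rewrite filter_uniq // primes_uniq.
  - exact: primes_uniq.
  - move=> p; rewrite mem_filter; apply: andb_idr.
    rewrite !mem_primes n0 m0 /= => /andP[-> pn] /=; exact: dvdn_trans nm.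
move=> p /andP[pn pm]; move: pn; rewrite -logn_gt0 -eqn0Ngt => /eqP ->.
by rewrite expn0.
Qed.

(** The p-adic factors multiply to the denominator, and the archimedean factor turns it into the
    larger of numerator and denominator. *)
Lemma rat_height_le (R : realType) (q : rat) :
  Num.max (`|numq q|%N%:R : R) (`|denq q|%N%:R) <=
  \prod_(o <- None :: map Some (primes `|denq q|)) Num.max 1 (rat_place R o (ratr q)).
Proof.
have d0 : (0 < `|denq q|)%N by rewrite absz_gt0 denq_neq0.
rewrite big_cons big_map rat_place_arch.
have h p : p \in primes `|denq q| -> Num.max 1 (rat_place R (Some p) (ratr q)) = (p ^ logn p `|denq q|)%:R.
  rewrite mem_primes => /and3P[p_pr _ pd]; rewrite rat_place_padic // /padic_abs.
  have q0 : q != 0.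
    by apply: contraTneq pd => ->; rewrite -[0]/(0%:~R) denq_int /= dvdn1; apply: contraTneq p_pr => ->.
  rewrite (negPf q0) (@logn_coprime p `|numq q|); last first.
    rewrite prime_coprime //; apply/negP => pn; have := coprime_num_den q.
    rewrite /coprime => /eqP g1; have : (p %| gcdn `|numq q| `|denq q|)%N by rewrite dvdn_gcd pn.
    by rewrite g1 dvdn1; apply/negP; apply: contraTneq p_pr => ->.
  rewrite expr0 divr1 -natrX; apply/max_idPr.
  by rewrite ler1n expn_gt0 prime_gt0.
rewrite (eq_big_seq _ h) -natr_prod prod_primes_superset // mulrC.
have den_pos : 0 < (`|denq q|%N%:R : R) by rewrite ltr0n.
have e : `|numq q|%N%:R = `|denq q|%N%:R * `|ratr q| :> R.
  have dq : (denq q)%:~R != 0 :> R by rewrite intr_eq0 denq_neq0.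
  rewrite /ratr normf_div !natr_absz !intr_norm mulrCA divff ?mulr1 //.
  by rewrite normr_eq0.
rewrite ge_max {}e ler_pM2l // le_max lexx orbT /=.
by rewrite (ler_peMr (ltW den_pos)) // le_max lexx.
Qed.

Lemma char_coef_rat (N : galois_field) a i : gal_set N a ->
  QQ (\prod_(g : gal_gT N) ('X - (gal_map g a)%:P))`_i.
Proof.
move=> Na; apply: (@fixed_QQ N).
  move: i; apply: (big_ind (fun p : {poly algC} => forall i, gal_set N p`_i)) => [j|p q hp hq j|g _ j].
  - by rewrite coef1; exact: subfield_nat (gal_subfield N) _.
  - rewrite coefM; apply: (subfield_sum (gal_subfield N)) => l _.
    exact: (subfieldM (gal_subfield N)).
  - rewrite coefB coefX coefC; apply: (subfieldB (gal_subfield N)).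
      exact: subfield_nat (gal_subfield N) _.
    by case: ifP => _; [exact: gal_stable|exact: subfield0 (gal_subfield N)].
move=> h; rewrite -[LHS]coef_map rmorph_prod /= [in RHS](reindex_inj (mulIg h)) /=.
apply: (congr1 (fun p : {poly algC} => p`_i)); apply: eq_bigr => g _; rewrite rmorphB /= map_polyX map_polyC /=.
by rewrite gal_mapM.
Qed.

(** Only the archimedean place contributes a constant, the power of 2; the p-adic coefficient bounds
    are free of constants, so the number of primes involved does not matter. *)
Lemma rat_coef_bound (R : realType) (N : galois_field) a i (q : rat) : gal_set N a ->
    (\prod_(g : gal_gT N) ('X - (gal_map g a)%:P))`_i = ratr q ->
  Num.max (`|numq q|%N%:R : R) (`|denq q|%N%:R) <=
  2 ^+ #|gal_gT N| * height R a ^+ #|gal_gT N|.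
Proof.
move=> Na Dq; apply: le_trans (rat_height_le R q) _.
set s := map Some (primes `|denq q|).
have us : uniq (None :: s).
  rewrite /= map_inj_uniq ?primes_uniq ?andbT; last by move=> x y [].
  by apply/negP => /mapP[].
have ps : all prime_place (None :: s).
  rewrite /= all_map; apply/allP => p /=; rewrite mem_primes.
  by case/andP.
apply: le_trans (_ : _ <= 2 ^+ #|gal_gT N| * \prod_(o <- None :: s)
    \prod_(g : gal_gT N) Num.max 1 (rat_place R o (gal_map g a))) _; last first.
  by rewrite ler_wpM2l ?exprn_ge0 // height_ge_prod.
have ge1 o : 1 <= \prod_(g : gal_gT N) Num.max 1 (rat_place R o (gal_map g a)).
  apply: (big_ind (fun y => 1 <= y)) => // [x y x1 y1|g _]; last by rewrite le_max lexx.
  by rewrite -[1]mulr1 ler_pM.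
have bnd (K : R) o : 1 <= K -> (forall x y B, rat_place R o x <= B -> rat_place R o y <= B ->
      rat_place R o (x + y) <= K * B) ->
    Num.max 1 (rat_place R o (ratr q)) <=
    K ^+ #|gal_gT N| * \prod_(g : gal_gT N) Num.max 1 (rat_place R o (gal_map g a)).
  move=> K1 KD; have := coef_prod_XsubC_bound KD [seq gal_map g a | g : gal_gT N] i.
  rewrite !big_image /= size_image Dq ge_max => ->; rewrite andbT.
  by apply: mulr_ege1; [exact: exprn_ege1|exact: ge1].
rewrite !big_cons mulrA; apply: ler_pM.
- by rewrite (le_trans ler01) // le_max lexx.
- by rewrite prodr_ge0 // => o _; rewrite (le_trans ler01) // le_max lexx.
- apply: bnd => [|x y B xB yB]; first by rewrite ler1n.
  by apply: le_trans (avD _ _ _) _; rewrite mulr_natl mulr2n lerD.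
rewrite /s big_map [leRHS]big_map big_seq [leRHS]big_seq; apply: ler_prod => p.
rewrite mem_primes => /andP[p_pr _].
rewrite (le_trans ler01) ?le_max ?lexx //=.
rewrite -[leRHS]mul1r -[X in X * _](expr1n _ #|gal_gT N|); apply: bnd => // x y B xB yB.
by rewrite mul1r; apply: le_trans (rat_place_max _ _ _ p_pr) _; rewrite ge_max xB.
Qed.

Lemma finite_bounded_rat (B : nat) :
  finite_set [set q : rat | (`|numq q| <= B)%N /\ (`|denq q| <= B)%N].
Proof.
pose s := [seq ((i%:Z - B%:Z)%:~R / j%:R : rat) | i <- iota 0 (B + B).+1, j <- iota 0 B.+1].
apply: (@sub_finite_set _ _ [set` s]); last exact: finite_seq.
move=> q [/= nq dq]; apply/allpairsP.
exists (absz (numq q + B%:Z), absz (denq q)).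
have nB : 0 <= numq q + B%:Z by lia.
split; rewrite ?mem_iota /=; [lia|lia|].
by rewrite gez0_abs // addrK natr_absz gtr0_norm ?denq_gt0 // divq_num_den.
Qed.

Lemma finite_roots (p : {poly algC}) : p != 0 -> finite_set [set x | root p x].
Proof.
move=> p0; have [r Dr] := closed_field_poly_normal p.
apply: (@sub_finite_set _ _ [set` r]); last exact: finite_seq.
by move=> x /=; rewrite Dr rootZ ?lead_coef_eq0 // root_prod_XsubC.
Qed.

(** The characteristic polynomials have fixed degree and rational coefficients of bounded numerator
    and denominator. There are finitely many of them, each with finitely many roots. *)
Lemma northcott_galois (R : realType) (N : galois_field) (X : R) :
  finite_set [set a | gal_set N a /\ height R a <= X].
Proof.
pose Gam := #|gal_gT N|.
pose B := Num.bound (2 ^+ Gam * `|X| ^+ Gam).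
have /finite_seqP[s Ds] := finite_bounded_rat B.
pose T := {ffun 'I_Gam.+1 -> seq_sub s}.
pose P (f : T) : {poly algC} := \poly_(i < Gam.+1) ratr (oapp (fun j => ssval (f j)) 0 (insub i)).
apply: (@sub_finite_set _ _ (\bigcup_(f in [set f | P f != 0]) [set x | root (P f) x])).
  move=> a /= [Na aX].
  pose chi : {poly algC} := \prod_(g : gal_gT N) ('X - (gal_map g a)%:P).
  have chi_size : size chi = Gam.+1.
    have -> : chi = \prod_(x <- [seq gal_map g a | g : gal_gT N]) ('X - x%:P) by rewrite big_image.
    by rewrite size_prod_XsubC size_image.
  have qex (i : 'I_Gam.+1) : exists q : rat, chi`_i = ratr q /\ q \in s.
    have [q _ Dq] := char_coef_rat i Na; exists q; split => //.
    suff : [set q : rat | (`|numq q| <= B)%N /\ (`|denq q| <= B)%N] q by rewrite Ds.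
    have /= := rat_coef_bound R Na (esym Dq).
    rewrite ge_max => /andP[nq dq].
    have hB : 2 ^+ Gam * height R a ^+ Gam < B%:R.
      apply: le_lt_trans (archi_boundP _); last by rewrite mulr_ge0 ?exprn_ge0.
      rewrite ler_wpM2l ?exprn_ge0 // lerXn2r ?nnegrE ?height_ge0 //.
      exact: le_trans aX (ler_norm _).
    split; rewrite -(ler_nat R); apply/ltW.
      exact: le_lt_trans nq hB.
    exact: le_lt_trans dq hB.
  have /choice[q hq] := qex.
  pose f : T := [ffun i => SeqSub (hq i).2].
  have Pf : P f = chi.
    apply/polyP => i; rewrite coef_poly; case: ltnP => [iG|Gi]; last by rewrite nth_default ?chi_size.
    by rewrite insubT /= ffunE /= -(hq (Ordinal iG)).1.
  exists f; rewrite /= Pf; first by rewrite -size_poly_eq0 chi_size.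
  rewrite /chi (bigD1 1%g) //= rootM root_XsubC gal_map1 // eqxx //.
by apply: bigcup_finite => [|f]; [exact: finite_finset|exact: finite_roots].
Qed.

(** * Relative discriminants *)

Lemma product_formula_rat (R : realType) (q : rat) : q != 0 ->
  `|ratr q| * \prod_(p <- primes (`|numq q| * `|denq q|)) rat_place R (Some p) (ratr q) = 1.
Proof.
move=> q0; set P := primes _.
have n0 : (0 < `|numq q|)%N by rewrite absz_gt0 numq_eq0.
have d0 : (0 < `|denq q|)%N by rewrite absz_gt0 denq_neq0.
have nd0 : (0 < `|numq q| * `|denq q|)%N by rewrite muln_gt0 n0.
have -> : \prod_(p <- P) rat_place R (Some p) (ratr q) = `|denq q|%N%:R / `|numq q|%N%:R.
  rewrite -[in X in X / _](prod_primes_superset nd0 (dvdn_mull _ (dvdnn _))).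
  rewrite -[in X in _ / X](prod_primes_superset nd0 (dvdn_mulr _ (dvdnn _))).
  rewrite !natr_prod -prodf_div; apply: eq_big_seq => p.
  rewrite mem_primes => /andP[p_pr _]; rewrite rat_place_padic // /padic_abs (negPf q0).
  by rewrite !natrX.
have e : `|ratr q| = `|numq q|%N%:R / `|denq q|%N%:R :> R.
  by rewrite /ratr normf_div !natr_absz !intr_norm.
rewrite e mulrA divfK ?divff // pnatr_eq0 -lt0n //.
Qed.

(** * Integral elements of prescribed absolute value above a prime *)

Section PadicScaling.
Variables (R : realType) (N : galois_field) (p : nat).
Hypothesis p_pr : prime p.
Local Notation nu := (@gal_map N).
Local Notation w := (rat_place R (Some p)).

Let wmax x y : w (x + y) <= Num.max (w x) (w y). Proof. exact: rat_place_max. Qed.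

Lemma padic_sum_lt I (r : seq I) (P : pred I) (f : I -> algC) B : 0 < B ->
  (forall i, P i -> w (f i) < B) -> w (\sum_(i <- r | P i) f i) < B.
Proof.
move=> B0 h; apply: (big_ind (fun x => w x < B)) => // [|x y xB yB]; first by rewrite av0.
by apply: le_lt_trans (wmax x y) _; rewrite gt_max xB.
Qed.

Lemma padic_dominant x y : w y < w x -> w (x + y) = w x.
Proof.
move=> yx; apply/eqP; rewrite eq_le; apply/andP; split.
  by apply: le_trans (wmax x y) _; rewrite ge_max lexx ltW.
rewrite leNgt; apply/negP => h; have := wmax (x + y) (- y).
by rewrite addrK avN leNgt gt_max h yx.
Qed.

Lemma padic_denq q : w (ratr q) <= 1 -> ~~ (p %| `|denq q|)%N.
Proof.
rewrite rat_place_padic // /padic_abs; case: eqVneq => [->|q0 h].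
  by rewrite -[denq 0]/(denq 0%:~R) denq_int /= dvdn1 => _; apply: contraTneq p_pr => ->.
apply/negP => pd; move: h.
rewrite (@logn_coprime p `|numq q|); last first.
  rewrite prime_coprime //; apply/negP => pn; have := coprime_num_den q.
  rewrite /coprime => /eqP g1; have : (p %| gcdn `|numq q| `|denq q|)%N by rewrite dvdn_gcd pn.
  by rewrite g1 dvdn1; apply/negP; apply: contraTneq p_pr => ->.
rewrite expr0 divr1 -natrX lern1 leqNgt -(expn0 p) ltn_exp2l ?prime_gt1 // logn_gt0.
by rewrite mem_primes p_pr pd absz_gt0 denq_neq0.
Qed.

Lemma padic_int_le1 (m : int) : w m%:~R <= 1.
Proof.
have -> : (m%:~R : algC) = ratr m%:~R by rewrite rmorph_int.
by rewrite rat_place_padic // padic_abs_le1 // denq_int /= dvdn1; apply: contraTneq p_pr => ->.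
Qed.

Lemma padic_coprime_nat m : ~~ (p %| m)%N -> w m%:R = 1.
Proof.
move=> pm; have m0 : (0 < m)%N by rewrite lt0n; apply: contraNneq pm => ->.
rewrite -ratr_nat rat_place_padic // padic_abs_nat // logn_coprime ?prime_coprime //.
by rewrite expr0 invr1.
Qed.

(** If all conjugates are p-integral, so is the characteristic polynomial, and the product [m] of
    its denominators is prime to [p]. *)
Lemma Aint_multiple y : gal_set N y -> (forall g, w (nu g y) <= 1) ->
  exists2 m : nat, ~~ (p %| m)%N & m%:R * y \in Aint.
Proof.
move=> Ny hy; pose Gam := #|gal_gT N|.
pose chi : {poly algC} := \prod_(x <- [seq nu g y | g : gal_gT N]) ('X - x%:P).
have chiE : chi = \prod_(g : gal_gT N) ('X - (nu g y)%:P) by rewrite /chi big_image.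
have chi_size : size chi = Gam.+1 by rewrite size_prod_XsubC size_image.
have chi_le i : w chi`_i <= 1.
  apply: le_trans (@coef_prod_XsubC_bound _ _ 1 _ _ i) _.
    by move=> u v B uB vB; rewrite mul1r; apply: le_trans (wmax u v) _; rewrite ge_max uB.
  rewrite expr1n mul1r big_image /= big1 // => g _.
  by apply/max_idPl; exact: hy.
have /choice[q hq] (i : nat) : exists q : rat, chi`_i = ratr q.
  by have [q _ Dq] := char_coef_rat i Ny; exists q; rewrite chiE.
pose m := (\prod_(i < Gam.+1) `|denq (q i)|)%N.
have pm : ~~ (p %| m)%N.
  apply/negP; rewrite /m; apply: (big_ind (fun n => ~ (p %| n)%N)) => [|x z hx hz|i _].
  - by rewrite dvdn1 => /eqP p1; move: p_pr; rewrite p1.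
  - by rewrite Euclid_dvdM // => /orP[].
  - by apply/negP/padic_denq; rewrite -hq.
exists m => //.
have mchi i : (i <= Gam)%N -> m%:R * chi`_i \in Num.int.
  move=> iG; rewrite hq /m (bigD1 (Ordinal (_ : i < Gam.+1)%N)) //= natrM mulrAC.
  rewrite rpredM ?rpred_nat // natr_absz gtr0_norm ?denq_gt0 //.
  by rewrite /ratr mulrC divfK ?rpred_int // intr_eq0 denq_neq0.
(* The value of [Q] at [m x] is [m ^+ Gam] times the value of [chi] at [x]; [Q] is monic with
   integer coefficients. *)
pose Q : {poly algC} := \poly_(i < Gam.+1) (m%:R ^+ (Gam - i) * chi`_i).
have chiG : chi`_Gam = 1.
  by have := monic_prod_XsubC [seq nu g y | g : gal_gT N] xpredT id; rewrite monicE lead_coefE chi_size => /eqP.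
have QG : Q`_Gam = 1 by rewrite coef_poly ltnSn subnn expr0 mul1r.
apply: (@root_monic_Aint Q).
- apply/rootP; rewrite horner_poly; transitivity (m%:R ^+ Gam * chi.[y]).
    rewrite horner_coef chi_size mulr_sumr; apply: eq_bigr => i _.
    have -> : m%:R ^+ Gam = m%:R ^+ (Gam - i) * m%:R ^+ i :> algC.
      by rewrite -exprD subnK // -ltnS.
    by rewrite exprMn; ring.
  have /rootP -> : root chi y; last by rewrite mulr0.
  by rewrite chiE (bigD1 1%g) //= rootM root_XsubC gal_map1 // eqxx.
- have sQ : size Q = Gam.+1.
    by apply: size_poly_eq; rewrite subnn expr0 mul1r chiG oner_neq0.
  by rewrite monicE lead_coefE sQ QG.
- apply/polyOverP => i; rewrite coef_poly; case: ltnP => [iG|_]; last exact: rpred0.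
  have [->|iG'] := eqVneq i Gam; first by move: QG; rewrite coef_poly ltnSn => ->; rewrite rpred1.
  have lt : (i < Gam)%N by rewrite ltn_neqAle iG' -ltnS.
  by rewrite -(prednK (_ : 0 < Gam - i)%N) ?subn_gt0 // exprSr -mulrA rpredM ?rpredX ?rpred_nat // mchi // ltnW.
Qed.

(* With [P] a monic polynomial reducing, up to a unit, to the minimal polynomial
   of [a] modulo [p], one has [|1 + x P(x)| = max(1,|x|)^(deg P + 1)] at every
   conjugate [x] of [a]; quotients of such elements realize
   [max(1,|x|)^-1] exactly. *)
Lemma padic_scaling_exists a : gal_set N a ->
  exists u, [/\ gal_set N u, adjoin N QQ a u &
    forall g, w (nu g u) = (Num.max 1 (w (nu g a)))^-1].
Proof.
move=> Na; pose Gam := #|gal_gT N|.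
pose chi : {poly algC} := \prod_(g : gal_gT N) ('X - (nu g a)%:P).
have chi_size : size chi = Gam.+1.
  have -> : chi = \prod_(x <- [seq nu g a | g : gal_gT N]) ('X - x%:P) by rewrite big_image.
  by rewrite size_prod_XsubC size_image.
have chi0 : chi != 0 by rewrite -size_poly_eq0 chi_size.
have /choice[q hq] (i : nat) : exists q : rat, chi`_i = ratr q.
  by have [q _ Dq] := char_coef_rat i Na; exists q.
have [i0 _ i0max] := @Order.TotalTheory.arg_maxP _ R _ (ord0 : 'I_Gam.+1) xpredT (fun i => w chi`_i) isT.
have ci0 : 0 < w chi`_i0.
  apply: lt_le_trans (i0max ord_max isT); rewrite av_gt0.
  have : lead_coef chi != 0 by rewrite lead_coef_eq0.
  by rewrite lead_coefE chi_size.
(* [k] is the last index of a coefficient of largest absolute value: divided by that coefficient,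
   [chi] reduces modulo [p] to a monic polynomial of degree [k], which [P] lifts. The discarded
   terms are small at integral points, so [P] is small at the integral conjugates. *)
pose good (k : 'I_Gam.+1) := w chi`_k == w chi`_i0.
have [k /eqP hk kmax] : exists2 k, good k & forall j : 'I_Gam.+1, good j -> (j <= k)%N.
  by have [k gk kmax] := @arg_maxnP _ i0 good (fun i => i) (eqxx _); exists k.
have ck0 : 0 < w chi`_k by rewrite hk.
have chk : chi`_k != 0 by rewrite -(av_gt0 w).
have le_k (i : 'I_Gam.+1) : w chi`_i <= w chi`_k by rewrite hk; exact: i0max.
have lt_k (i : 'I_Gam.+1) : (k < i)%N -> w chi`_i < w chi`_k.
  move=> ki; rewrite lt_neqAle le_k andbT hk; apply/negP => /kmax.
  by rewrite leqNgt ki.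
pose P x := \sum_(i < Gam.+1 | (i <= k)%N) chi`_i / chi`_k * x ^+ i.
have Prat x (F : set algC) : is_subfield F -> F x -> F (P x).
  move=> hF Fx; apply: subfield_sum => // i _; apply: subfieldM => //; last exact: subfieldX.
  by rewrite !hq; apply: subfield_div => //; exact: subfield_rat.
have nuP g x : nu g (P x) = P (nu g x).
  rewrite rmorph_sum; apply: eq_bigr => i _.
  by rewrite /= rmorphM rmorphXn fmorph_div !hq !fmorph_rat.
have P_small g : w (nu g a) <= 1 -> w (P (nu g a)) < 1.
  move=> a1; set x := nu g a in a1 *.
  have -> : P x = - \sum_(i < Gam.+1 | ~~ (i <= k)%N) chi`_i / chi`_k * x ^+ i.
    apply/eqP; rewrite -addr_eq0; apply/eqP.
    transitivity (\sum_(i < Gam.+1) chi`_i / chi`_k * x ^+ i).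
      by rewrite [RHS](bigID (fun i : 'I_Gam.+1 => (i <= k)%N)).
    transitivity (chi.[x] / chi`_k).
      rewrite horner_coef chi_size mulr_suml; apply: eq_bigr => i _.
      by rewrite mulrAC.
    suff /rootP-> : root chi x by rewrite mul0r.
    by rewrite /chi (bigD1 g) //= rootM root_XsubC eqxx.
  rewrite avN; apply: padic_sum_lt => // i; rewrite -ltnNge => ki.
  rewrite !avM avV avX; apply: le_lt_trans (_ : _ <= w chi`_i / w chi`_k * 1) _.
    by rewrite ler_wpM2l ?exprn_ile1 ?av_ge0 // divr_ge0 ?av_ge0.
  by rewrite mulr1 ltr_pdivrMr // mul1r lt_k.
have P_large x : 1 < w x -> w (P x) = w x ^+ k.
  move=> x1; have x0 : 0 < w x by apply: lt_trans x1.
  rewrite /P (bigD1 k) //= divff // mul1r padic_dominant avX //.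
  apply: padic_sum_lt; first by rewrite exprn_gt0.
  move=> i /andP[ik nik]; have lik : (i < k)%N by rewrite ltn_neqAle ik andbT -val_eqE in nik *.
  rewrite !avM avV avX; apply: le_lt_trans (_ : _ <= 1 * w x ^+ i) _.
    by rewrite ler_wpM2r ?exprn_ge0 ?av_ge0 // ler_pdivrMr // mul1r le_k.
  by rewrite mul1r ltr_eXn2l.
pose h m x := 1 + x ^+ m.+1 * P x.
have h_small m g : w (nu g a) <= 1 -> w (h m (nu g a)) = 1.
  move=> a1; rewrite /h padic_dominant av1 // avM avX.
  apply: le_lt_trans (_ : _ <= 1 * w (P (nu g a))) _.
    by rewrite ler_wpM2r ?exprn_ile1 ?av_ge0.
  by rewrite mul1r P_small.
have h_large m x : 1 < w x -> w (h m x) = w x ^+ (m.+1 + k).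
  move=> x1; have e : w (x ^+ m.+1 * P x) = w x ^+ (m.+1 + k) by rewrite avM avX P_large // exprD.
  by rewrite /h addrC padic_dominant e // av1 exprn_egt1 // addSn.
have hrat m x (F : set algC) : is_subfield F -> F x -> F (h m x).
  move=> hF Fx; apply: subfieldD => //; first exact: subfield1.
  by apply: subfieldM => //; [exact: subfieldX|exact: Prat].
have hN := gal_subfield N.
have QN : QQ `<=` gal_set N by exact: QQ_sub.
(* At a large conjugate [x] the two factors have sizes [w x ^+ (1 + k)] and [w x ^+ (2 + k)], so the
   unknown degree [k] cancels. *)
exists (h 0%N a / h 1%N a); split.
- by apply: subfield_div => //; exact: hrat.
- have hF : is_subfield (adjoin N QQ a) by exact: adjoin_subfield.
  by apply: subfield_div => //; apply: hrat => //; exact: adjoin_gen.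
have nuh m g : nu g (h m a) = h m (nu g a).
  by rewrite /h rmorphD rmorph1 rmorphM rmorphXn nuP.
move=> g; rewrite fmorph_div /= !nuh avM avV; have [a1|a1] := leP (w (nu g a)) 1.
  by rewrite !h_small // divr1 invr1.
have x0 : w (nu g a) != 0 by rewrite gt_eqF // (lt_trans ltr01).
rewrite !h_large // !addSn add0n [w _ ^+ k.+2]exprS invfM mulrCA divff ?mulr1 //.
by rewrite expf_neq0.
Qed.

(** The power [u ^+ n] has the right size above [p]; an integer prime to [p] removes the
    denominators at the other primes without changing that size. *)
Lemma padic_integral_scaling a n : gal_set N a ->
  exists c, [/\ adjoin N QQ a c, c != 0,
    forall i, (i <= n)%N -> c * a ^+ i \in Aint &
    forall g, w (nu g c) = (Num.max 1 (w (nu g a)))^-1 ^+ n].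
Proof.
move=> Na; have [u [Nu Fu hu]] := padic_scaling_exists Na.
have hN := gal_subfield N; have QN : QQ `<=` gal_set N by exact: QQ_sub.
have hF : is_subfield (adjoin N QQ a) by exact: adjoin_subfield.
have M1 g : 1 <= Num.max 1 (w (nu g a)) by rewrite le_max lexx.
have M0 g : 0 < Num.max 1 (w (nu g a)) by apply: lt_le_trans (M1 g).
have Nui i : gal_set N (u ^+ n * a ^+ i) by apply: subfieldM => //; exact: subfieldX.
have le1 (i : 'I_n.+1) g : w (nu g (u ^+ n * a ^+ i)) <= 1.
  rewrite rmorphM !rmorphXn avM !avX hu exprVn mulrC ler_pdivrMr ?exprn_gt0 // mul1r.
  apply: le_trans (_ : Num.max 1 (w (nu g a)) ^+ i <= _).
    by rewrite lerXn2r ?nnegrE ?av_ge0 ?(ltW (M0 g)) // le_max lexx orbT.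
  by apply: ler_weXn2l => //; rewrite -ltnS.
have /choice[m hm] (i : 'I_n.+1) : exists m : nat, ~~ (p %| m)%N /\ m%:R * (u ^+ n * a ^+ i) \in Aint.
  by have [m pm mA] := Aint_multiple (Nui i) (le1 i); exists m.
pose k := (\prod_i m i)%N.
have pk : ~~ (p %| k)%N.
  apply/negP; rewrite /k; apply: (big_ind (fun n => ~ (p %| n)%N)) => [|x z hx hz|i _].
  - by rewrite dvdn1 => /eqP p1; move: p_pr; rewrite p1.
  - by rewrite Euclid_dvdM // => /orP[].
  - by apply/negP; case: (hm i).
exists (k%:R * u ^+ n); split.
- by apply: subfieldM => //; [exact: subfield_nat|exact: subfieldX].
- have u0 : u != 0.
    rewrite -(av_gt0 w) -[u](gal_map1 Nu) hu invr_gt0; exact: M0.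
  rewrite mulf_neq0 ?expf_neq0 // pnatr_eq0; apply: contraNneq pk => ->.
  exact: dvdn0.
- move=> i; rewrite -ltnS => lt; rewrite -mulrA /k (bigD1 (Ordinal lt)) //= mulnC natrM -mulrA.
  by rewrite rpredM ?rpred_nat //; case: (hm (Ordinal lt)).
- by move=> g; rewrite rmorphM rmorph_nat rmorphXn avM padic_coprime_nat // mul1r avX hu.
Qed.

End PadicScaling.

(** * The norm of the relative discriminant against the height *)

Section RelativeDiscriminant.
Variables (R : realType) (N : galois_field) (E : set algC) (a : algC).
Hypotheses (hE : is_subfield E) (EN : E `<=` gal_set N) (Na : gal_set N a).
Local Notation nu := (@gal_map N).
Local Notation M := (adjoin N E a).
Local Notation d := #|fixing N E : fixing N M|%g.
Variable t : 'I_d -> gal_gT N.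
Hypothesis ht : embeddings_spec E M t.

Let hN := gal_subfield N.
Let QE : QQ `<=` E. Proof. exact: QQ_sub. Qed.
Let QN : QQ `<=` gal_set N. Proof. exact: QQ_sub. Qed.
Let hM : is_subfield M. Proof. exact: adjoin_subfield. Qed.
Let EM : E `<=` M. Proof. exact: sub_adjoin. Qed.
Let MN : M `<=` gal_set N. Proof. exact: adjoin_sub. Qed.

Definition vdm := Vandermonde d (\row_j nu (t j) a).

Lemma det_vdm_in : gal_set N (\det vdm).
Proof.
by apply: subfield_det => // i j; rewrite !mxE; apply: subfieldX => //; exact: gal_stable.
Qed.

Lemma det_vdm_neq0 : \det vdm != 0.
Proof. exact: (Vandermonde_neq0 Na ht). Qed.

Lemma rel_trace_in x : M x -> E (rel_trace E M x).
Proof.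
have [b hb] := adjoin_degree hE EN Na.
move=> Mx; rewrite (rel_traceE hE hM EM MN ht hb Mx).
have := trace_fixed hE EM MN (MN Mx); rewrite (embed_sum ht Mx) -mulr_natr => h.
have c0 : (#|fixing N M|%:R : algC) != 0 by rewrite pnatr_eq0 -lt0n cardG_gt0.
by rewrite -[\sum_j _](mulfK c0); apply: subfield_div => //; exact: subfield_nat.
Qed.

Lemma basis_disc_in n (b : 'I_n -> algC) : (forall i, M (b i)) -> E (basis_disc E M b).
Proof.
move=> Mb; apply: subfield_det => // i j; rewrite mxE; apply: rel_trace_in.
exact: subfieldM.
Qed.

Lemma basis_disc_power c : M c -> c != 0 ->
  basis_disc E M (fun i : 'I_d => c * a ^+ i) = (\prod_j nu (t j) c) ^+ 2 * \det vdm ^+ 2.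
Proof.
move=> Mc c0; have hb := power_basis hE EN Na ht Mc c0.
have Mca i : M (c * a ^+ i) by apply: subfieldM => //; apply: subfieldX => //; exact: adjoin_gen.
rewrite -exprMn -(det_power_matrix a t) expr2 -[X in _ * X]det_tr -det_mulmx /basis_disc.
congr (\det _); apply/matrixP => i j; rewrite !mxE.
rewrite (rel_traceE hE hM EM MN ht hb) //; last exact: subfieldM.
by apply: eq_bigr => l _; rewrite !mxE rmorphM.
Qed.

Lemma prod_conjugates_embed c : M c ->
  \prod_g nu g (\prod_j nu (t j) c) = (\prod_g nu g c) ^+ d.
Proof.
move=> Mc; under eq_bigr do rewrite rmorph_prod.
rewrite exchange_big /= -[d in RHS]card_ord -prodr_const; apply: eq_bigr => j _.
rewrite [RHS](reindex_inj (mulgI (t j))) /=; apply: eq_bigr => g _.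
by rewrite gal_mapM //; exact: MN.
Qed.

Lemma rel_norm_QQ x n : has_degree QQ E n -> E x ->
  rel_norm QQ E x ^+ #|fixing N E| = \prod_g nu g x.
Proof.
move=> [b hb] Ex; have [s hs] := embeddings_exist QE EN.
rewrite (rel_normE QQ_subfield hE QE EN hs hb Ex).
have := embed_prod id hs Ex => /= <-; rewrite fixing_QQ.
by apply: eq_bigl => g; rewrite inE.
Qed.

Lemma ideal_norm_divides q x : 0 < q ->
    ideal_span QQ [set rel_norm QQ E x | x in rel_disc E M] = ideal_span QQ [set ratr q] ->
    rel_disc E M x -> exists m : int, rel_norm QQ E x = m%:~R * ratr q.
Proof.
move=> q0 eq xD.
have : ideal_span QQ [set rel_norm QQ E x | x in rel_disc E M] (rel_norm QQ E x).
  exists 1%N, (fun=> 1), (fun=> rel_norm QQ E x); split.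
  - by move=> _; split; [exact: subfield1 QQ_subfield|exact: Aint1].
  - by move=> _; exists x.
  - by rewrite big_ord1 mul1r.
rewrite eq => -[n [r [s [hr hs ->]]]].
have rint i : r i \in Num.int.
  by have [[z _ Dz] rA] := hr i; apply: Cint_rat_Aint => //; rewrite -Dz; exact: Crat_rat.
have : \sum_(i < n) r i \in Num.int by exact: rpred_sum.
move=> /intrP[m Dm]; exists m; rewrite -Dm mulr_suml; apply: eq_bigr => i _.
by rewrite (hs i).
Qed.

(** Each of the [d!] terms of the determinant takes one entry from each column, a power of a
    conjugate of exponent at most [d.-1]. *)
Lemma det_vdm_bound (w : absval R) g :
  w (nu g (\det vdm)) <= d`!%:R * (\prod_j Num.max 1 (w (nu g (nu (t j) a)))) ^+ d.-1.
Proof.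
rewrite rmorph_sum; apply: le_trans (av_sum _ _ _ _) _.
rewrite -[d`! in leRHS](card_Sn d) -sumr_const mulr_suml; apply: ler_sum => s _.
rewrite mul1r rmorphM rmorph_prod rmorph_sign avM av_prod.
have -> : w ((-1) ^+ s) = 1 by rewrite avX avN av1 expr1n.
rewrite mul1r -prodrXl (reindex_inj (@perm_inj _ s^-1)%g) /=.
apply: ler_prod => j _; rewrite av_ge0 /= !mxE permKV rmorphXn avX.
apply: le_trans (_ : Num.max 1 (w (nu g (nu (t j) a))) ^+ (s^-1)%g j <= _).
  by rewrite lerXn2r ?nnegrE ?av_ge0 // le_max ?ler01 // lexx orbT.
apply: ler_weXn2l; first by rewrite le_max lexx.
have d0 : (0 < d)%N by rewrite indexg_gt0.
by rewrite -ltnS prednK.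
Qed.

Lemma ideal_norm_bound q : 0 < q ->
    ideal_span QQ [set rel_norm QQ E x | x in rel_disc E M] = ideal_span QQ [set ratr q] ->
  (ratr q : R) ^+ #|fixing N E| <=
  d`!%:R ^+ (2 * #|gal_gT N|) *
    (height R a ^+ #|gal_gT N|) ^+ (2 * (d * d.-1)).
Proof.
move=> q0 eq_span; set H := #|fixing N E|; set Gam := #|gal_gT N|; set k := d.-1.
(* Without a rational basis of [E] every [rel_norm] is the default 0, and the span of the norms
   could not contain the positive [q]. *)
have [[n hn]|no_basis] := pselect (exists n, has_degree QQ E n); last first.
  have norm0 x : rel_norm QQ E x = 0.
    by apply: xgetPN => _ [n [b [hb _]]]; apply: no_basis; exists n, b.
  have : ideal_span QQ [set ratr q] (ratr q).
    exists 1%N, (fun=> 1), (fun=> ratr q); split => //; last by rewrite big_ord1 mul1r.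
    by move=> _; split; [exact: subfield1 QQ_subfield|exact: Aint1].
  rewrite -eq_span => -[n [r [s [_ hs e]]]]; move: q0.
  have /eqP : (ratr q : algC) = 0.
    by rewrite e big1 // => i _; have [x _ <-] := hs i; rewrite norm0 mulr0.
  by rewrite fmorph_eq0 => /eqP ->; rewrite ltxx.
pose A o : R := \prod_(g : gal_gT N) Num.max 1 (rat_place R o (nu g a)).
have A1 o : 1 <= A o.
  apply: (big_ind (fun y => 1 <= y)) => // [x y x1 y1|g _]; last by rewrite le_max lexx.
  exact: mulr_ege1.
have A0 o : 0 < A o by apply: lt_le_trans (A1 o).
have QM : adjoin N QQ a `<=` M.
  by apply: adjoin_min => //; exact: subset_trans EM.
pose Y := \prod_g nu g (\det vdm ^+ 2).
have Ndet2 : gal_set N (\det vdm ^+ 2) by apply: subfieldX => //; exact: det_vdm_in.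
have [y _ Dy] : QQ Y.
  apply: (@fixed_QQ N); first by apply: subfield_prod => // g _; exact: gal_stable.
  move=> h; rewrite rmorph_prod /= [RHS](reindex_inj (mulIg h)) /=.
  by apply: eq_bigr => g _; rewrite gal_mapM.
have Y0 : Y != 0.
  by apply/prodf_neq0 => g _; rewrite fmorph_eq0 expf_neq0 // det_vdm_neq0.
have y0 : y != 0 by apply: contraNneq Y0 => y0; rewrite -Dy y0 rmorph0.
(* Dividing by [y] removes the p-adic sizes of the Vandermonde determinant, so only its archimedean
   size has to be bounded, in [inf]. *)
pose rho := q ^+ H / y.
have rho0 : rho != 0 by rewrite mulf_neq0 ?invr_eq0 // expf_neq0 // gt_eqF.
have local p : prime p -> (rat_place R (Some p) (ratr rho))^-1 <= A (Some p) ^+ (2 * (d * k)).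
  move=> p_pr; have [c [Fc c0 cint hc]] := padic_integral_scaling R p_pr k Na.
  have Mc : M c by exact: QM.
  have hb := power_basis hE EN Na ht Mc c0.
  have Mca i : M (c * a ^+ i) by apply: subfieldM => //; apply: subfieldX => //; exact: adjoin_gen.
  have d0 : (0 < d)%N by rewrite indexg_gt0.
  have inD : rel_disc E M (basis_disc E M (fun i : 'I_d => c * a ^+ i)).
    exists 1%N, (fun=> 1), (fun=> basis_disc E M (fun i : 'I_d => c * a ^+ i)); split.
    - by move=> _; split; [exact: subfield1|exact: Aint1].
    - move=> _; exists d, (fun i : 'I_d => c * a ^+ i); split => // i; split => //.
      by apply: cint; rewrite /k -ltnS prednK.
    - by rewrite big_ord1 mul1r.
  have [m Dm] := ideal_norm_divides q0 eq_span inD.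
  have := rel_norm_QQ hn (basis_disc_in (fun i : 'I_d => Mca i)).
  rewrite Dm basis_disc_power //; under eq_bigr do rewrite rmorphM rmorphXn.
  rewrite big_split /= prodrXl prod_conjugates_embed // -/Y -/H => eqY.
  (* The integer [m] can only lower the absolute value, so a lower bound for the norm of one
     discriminant is a lower bound for [q]. *)
  have wmq : rat_place R (Some p) (ratr q ^+ H) >=
      (A (Some p) ^+ (2 * (d * k)))^-1 * rat_place R (Some p) Y.
    apply: le_trans (_ : _ <= rat_place R (Some p) ((m%:~R * ratr q) ^+ H)) _; last first.
      rewrite exprMn avM avX ler_piMl ?av_ge0 // exprn_ile1 ?av_ge0 //.
      exact: padic_int_le1.
    rewrite eqY avM ler_wpM2r ?av_ge0 // !avX av_prod.
    under [X in _ <= X ^+ d ^+ 2]eq_bigr do rewrite hc.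
    rewrite prodrXl prodfV -/(A (Some p)) -!exprM exprVn.
    by have -> : (2 * (d * k) = k * (d * 2))%N by lia.
  rewrite -[leRHS]invrK lef_pV2 ?posrE ?invr_gt0 ?exprn_gt0 //; last by rewrite av_gt0 fmorph_eq0.
  by rewrite fmorph_div rmorphXn /= Dy avM avV ler_pdivlMr ?av_gt0.
pose P := primes (`|numq rho| * `|denq rho|).
have Pp p : p \in P -> prime p by rewrite mem_primes => /andP[].
have fin : `|ratr rho| <= \prod_(p <- P) A (Some p) ^+ (2 * (d * k)).
  have -> : `|ratr rho| = \prod_(p <- P) (rat_place R (Some p) (ratr rho))^-1.
    have e := product_formula_rat R rho0.
    have Z0 : \prod_(p <- P) rat_place R (Some p) (ratr rho) != 0.
      by apply: contra_eq_neq e => ->; rewrite mulr0 eq_sym oner_neq0.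
    by rewrite prodfV; apply: (mulIf Z0); rewrite mulVf.
  rewrite !big_seq; apply: ler_prod => p /Pp p_pr.
  by rewrite invr_ge0 av_ge0 local.
have inf : rat_place R None Y <= d`!%:R ^+ (2 * Gam) * A None ^+ (2 * (d * k)).
  rewrite av_prod; under eq_bigr do rewrite rmorphXn avX.
  rewrite prodrXl.
  have -> : A None ^+ (2 * (d * k)) =
      (\prod_g (\prod_j Num.max 1 (rat_place R None (nu g (nu (t j) a)))) ^+ k) ^+ 2.
    have -> : (2 * (d * k) = d * (k * 2))%N by lia.
    rewrite prodrXl -exprM exprM exchange_big; congr (_ ^+ _).
    rewrite -[X in _ ^+ X]card_ord -prodr_const; apply: eq_bigr => j _.
    rewrite /A (reindex_inj (mulgI (t j))) /=; apply: eq_bigr => g _.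
    by rewrite gal_mapM.
  rewrite [(2 * Gam)%N]mulnC exprM -exprMn lerXn2r ?nnegrE //.
  - by rewrite prodr_ge0 // => g _; exact: av_ge0.
  - rewrite mulr_ge0 ?exprn_ge0 // prodr_ge0 // => g _.
    by rewrite exprn_ge0 // prodr_ge0 // => j _; rewrite le_max ler01.
  have -> : d`!%:R ^+ Gam = \prod_(g : gal_gT N) d`!%:R :> R by rewrite prodr_const.
  rewrite -big_split; apply: ler_prod => g _.
  by apply/andP; split; [exact: av_ge0|exact: (det_vdm_bound (rat_place R None))].
have -> : (ratr q : R) ^+ H = rat_place R None Y * `|ratr rho|.
  rewrite -Dy rat_place_arch -normrM -rmorphM /rho mulrCA divff // mulr1 rmorphXn /=.
  by rewrite ger0_norm // exprn_ge0 // ler0q ltW.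
apply: le_trans (ler_pM _ _ inf fin) _; rewrite ?av_ge0 //.
rewrite -mulrA ler_wpM2l ?exprn_ge0 // prodrXl -exprMn lerXn2r ?nnegrE //.
- by rewrite mulr_ge0 ?(ltW (A0 _)) // prodr_ge0 // => p _; exact: ltW.
- by rewrite exprn_ge0 // height_ge0.
have us : uniq (None :: map Some P).
  rewrite /= map_inj_uniq ?primes_uniq ?andbT; last by move=> x z [].
  by apply/negP => /mapP[].
have ps : all prime_place (None :: map Some P).
  by rewrite /= all_map; apply/allP => p /Pp.
by have := height_ge_prod R Na us ps; rewrite big_cons big_map.
Qed.

End RelativeDiscriminant.

(** * The uniform bound for the root of the norm, and the conclusion *)

Lemma powR0_le1 (R : realType) (x : R) : 0 `^ x <= 1 :> R.
Proof. by have [->|x0] := eqVneq x 0; rewrite ?powRr0 // powR0 // ler01. Qed.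

(** The crude exponent [n * n] is what the root of order [m * d * (d * c)] in [disc_root_bound]
    absorbs exactly, leaving [2 ^+ (2 * e)]. *)
Lemma fact_le_exp2 n : (n`! <= 2 ^ (n * n))%N.
Proof.
elim: n => // n IHn; rewrite factS.
have -> : (n.+1 * n.+1 = n.+1 + (n + n * n))%N by lia.
rewrite expnD leq_mul //; first by rewrite ltnW // ltn_expl.
by apply: leq_trans IHn _; rewrite leq_exp2l // leq_addl.
Qed.

Lemma disc_root_bound (R : realType) (N : galois_field) (K E : set algC) (a : algC) (X : R) e :
    is_subfield K -> is_subfield E -> K `<=` E -> E `<=` gal_set N -> gal_set N a ->
    has_degree QQ K e -> height R a <= X ->
  (ratr (ideal_norm E (rel_disc E (adjoin N E a))))
    `^ ((degree K (adjoin N E a))%:R * (degree E (adjoin N E a))%:R)^-1 <=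
  (2 * Num.max 1 X) ^+ (2 * e).
Proof.
move=> hK hE KE EN Na hKe hX; set M := adjoin N E a; set Z := Num.max 1 X.
have Z1 : 1 <= Z by rewrite le_max lexx.
have Z0 : 0 <= Z by exact: le_trans Z1.
have B1 : 1 <= 2 * Z by lra.
have B0 : 0 <= 2 * Z by exact: le_trans B1.
(* If there is no positive generator, [ideal_norm] is 0 and its power is at most 1. *)
rewrite /ideal_norm; case: xgetP => [q _ [q0 eq_span]|_]; last first.
  by rewrite rmorph0; apply: le_trans (powR0_le1 _) _; rewrite exprn_ege1.
have hM : is_subfield M by exact: adjoin_subfield.
have EM : E `<=` M by exact: sub_adjoin.
have MN : M `<=` gal_set N by exact: adjoin_sub.
have KM := subset_trans KE EM.
have hd := adjoin_degree hE EN Na.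
have [t ht] := embeddings_exist EM MN.
have -> := degreeE hE hM EM MN hd.
(* At the default value 0 of the degree the exponent is 0 and the power is 1, within the bound. *)
have [->|m0] := eqVneq (degree K M) 0%N.
  by rewrite mul0r invr0 powRr0 exprn_ege1.
have hm : has_degree K M (degree K M).
  by move: m0; rewrite /degree; case: xgetP => // _ ->.
move: (degree K M) m0 hm => m m0 hm.
have := ideal_norm_bound R hE EN Na ht q0 eq_span.
set d := #|_ : _|%g in hd ht *; set c := #|fixing N M|.
have d0 : (0 < d)%N by rewrite indexg_gt0.
have c0 : (0 < c)%N by rewrite cardG_gt0.
have -> : #|fixing N E| = (d * c)%N := degree_card hE hM EM MN hd.
have cK : #|fixing N K| = (m * c)%N := degree_card hK hM KM MN hm.
have -> : #|gal_gT N| = (e * (m * c))%N.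
  rewrite -cK -(degree_card QQ_subfield hK (QQ_sub hK) (subset_trans KM MN) hKe).
  by rewrite fixing_QQ finset.cardsT.
set x := _ `^ _ => qbound.
have x0 : 0 <= x by exact: powR_ge0.
have Dq : ratr q = x ^+ (m * d) :> R.
  rewrite -powR_mulrn // -powRrM -natrM mulVf ?powRr1 ?ler0q ?(ltW q0) //.
  by rewrite pnatr_eq0 muln_eq0 negb_or m0 -lt0n.
have n0 : (0 < m * d * (d * c))%N by rewrite !muln_gt0 lt0n m0 d0 c0.
rewrite -(ler_pXn2r n0) ?nnegrE ?exprn_ge0 //.
rewrite exprM -Dq; apply: le_trans qbound _.
apply: le_trans (_ : (2 ^+ (d * d)) ^+ (2 * (e * (m * c))) *
  (Z ^+ (e * (m * c))) ^+ (2 * (d * d)) <= _).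
  apply: ler_pM; rewrite ?exprn_ge0 ?height_ge0 ?ler0n //.
    by rewrite lerXn2r ?nnegrE ?exprn_ge0 ?ler0n // -natrX ler_nat fact_le_exp2.
  apply: le_trans (_ : (Z ^+ (e * (m * c))) ^+ (2 * (d * d.-1)) <= _).
    rewrite !lerXn2r ?nnegrE ?exprn_ge0 ?height_ge0 //.
    by rewrite le_max hX orbT.
  by rewrite ler_weXn2l ?exprn_ege1 // !leq_mul2l leq_pred !orbT.
rewrite -!exprM exprMn.
have -> : (d * d * (2 * (e * (m * c))) = 2 * e * (m * d * (d * c)))%N by lia.
by have -> : (e * (m * c) * (2 * (d * d)) = 2 * e * (m * d * (d * c)))%N by lia.
Qed.

(** Reduces the inclusion of [F] in a field containing [E] to finitely many memberships, the kind of
    condition that [galois_field_exists] can meet. *)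
Lemma finite_extension_basis E F : finite_extension E F ->
  exists s : seq algC, forall N : set algC, is_subfield N -> E `<=` N ->
    (forall x, x \in s -> N x) -> F `<=` N.
Proof.
case=> _ _ _ [n [b [_ span _]]]; exists [seq b i | i <- enum 'I_n] => N hN EN hs x Fx.
have [c [Ec ->]] := span x Fx; apply: subfield_sum => // i _.
by apply: subfieldM => //; [exact: EN|apply: hs; apply: map_f; rewrite mem_enum].
Qed.

Theorem theorem3 (R : realType) (K : set algC) (K_ : nat -> set algC)
  (hK : number_field K) (hK0 : K_ 0%N = K)
  (hKfin : forall i : nat, finite_extension K (K_ i))
  (hKlt : forall i : nat, K_ i `<` K_ i.+1)
  (hinf : inf_disc R (K_ 0%N) (K_ i) (K_ i.+1) @[i --> \oo] --> +oo) :
  northcott R (\bigcup_i K_ i).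
Proof.
move=> X _; have [_ hsubK _ [e hKe]] := hK.
have hsub i : is_subfield (K_ i) by case: (hKfin i).
have KK i : K `<=` K_ i by case: (hKfin i).
have [s hs] := finite_extension_basis hK.
have galois_closure i : exists N : galois_field, K_ i `<=` gal_set N.
  have [s' hs'] := finite_extension_basis (hKfin i).
  have [N hN] := galois_field_exists (s ++ s'); exists N.
  have sN := gal_subfield N; apply: hs' => // [|x xs]; last first.
    by apply: hN; rewrite mem_cat xs orbT.
  by apply: hs => // [|x xs]; [exact: QQ_sub|apply: hN; rewrite mem_cat xs].
(* The threshold is the bound of [disc_root_bound], which depends on neither the stage nor the
   Galois closure. *)
have [i0 _ hi0] : \forall i \near \oo,
    (2 * Num.max 1 X) ^+ (2 * e) < inf_disc R (K_ 0%N) (K_ i) (K_ i.+1).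
  by move/cvgryPgt: hinf; apply.
have [N hN] := galois_closure i0.
apply: sub_finite_set (@northcott_galois R N X) => a [[j _ Ka] ha]; split=> //; apply: hN.
(* Descent on the stage: an element of [K_ j.+1] is shown to lie in [K_ j] as long as [i0 <= j], and
   for [j < i0] the field [K_ j.+1] is already inside [K_ i0]. *)
elim: j Ka => [Ka|j IHj Ka].
  by rewrite hK0 in Ka; exact: KK.
have [i0j|ji0] := leqP i0 j; last first.
  have mono k : K_ j.+1 `<=` K_ (j.+1 + k)%N.
    elim: k => [|k IHk]; first by rewrite addn0.
    by rewrite addnS; apply: subset_trans IHk _; case: (hKlt (j.+1 + k)%N).
  by rewrite -(subnKC ji0); exact: mono.
apply: IHj; apply: contrapT => Kj'a.
(* No single Galois closure contains all the stages in general; one is chosen afresh at each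
   step. *)
have [N' hN'] := galois_closure j.+1.
have KjN' : K_ j `<=` gal_set N' by apply: subset_trans hN'; case: (hKlt j).
have N'a := hN' _ Ka.
have := hi0 j i0j; apply/negP; rewrite -leNgt hK0.
apply: le_trans (disc_root_bound (hsubK) (hsub j) (KK j) KjN' N'a hKe ha).
apply: ge_inf.
  by exists 0 => _ [M [_ _ _ ->]]; exact: powR_ge0.
exists (adjoin N' (K_ j) a); split=> //; first exact: adjoin_subfield.
- split; first exact: sub_adjoin.
  by move=> /(_ a (adjoin_gen _ _))/Kj'a.
- by apply: adjoin_min => //; case: (hKlt j).
Qed.
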